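(* For $n\ge4$, let $\beta_n$ be the largest real root of the polynomial $x^n-x^{n-1}-\cdots-x+1$, and let $\lambda_n=\beta_n^{-1}$. Then for every $n\ge 4$ and $\lambda=\lambda_n$, $$\tau'_{\nu_\lambda}(+\infty)<1\le\tau'_{\nu_\lambda}(0+),$$ and hence the range of local dimensions of $\nu_\lambda$, i.e. the set of $\alpha\in\mathbb{R}$ with $E_{\nu_\lambda}(\alpha)\neq\emptyset$, contains a non-degenerate interval.
   Context: In the polynomial $x^n-x^{n-1}-\cdots-x+1$, the coefficients of $x^{n-1},\dots,x$ are all $-1$ and the constant term is $+1$. For $\lambda\in(0,1)$, the Bernoulli convolution $\nu_\lambda$ is the distribution of $\sum_{n=0}^\infty\epsilon_n\lambda^n$, where the $\epsilon_n\in\{-1,1\}$ are chosen independently with probability $1/2$ each. Equivalently, it is the unique Borel probability measure with $\nu_\lambda=\frac12\nu_\lambda\circ S_1^{-1}+\frac12\nu_\lambda\circ S_2^{-1}$, where $S_1(x)=\lambda x-1$, $S_2(x)=\lambda x+1$. Let $\mu$ be a finite Borel measure on $\mathbb{R}$ with compact support, and let $B_r(x)$ denote the closed ball of radius $r$ centered at $x$. For $q\in\mathbb{R}$ the $L^q$ spectrum of $\mu$ is $$\tau_\mu(q)=\liminf_{r\to0}\frac{\log\Theta_\mu(q;r)}{\log r},\qquad \Theta_\mu(q;r)=\sup\sum_i\mu(B_r(x_i))^q,$$ where the supremum is over all families of disjoint balls $\{B_r(x_i)\}_i$ with $x_i\in\mathrm{supp}(\mu)$; $\tau_\mu$ is concave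 in $q$. We write $\tau'_\mu(+\infty):=\lim_{q\to+\infty}\tau_\mu(q)/q$ and $\tau'_\mu(0+)$ for the right derivative of $\tau_\mu$ at $0$. For $\alpha\in\mathbb{R}$, $$E_\mu(\alpha)=\left\{x\in\mathbb{R}:\ \lim_{r\to0}\frac{\log\mu(B_r(x))}{\log r}\text{ exists and equals }\alpha\right\}.$$ *)

(* Defs.v *)
From mathcomp Require Export all_boot all_order all_algebra finmap.
From mathcomp Require Export all_classical all_reals all_analysis.

Set Implicit Arguments.
Unset Strict Implicit.
Unset Printing Implicit Defensive.

Import Order.TTheory GRing.Theory Num.Theory.
Import numFieldNormedType.Exports.

Local Open Scope classical_set_scope.
Local Open Scope ring_scope.

Definition beta_poly (R : realType) (n : nat) : {poly R} :=
  'X^n - \sum_(1 <= i < n) 'X^i + 1.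

Definition is_largest_root (R : realType) (p : {poly R}) (b : R) : Prop :=
  root p b /\ forall x, root p x -> x <= b.

(* Mutual independence: the product rule over every finite subfamily. *)
Definition mutually_independent (R : realType) d (T : measurableType d)
    (P : probability T R) (X : nat -> {RV P >-> R}) : Prop :=
  forall (J : {fset nat}) (A : nat -> set R), (forall j, measurable (A j)) ->
    P (\bigcap_(j in [set` J]) X j @^-1` A j) =
    (\prod_(j <- J) P (X j @^-1` A j))%E.

(* [nu] is the law of [S = \sum_(n >= 0) eps n * lam ^+ n], with i.i.d. fair
   signs [eps n], on some probability space. The law does not depend on that
   space, so this determines [nu] on Borel sets. *)
Definition is_bernoulli_convolution (R : realType) (lam : R)
    (nu : probability R R) : Prop :=
  exists (d : measure_display) (T : measurableType d) (P : probability T R)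
         (eps : nat -> {RV P >-> R}) (S : {RV P >-> R}),
    [/\ mutually_independent eps,
        forall n w, eps n w = 1 \/ eps n w = - 1,
        forall n, P [set w | eps n w = 1] = (2^-1)%:E /\
                  P [set w | eps n w = - 1] = (2^-1)%:E,
        forall w, series (fun n => eps n w * lam ^+ n) @ \oo --> S w &
        forall A, measurable A -> nu A = distribution P S A].

Definition msupport (R : realType) (mu : {measure set R -> \bar R}) : set R :=
  [set x | forall U, open U -> U x -> (0 < mu U)%E].

(* The balls of a disjoint family have distinct centers, so a family is
   given by its set [C] of centers. *)
Definition Lq_Theta (R : realType) (mu : {measure set R -> \bar R}) (q r : R) :
    \bar R :=
  ereal_sup [set (\esum_(x in C) poweR (mu (closed_ball x r)) q)%E |
    C in [set C : set R | C `<=` msupport mu /\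
                          trivIset C (fun x => closed_ball x r)]].

(* With [lne 0 = -oo] no junk value arises from an empty support. *)
Definition Lq_spectrum (R : realType) (mu : {measure set R -> \bar R}) (q : R) :
    \bar R :=
  limf_einf (fun r : R => lne (Lq_Theta mu q r) / (ln r)%:E)%E 0^'+.

Definition is_Lq_slope_pinfty (R : realType) (mu : {measure set R -> \bar R})
    (a : R) : Prop :=
  (Lq_spectrum mu q / q%:E)%E @[q --> +oo%R] --> a%:E.

Definition is_Lq_right_derivative0 (R : realType)
    (mu : {measure set R -> \bar R}) (b : R) : Prop :=
  ((Lq_spectrum mu q - Lq_spectrum mu 0) / q%:E)%E @[q --> 0^'+] --> b%:E.

(* Where [mu (closed_ball x r) = 0] for some [r > 0], the quotient tends to
   [+oo], so [x] is in no [local_dim_set mu alpha]. *)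
Definition local_dim_set (R : realType) (mu : {measure set R -> \bar R})
    (alpha : R) : set R :=
  [set x : R | (lne (mu (closed_ball x r)) / (ln r)%:E)%E @[r --> 0^'+]
               --> alpha%:E].

(* Main.v *)
(* Since beta is a Salem number, the distinct values of the sums of k terms +-lam^i,
   i < k, are polynomially few in each window of length O(lam^k). Hence, up to
   polynomial factors, nu(B(x, lam^k)) is 2^-k times the largest multiplicity N of a
   k-term sum near x, and the Gibbs sums of N^q over the distinct sums are
   submultiplicative for q > 0.

   Some sum occurs with multiplicity exp(g' k) for some g' > ln (2 lam): for n >= 5 the
   relation given by the polynomial itself is enough, for n = 4 ten words of length 15
   have the same sum. So balls of mass r^a with a < 1 exist and tau'(+oo) <= a. On
   the other side tau(0) = -1 and tau(1) >= 0, and the concavity of tau gives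
   tau'(0+) >= 1.

   For g between ln (2 lam) and g', q is tuned so that the mean of ln N under the
   weights N^q over the distinct sums of k terms is k g. By Markov's inequality some
   word u of length k can then be appended to a given word, with ln N(u) on the
   prescribed side of k g and with the multiplicities near the new sum under control.
   Concatenating such words of slowly growing lengths, so that the total of ln N
   follows g times the total length, produces a point of local dimension
   (ln 2 - g) / (- ln lam). *)

Require Import Defs.
From mathcomp Require Import all_boot all_order all_algebra finmap.
From mathcomp Require Import all_classical all_reals all_analysis.
From mathcomp Require Import measurable_realfun.
From mathcomp Require complex.
From mathcomp Require Import ring lra zify.

Set Implicit Arguments.
Unset Strict Implicit.
Unset Printing Implicit Defensive.

Import Order.TTheory GRing.Theory Num.Theory.
Import numFieldNormedType.Exports.

Local Open Scope ring_scope.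

(** * Polynomial remainders over roots in the unit disc *)

(** The value ln (2 lam) is the exponent of local dimension 1: (ln 2 - g) / (- ln lam) < 1 exactly
    when g > ln (2 lam). It also bounds the exponent of the mean multiplicity, as 2^k words share at
    least lam^-k distinct sums; coincidences with a larger exponent g' are thus a genuine excess
    over the mean. The obstacle is overlap. Since lam > 1/2, the mass of a ball is not a product
    along a word: words with other prefixes but close sums contribute to it. Exact multiplicities
    ([mult]) are supermultiplicative and bound masses from below; [near_mult], which counts all
    words with a close sum, bounds them from above. The blocks have to be chosen so that both grow
    at the same rate, and this is where the polynomial number of nearby distinct sums enters. The
    exponent q may vary with the block length; the errors involve it only through a lower bound
    q0. *)

Lemma Poly_synthetic_division (F : numDomainType) (z b : F) (s : seq F) :
  `|z| <= 1 -> 0 <= b -> (forall i, `|s`_i| <= b) ->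
  exists (H : {poly F}) (c : F),
    [/\ Poly s = ('X - z%:P) * H + c%:P, (size H <= size s)%N,
        forall i, `|H`_i| <= b *+ size s & `|c| <= b *+ size s].
Proof.
move=> z1 b0; elim: s => [|a s IHs] sb.
  exists 0, 0; split; rewrite ?size_poly0 ?normr0 //.
    by rewrite mulr0 addr0.
  by move=> i; rewrite coef0 normr0.
have [|H [h [PH sH Hb hb]]] := IHs; first by move=> i; exact: (sb i.+1).
exists (H * 'X + h%:P), (h * z + a); split.
- rewrite /= cons_poly_def PH polyCD polyCM; ring.
- rewrite (leq_trans (size_polyD _ _)) // geq_max.
  rewrite (leq_trans (size_polyMleq _ _)) ?size_polyX ?addn2 ?ltnS //=.
  by rewrite (leq_trans (size_polyC_leq1 _)).
- move=> i; rewrite coefD coefMX coefC; case: i => [|i] /=.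
    by rewrite add0r (le_trans hb) // mulrS lerDr.
  by rewrite addr0 (le_trans (Hb i)) // mulrS lerDr.
- rewrite (le_trans (ler_normD _ _)) //= mulrSr lerD //; last exact: (sb 0%N).
  by rewrite normrM (le_trans _ hb) // ler_piMr.
Qed.

Lemma poly_synthetic_division (F : numDomainType) (z b : F) (k : nat)
    (P : {poly F}) :
  `|z| <= 1 -> 0 <= b -> (size P <= k)%N -> (forall i, `|P`_i| <= b) ->
  exists (H : {poly F}) (c : F),
    [/\ P = ('X - z%:P) * H + c%:P, (size H <= k)%N,
        forall i, `|H`_i| <= b *+ k & `|c| <= b *+ k].
Proof.
move=> z1 b0 sP Pb; have [H [c [PH sH Hb cb]]] := Poly_synthetic_division z1 b0 Pb.
exists H, c; rewrite -{1}PH polyseqK; split=> //.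
- exact: leq_trans sH sP.
- by move=> i; rewrite (le_trans (Hb i)) // ler_wpMn2l.
- by rewrite (le_trans cb) // ler_wpMn2l.
Qed.

(** Dividing by the factors one at a time. Since [|z| <= 1], the coefficients of a Horner quotient
    are sums of at most [k] terms bounded by [b], so each division costs a factor [k], and
    rebuilding the remainder as (X - z) r + c at most doubles the bound. The [+ 1] keeps the base at
    least 1 when [k = 0]. *)
Lemma modp_prod_XsubC_bound (F : numDomainType) (rs : seq F) (k : nat) (b : F)
    (P : {poly F}) :
  (forall z, z \in rs -> `|z| <= 1) -> 0 <= b ->
  (size P <= k)%N -> (forall i, `|P`_i| <= b) ->
  exists H r : {poly F},
    [/\ P = H * \prod_(z <- rs) ('X - z%:P) + r, (size r <= size rs)%N
      & forall i, `|r`_i| <= b * (3 * k + 1)%:R ^+ size rs].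
Proof.
elim: rs b P => [|z rs IHrs] b P rs1 b0 sP Pb.
  exists P, 0; rewrite big_nil mulr1 addr0 size_poly0; split => // i.
  by rewrite coef0 normr0 mulr1.
have z1 : `|z| <= 1 by apply: rs1; rewrite mem_head.
have [P1 [c [PE sP1 P1b cb]]] := poly_synthetic_division z1 b0 sP Pb.
have bk0 : 0 <= b *+ k by rewrite mulrn_wge0.
have [|H [r [P1E sr rb]]] := IHrs (b *+ k) P1 _ bk0 sP1 P1b.
  by move=> y yrs; apply: rs1; rewrite in_cons yrs orbT.
exists H, (('X - z%:P) * r + c%:P); split.
- rewrite big_cons PE {1}P1E; ring.
- rewrite (leq_trans (size_polyD _ _)) // geq_max.
  rewrite (leq_trans (size_polyMleq _ _)) ?size_XsubC //=.
  by rewrite (leq_trans (size_polyC_leq1 _)).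
move=> i; set T := b *+ k * (3 * k + 1)%:R ^+ size rs in rb.
have T0 : 0 <= T by rewrite mulr_ge0 // exprn_ge0.
have cT : `|c| <= T.
  rewrite (le_trans cb) // /T ler_peMr // exprn_ege1 //.
  by rewrite ler1n addn1.
have -> : (('X - z%:P) * r + c%:P)`_i =
    (if i == 0%N then c else r`_i.-1) - z * r`_i.
  rewrite mulrBl coefD coefB coefXM coefCM coefC; case: eqP => _; ring.
rewrite (le_trans (ler_normB _ _)) //.
have zr : `|z * r`_i| <= T by rewrite normrM (le_trans _ (rb i)) // ler_piMl.
apply: (@le_trans _ _ (T + T)).
  by rewrite lerD //; case: ifP.
rewrite /= exprS mulrA /T -[b *+ k]mulr_natr -mulrDl ler_wpM2r ?exprn_ge0 //.
rewrite -mulrDr ler_wpM2l // -natrD ler_nat; lia.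
Qed.

(** * The polynomial and its largest root *)

Lemma mulB1_sum_exprn (A : comPzRingType) (x : A) (n : nat) : (0 < n)%N ->
  (x - 1) * \sum_(1 <= i < n) x ^+ i = x ^+ n - x.
Proof.
case: n => // n _; elim: n => [|n IHn].
  by rewrite big_geq // mulr0 expr1 subrr.
rewrite big_nat_recr //= mulrDr IHn !exprS; ring.
Qed.

(** The integer form is what makes counting possible: a bounded remainder modulo it has finitely
    many values. *)
Definition int_beta_poly (n : nat) : {poly int} :=
  'X^n - \sum_(1 <= i < n) 'X^i + 1.

Lemma map_int_beta_poly (R : realType) (n : nat) :
  map_poly intr (int_beta_poly n) = beta_poly R n.
Proof.
rewrite rmorphD rmorphB /= rmorph1 rmorph_sum /= map_polyXn; congr (_ - _ + _).
by apply: eq_bigr => i _; rewrite map_polyXn.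
Qed.

Lemma size_int_beta_poly n : (0 < n)%N -> size (int_beta_poly n) = n.+1.
Proof.
move=> n0; rewrite /int_beta_poly -addrA size_polyDl ?size_polyXn //.
rewrite ltnS (leq_trans (size_polyD _ _)) // geq_max size_poly1 n0 andbT.
rewrite size_polyN (leq_trans (size_sum _ _ _)) //.
apply/bigmax_leqP_seq => i; rewrite mem_index_iota => /andP[_ ?] _.
by rewrite size_polyXn.
Qed.

Lemma int_beta_poly_monic n : (0 < n)%N -> int_beta_poly n \is monic.
Proof.
move=> n0; rewrite monicE lead_coefE size_int_beta_poly //= /int_beta_poly.
rewrite !coefD coefN coefXn eqxx coef1 eqn0Ngt n0 addr0 coef_sum.
rewrite big_nat_cond big1 ?subr0 // => i /andP[/andP[_ il] _].
by rewrite coefXn gtn_eqF.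
Qed.

Section Beta.
Variables (R : realType) (n : nat).
Hypothesis n4 : (4 <= n)%N.
Implicit Types x y : R.

(** The factor X - 1 telescopes the geometric sum; all estimates on the roots start from this short
    form. *)
Lemma beta_polyM_XB1 : ('X - 1) * beta_poly R n =
  'X^(n.+1) - ('X^n + 'X^n) + ('X + 'X) - 1.
Proof.
rewrite /beta_poly mulrDr mulrBr mulB1_sum_exprn; last by lia.
rewrite exprS mulr1 mulrBl mul1r opprB opprD; rewrite -!addrA.
by congr (_ + (_ + _)); rewrite addrCA.
Qed.

Lemma horner_beta_poly x : (x - 1) * (beta_poly R n).[x] =
  x ^+ n.+1 - 2 * x ^+ n + 2 * x - 1.
Proof.
have /(congr1 (fun p => p.[x])) := beta_polyM_XB1.
rewrite !(hornerM, hornerD, hornerN, hornerXn, hornerX, hornerC) => ->; ring.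
Qed.

Lemma beta_poly_gt0 x : 2 <= x -> 0 < (beta_poly R n).[x].
Proof.
move=> x2; rewrite -(@pmulr_rgt0 _ (x - 1)) ?horner_beta_poly ?exprS; last by lra.
have xn : 0 <= (x - 2) * x ^+ n by rewrite mulr_ge0 ?exprn_ge0; lra.
lra.
Qed.

Variable b : R.
Hypothesis br : is_largest_root (beta_poly R n) b.

Lemma largest_root_ge x : (beta_poly R n).[x] <= 0 -> x <= 2 -> x <= b.
Proof.
move=> px x2; have [] := @poly_ivt R (beta_poly R n) x 2.
- by [].
- by rewrite px ltW // beta_poly_gt0.
- by move=> y /andP[xy _] /(br.2) /(le_trans xy).
Qed.

Lemma beta_lt2 : b < 2.
Proof.
rewrite ltNge; apply/negP => /beta_poly_gt0; have /rootP -> := br.1.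
by rewrite ltxx.
Qed.

(** By the telescoped form, (x - 1) p(x) = 2 x - 1 - (2 - x) x^n. *)
Lemma beta_ge_of_expr x : 1 < x -> x <= 2 -> 2 * x - 1 <= (2 - x) * x ^+ n -> x <= b.
Proof.
move=> x1 x2 xn; apply: largest_root_ge => //.
rewrite -(@pmulr_rle0 _ (x - 1)) ?horner_beta_poly ?exprS ?subr_gt0 //; lra.
Qed.

Lemma beta_ge : 172 / 100 <= b.
Proof.
apply: beta_ge_of_expr; [lra|lra|].
(* The root for n = 4 is slightly above 1.72, and increasing n only enlarges the right-hand side. *)
apply: (@le_trans _ _ ((2 - 172 / 100) * (172 / 100) ^+ 4)); first by lra.
rewrite ler_pM2l; last by lra.
by rewrite ler_weXn2l //; lra.
Qed.

Lemma beta_ge5 : (5 <= n)%N -> 188 / 100 <= b.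
Proof.
move=> n5; apply: beta_ge_of_expr; [lra|lra|].
apply: (@le_trans _ _ ((2 - 188 / 100) * (188 / 100) ^+ 5)); first by lra.
rewrite ler_pM2l; last by lra.
by rewrite ler_weXn2l //; lra.
Qed.

Lemma beta_eq : b ^+ n.+1 - 2 * b ^+ n + 2 * b - 1 = 0.
Proof. by rewrite -horner_beta_poly (rootP br.1) mulr0. Qed.

(** Divided by b^(n+1), this says that the Lipschitz constant 2 (n-1) b^(-n) + n b^(-n-1) of z |-> 2
    - 2 z^(1-n) + z^(-n) on |z| >= b is below 1. *)
Lemma beta_contraction :
  2 * n.-1%:R * b + n%:R < b ^+ n.+1.
Proof.
(* The inequality passes from (m, c) to (m, b), then by induction on the exponent to (n, b); it
   remains to check it at m = 4 and c = 1.72. *)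
have bn : forall m (c : R), 172 / 100 <= c -> c <= b -> (4 <= m)%N -> (m <= n)%N ->
    2 * m.-1%:R * c + m%:R < c ^+ m.+1 -> 2 * n.-1%:R * b + n%:R < b ^+ n.+1.
  move=> m c c1 cb m2 mn H.
  have {}H : 2 * m.-1%:R * b + m%:R < b ^+ m.+1.
    have cm : m%:R < c * c ^+ m - 2 * m.-1%:R * c by rewrite -exprS; lra.
    have cm2 : 2 * m.-1%:R < c ^+ m.
      rewrite -(@ltr_pM2l _ c); last by lra.
      have : (0 : R) <= m%:R by []. lra.
    have bcm : c ^+ m <= b ^+ m by rewrite lerXn2r ?nnegrE; lra.
    rewrite exprS.
    have : 0 <= (b - c) * (c ^+ m - 2 * m.-1%:R) by rewrite mulr_ge0; lra.
    have : 0 <= b * (b ^+ m - c ^+ m) by rewrite mulr_ge0; lra.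
    lra.
  rewrite -(subnK mn); elim: (n - m)%N => [|k IHk]; first by rewrite add0n.
  have km : (k + m)%:R = (k + m).-1%:R + 1 :> R.
    by rewrite natr1 prednK //; lia.
  have km1 : 3 <= (k + m).-1%:R :> R by rewrite (ler_nat _ 3); lia.
  rewrite addSn /=.
  rewrite -natr1 exprS.
  have := IHk; rewrite km => {}IHk.
  have bge := beta_ge.
  have : 0 < b * (b ^+ (k + m).+1 - (2 * (k + m).-1%:R * b + ((k + m).-1%:R + 1))).
    by rewrite mulr_gt0; lra.
  have : 0 <= ((k + m).-1%:R - 3) * b by rewrite mulr_ge0; lra.
  have : 0 <= ((k + m).-1%:R - 3) * (b * (b - 172/100)) by rewrite mulr_ge0 ?mulr_ge0; lra.
  have : 0 <= b * (b - 172/100) by rewrite mulr_ge0; lra.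
  nra.
apply: (bn 4%N (172 / 100)) => //; first exact: beta_ge.
rewrite /=; lra.
Qed.

(** The quotient p(x) / x is x^(n-1) - (1 + ... + x^(n-2)) + 1/x. Between s and t its top power
    grows by at most the growth of x^(n-2) plus t - s; the term - x^(n-2) absorbs the former, and
    1/x the latter, as 1/s - 1/t = (t - s) / (s t) > t - s. *)
Lemma beta_poly_div_decreasing s t : 0 < s -> s < t -> t < 1 ->
  (beta_poly R n).[t] * s < (beta_poly R n).[s] * t.
Proof.
move=> s0 st t1.
have hE x : (beta_poly R n).[x] = x * (x ^+ n.-1 - \sum_(0 <= i < n.-1) x ^+ i) + 1.
  rewrite /beta_poly !(hornerD, hornerN, hornerXn, hornerC) horner_sum mulrBr -exprS.
  rewrite mulr_sumr -[in X in x ^+ X](prednK (_ : 0 < n)%N) //; last by lia.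
  rewrite -{1}[n in X in _ - X](prednK (_ : 0 < n)%N) //; last by lia.
  rewrite big_add1 /=; congr (_ - _ + _).
  by apply: eq_bigr => i _; rewrite hornerXn exprS.
rewrite !hE.
case: n n4 => [|[|m]] // _; rewrite /= !big_nat_recr //= !exprS.
have tsm (k : nat) : s ^+ k <= t ^+ k by rewrite lerXn2r ?nnegrE; lra.
set A := \sum_(0 <= i < m) s ^+ i; set B := \sum_(0 <= i < m) t ^+ i.
have AB : A <= B by apply: ler_sum => i _; exact: tsm.
have sm := tsm m; have tm : 0 <= t ^+ m by rewrite exprn_ge0; lra.
have sm0 : 0 <= s ^+ m by rewrite exprn_ge0; lra.
have tm1 : t ^+ m <= 1 by rewrite exprn_ile1; lra.
have key : t * t ^+ m - s * s ^+ m <= (t ^+ m - s ^+ m) + (t - s).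
  have -> : t * t ^+ m - s * s ^+ m = t * (t ^+ m - s ^+ m) + s ^+ m * (t - s) by ring.
  have : 0 <= (1 - t) * (t ^+ m - s ^+ m) by rewrite mulr_ge0; lra.
  have : 0 <= (1 - s ^+ m) * (t - s) by rewrite mulr_ge0; lra.
  lra.
rewrite -subr_gt0.
have st0 : 0 < s * t by rewrite mulr_gt0; lra.
have st1 : s * t < 1.
  have : 0 < (1 - s) * t by rewrite mulr_gt0; lra.
  lra.
have : 0 <= s * t * ((t ^+ m - s ^+ m) + (t - s) + (B - A)
    - (t * t ^+ m - s * s ^+ m)) by rewrite mulr_ge0; lra.
have : 0 < (1 - s * t) * (t - s) by rewrite mulr_gt0; lra.
lra.
Qed.

(** The polynomial is reciprocal, so 1/b is a root. As p(t) / t decreases on (0, 1), p is negative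
    at 1/x > 1/b, hence also at x. *)
Lemma beta_expr_gt x : 1 < x -> x < b -> 2 * x - 1 < (2 - x) * x ^+ n.
Proof.
move=> x1 xb.
have recip y : 1 < y -> y ^+ n * (beta_poly R n).[y^-1] = (beta_poly R n).[y].
  move=> y1; have yn0 : y != 0 by lra.
  have y10 : y^-1 - 1 != 0.
    by rewrite subr_eq0 invr_eq1; lra.
  have yV : y - 1 = - y * (y^-1 - 1) by field.
  apply: (@mulfI _ (y^-1 - 1)) => //; rewrite mulrCA horner_beta_poly.
  apply: (@mulfI _ (- y)); first by rewrite oppr_eq0.
  rewrite [RHS]mulrA -yV horner_beta_poly !exprS !exprVn.
  field.
  by rewrite expf_neq0 ?yn0.
have b1 : 1 < b by lra.
have xV : x^-1 < 1 by rewrite invf_lt1; lra.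
have bx : b^-1 < x^-1 by rewrite ltf_pV2 ?posrE; lra.
have b0 : 0 < b^-1 by rewrite invr_gt0; lra.
have := beta_poly_div_decreasing b0 bx xV.
have -> : (beta_poly R n).[b^-1] = 0.
  apply: (@mulfI _ (b ^+ n)); first by rewrite expf_neq0 // lt0r_neq0; lra.
  by rewrite recip // (rootP br.1) mulr0.
rewrite mul0r pmulr_llt0 // => pV.
have : (beta_poly R n).[x] < 0 by rewrite -recip // pmulr_rlt0 // exprn_gt0; lra.
rewrite -(@pmulr_rlt0 _ (x - 1)) ?horner_beta_poly ?exprS; last by lra.
lra.
Qed.

End Beta.

(** * The other complex roots *)

Lemma normrXX_le (F : numDomainType) (x y c : F) (m : nat) :
  `|x| <= c -> `|y| <= c -> `|x ^+ m - y ^+ m| <= `|x - y| * (m%:R * c ^+ m.-1).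
Proof.
move=> xc yc; rewrite subrXX normrM ler_wpM2l // mulr_natl.
rewrite (le_trans (ler_norm_sum _ _ _)) //.
rewrite -[X in _ <= _ *+ X](card_ord m) -sumr_const ler_sum // => i _.
have -> : c ^+ m.-1 = c ^+ (m.-1 - i) * c ^+ i.
  by rewrite -exprD; congr (_ ^+ _); have := ltn_ord i; lia.
rewrite normrM !normrX ler_pM ?exprn_ge0 //.
  by rewrite lerXn2r ?nnegrE ?(le_trans _ xc).
by rewrite lerXn2r ?nnegrE ?(le_trans _ yc).
Qed.

Section ComplexRoots.
Import complex.
Local Open Scope complex_scope.
Variables (R : realType) (n : nat).
Hypothesis n4 : (4 <= n)%N.
Variable b : R.
Hypothesis br : is_largest_root (beta_poly R n) b.
Let C := R[i].
Let pC : {poly C} := map_poly (real_complex R) (beta_poly R n).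

Lemma complex_beta_polyM_XB1 : ('X - 1) * pC =
  'X^(n.+1) - ('X^n + 'X^n) + ('X + 'X) - 1.
Proof.
have /(congr1 (map_poly (real_complex R))) := beta_polyM_XB1 R n4.
rewrite rmorphM /= -/pC.
rewrite !(rmorphD, rmorphB, rmorphN, rmorph1) /=.
by rewrite !map_polyXn map_polyX.
Qed.

Lemma complex_root_beta_poly (z : C) : root pC z ->
  z ^+ n.+1 - 2 * z ^+ n + 2 * z - 1 = 0.
Proof.
have /(congr1 (fun p => p.[z])) := complex_beta_polyM_XB1.
rewrite !(hornerM, hornerD, hornerN, hornerXn, hornerX, hornerC) => H /rootP rz.
by rewrite rz mulr0 in H; rewrite [RHS]H; ring.
Qed.

(* A root satisfies |z|^n |2 - z| = |2 z - 1|. For |z| = r > 1 the ratio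
   |2 z - 1| / |2 - z| is largest at z = r, where it is below r^n if r < b
   by [beta_expr_gt]. *)
Lemma complex_root_norm_lt (z : C) : root pC z -> `|z| < b%:C -> `|z| <= 1.
Proof.
move=> /complex_root_beta_poly; rewrite exprS normc_def.
set r := Num.sqrt _ => fz rb.
have r2 : r ^+ 2 = complex.Re z ^+ 2 + complex.Im z ^+ 2.
  by rewrite sqr_sqrtr // addr_ge0 // sqr_ge0.
have r0 : 0 <= r by rewrite sqrtr_ge0.
rewrite -[1]/(1%:C) lecR leNgt; apply/negP => r1.
rewrite ltcR in rb.
have b2 := beta_lt2 n4 br.
have := beta_expr_gt n4 br r1 rb.
have xr : complex.Re z <= r.
  rewrite (le_trans (ler_norm _)) // -(@ler_pXn2r _ 2) ?nnegrE ?normr_ge0 //.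
  by rewrite real_normK ?num_real // r2 lerDl sqr_ge0.
have : `|z ^+ n * (2 - z)| = `|2 * z - 1|.
  congr (Num.norm _); apply/eqP; rewrite -subr_eq0; apply/eqP.
  rewrite -[RHS]oppr0 -[in RHS]fz; ring.
rewrite normrM normrX [ `|z| ]normc_def -/r => /(congr1 (fun t => t ^+ 2)).
rewrite exprMn !sqr_normc.
have -> : (2 - z) * (2 - z)^*%C = ((2 - complex.Re z) ^+ 2 + complex.Im z ^+ 2)%:C.
  case: z {fz r2 xr} @r r0 r1 rb => x y /= *; simpc; apply/eqP.
  by rewrite eq_complex /=; apply/andP; split; apply/eqP; ring.
have -> : (2 * z - 1) * (2 * z - 1)^*%C = ((2 * complex.Re z - 1) ^+ 2 + 4 * complex.Im z ^+ 2)%:C.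
  case: z {fz r2 xr} @r r0 r1 rb => x y /= *; simpc; apply/eqP.
  by rewrite eq_complex /=; apply/andP; split; apply/eqP; ring.
rewrite -!rmorphXn -rmorphM => /complexI {fz}.
have T0 : 0 < r ^+ n by rewrite exprn_gt0; lra.
set T := r ^+ n in T0 *.
have -> : (2 - complex.Re z) ^+ 2 + complex.Im z ^+ 2 = 4 - 4 * complex.Re z + r ^+ 2 by rewrite r2; ring.
have -> : (2 * complex.Re z - 1) ^+ 2 + 4 * complex.Im z ^+ 2 = 1 - 4 * complex.Re z + 4 * r ^+ 2 by rewrite r2; ring.
set x := complex.Re z in xr * => TA rT.
set A := 4 - 4 * x + r ^+ 2 in TA.
have A0 : 0 < A.
  have : 0 < (2 - r) ^+ 2 by rewrite exprn_gt0; lra.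
  rewrite /A; nra.
have lt : (2 * r - 1) ^+ 2 * A < ((2 - r) * T) ^+ 2 * A.
  by rewrite ltr_pM2r // ltrXn2r // ?nnegrE; nra.
have : (2 - r) ^+ 2 * (1 - 4 * x + 4 * r ^+ 2) <= (2 * r - 1) ^+ 2 * A.
  rewrite -subr_ge0.
  have -> : (2 * r - 1) ^+ 2 * A - (2 - r) ^+ 2 * (1 - 4 * x + 4 * r ^+ 2) =
      12 * (r - 1) * (r + 1) * (r - x) by rewrite /A; ring.
  by rewrite !mulr_ge0; lra.
rewrite -TA; move: lt; rewrite exprMn; nra.
Qed.

(* A root satisfies z = 2 - 2 z^(1-n) + z^(-n); on |z| >= b the right-hand side is a
   strict contraction by [beta_contraction], and b is its fixed point. *)
Lemma complex_root_norm_ge (z : C) : root pC z -> b%:C <= `|z| -> z = b%:C.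
Proof.
move=> /complex_root_beta_poly fz bz.
have bge := beta_ge n4 br.
have b0 : 0 < b%:C by rewrite -[0]/(0%:C) ltcR; lra.
have z0 : z != 0 by rewrite -normr_gt0 (lt_le_trans b0).
have bn0 : b%:C != 0 by rewrite gt_eqF.
have fb : b%:C ^+ n.+1 - 2 * b%:C ^+ n + 2 * b%:C - 1 = 0 :> C.
  have /(congr1 (real_complex R)) := beta_eq n4 br.
  by rewrite !(rmorphB, rmorphD, rmorphM, rmorphXn, rmorph1, rmorph_nat) rmorph0.
have fV (w : C) : w != 0 -> w ^+ n.+1 - 2 * w ^+ n + 2 * w - 1 = 0 ->
    w = 2 - 2 * w^-1 ^+ n.-1 + w^-1 ^+ n.
  case: n n4 => // m _ w0 /=; rewrite !exprVn !exprS => fw.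
  have wm : w ^+ m != 0 by rewrite expf_neq0.
  apply/eqP; rewrite -subr_eq0; apply/eqP.
  apply: (@mulfI _ (w * w ^+ m)); first by rewrite mulf_neq0.
  by rewrite mulr0 -[RHS]fw; field; rewrite wm w0.
have zb : z - b%:C = - 2 * (z^-1 ^+ n.-1 - b%:C^-1 ^+ n.-1) + (z^-1 ^+ n - b%:C^-1 ^+ n).
  rewrite {1}(fV _ z0 fz) {1}(fV _ bn0 fb); ring.
set s := b%:C^-1 in zb.
have s0 : 0 < s by rewrite invr_gt0.
have ns : `|s| <= s by rewrite gtr0_norm.
have nzs : `|z^-1| <= s by rewrite normfV lef_pV2 ?posrE ?normr_gt0.
have zs : `|z^-1 - s| <= `|z - b%:C| * s ^+ 2.
  have -> : z^-1 - s = (b%:C - z) * (z^-1 * s) by rewrite /s; field; rewrite bn0 z0.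
  rewrite normrM distrC ler_wpM2l // normrM expr2 ler_pM //.
apply/eqP; rewrite -subr_eq0; apply/negPn/negP; rewrite -normr_gt0 => d0.
have H : `|z - b%:C| <= `|z - b%:C| * (s ^+ 2 * (2 * (n.-1%:R * s ^+ n.-2) + n%:R * s ^+ n.-1)).
  rewrite {1}zb (le_trans (ler_normD _ _)) // [in leRHS]mulrDr [leRHS]mulrDr lerD //.
    rewrite normrM normrN normr_nat .
    have -> : `|z - b%:C| * (s ^+ 2 * (2 * (n.-1%:R * s ^+ n.-2))) =
        2 * (`|z - b%:C| * s ^+ 2 * (n.-1%:R * s ^+ n.-2)) by ring.
    rewrite ler_wpM2l ?ler0n // (le_trans (normrXX_le _ nzs ns)) // ler_wpM2r //.
    by rewrite mulr_ge0 ?exprn_ge0 ?ler0n // ltW.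
  rewrite (le_trans (normrXX_le _ nzs ns)) // [leRHS]mulrA ler_wpM2r //.
  by rewrite mulr_ge0 ?exprn_ge0 ?ler0n // ltW.
move: H; rewrite -{1}[ `|_| ]mulr1 ler_pM2l // => H.
have : 1 <= b^-1 ^+ 2 * (2 * (n.-1%:R * b^-1 ^+ n.-2) + n%:R * b^-1 ^+ n.-1).
  rewrite -lecR; move: H; rewrite /s.
  by rewrite !(rmorphB, rmorphD, rmorphM, rmorphXn, rmorph1, rmorph_nat, fmorphV).
clear - n4 br bge; have := beta_contraction n4 br.
case: n n4 => [|[|m]] // _ /=; rewrite !exprS.
have bm : 0 < b ^+ m by rewrite exprn_gt0; lra.
move=> lt; apply/negP; rewrite -ltNge !exprVn expr0 invr1 mulr1.
rewrite -(@ltr_pM2r _ (b * (b * (b * b ^+ m)))) ?mulr_gt0 //; try lra.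
have -> : b^-1 * b^-1 * (2 * (m.+1%:R / b ^+ m) + m.+2%:R * (b^-1 / b ^+ m)) *
   (b * (b * (b * b ^+ m))) = 2 * m.+1%:R * b + m.+2%:R.
  by field; rewrite !gt_eqF //; lra.
by rewrite mul1r.
Qed.

End ComplexRoots.

(** * Remainders modulo the polynomial *)

Lemma remainder_bound_aux (R : realType) (c e v s T w : R) :
  0 <= c -> 0 <= e -> 0 <= v -> 0 <= s -> 1 <= T ->
  w <= (c + e * (2 * T)) * v * s ->
  w + 2 * T <= (s * (1 + e * 2) * v + 2) * (c + 1) * T.
Proof.
move=> c0 e0 v0 s0 T1 wle.
have sv : 0 <= s * v by rewrite mulr_ge0.
have t1 : 0 <= s * v * (c * (T - 1)) by rewrite mulr_ge0 // mulr_ge0; lra.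
have t2 : 0 <= s * v * T by rewrite mulr_ge0; lra.
have t3 : 0 <= s * v * (e * (c * T)) by rewrite !mulr_ge0; lra.
have t4 : 0 <= c * T by rewrite mulr_ge0; lra.
lra.
Qed.

Section Factor.
Import complex.
Local Open Scope complex_scope.
Variables (R : realType) (n : nat).
Hypothesis n4 : (4 <= n)%N.
Variable b : R.
Hypothesis br : is_largest_root (beta_poly R n) b.
Let C := R[i].

Lemma norm_real_complex (x : R) : `|x%:C| = `|x|%:C :> C.
Proof. by rewrite normc_def /= expr0n addr0 sqrtr_sqr. Qed.

(** At a double root the derivative of (X - 1) p would vanish too; eliminating b^n would give
    b^(n+1) = 2 (n-1) b - n, against [beta_contraction]. Simplicity is what keeps b itself out of
    the remaining complex roots. *)
Lemma beta_simple_root (q : {poly R}) :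
  beta_poly R n = q * ('X - b%:P) -> q.[b] != 0.
Proof.
move=> pq; apply/negP => /eqP qb.
have bge := beta_ge n4 br.
have := beta_polyM_XB1 R n4; rewrite pq => /(congr1 (fun p => p^`().[b])).
rewrite !(derivM, derivD, derivB, derivN, derivX, derivXn, derivC).
rewrite !(hornerD, hornerN, hornerM, hornerX, hornerXn, hornerC, hornerMn) /= qb.
rewrite subrr !mulr0 !mul0r !(add0r, addr0) mulr0.
have := beta_eq n4 br; have := beta_contraction n4 br.
case: n n4 => // m _ /=; rewrite !exprS -[in X in _ -> _ -> X]mulr_natr.
set B := b ^+ m => c1 c2 c3.
have : b * B * b = 2 * m%:R * b - m.+1%:R.
  apply/eqP; rewrite -subr_eq0; apply/eqP.
  have -> : b * B * b - (2 * m%:R * b - m.+1%:R) =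
      b * (b * B * m.+2%:R - (B *+ m.+1 + B *+ m.+1) + (1 + 1) - 0)
      - m.+1%:R * (b * (b * B) - 2 * (b * B) + 2 * b - 1).
    by rewrite -[B *+ _]mulr_natr -!natr1; ring.
  by rewrite -c3 c2 !mulr0 subrr.
move=> c4; have : b * (b * B) = b * B * b by ring.
have : (0 : R) <= m%:R by [].
rewrite c4 -natr1 in c1 *.
lra.
Qed.

Lemma beta_poly_split : exists rs : seq C,
  [/\ map_poly (real_complex R) (beta_poly R n) =
        \prod_(z <- rs) ('X - z%:P) * ('X - b%:C%:P),
      forall z, z \in rs -> `|z| <= 1 & size rs = n.-1].
Proof.
have [q pq] := factor_theorem _ _ br.1.
have qb := beta_simple_root pq.
set qC := map_poly (real_complex R) q.
have pqC : map_poly (real_complex R) (beta_poly R n) = qC * ('X - b%:C%:P).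
  by rewrite pq rmorphM /= rmorphB /= map_polyX map_polyC.
have pm : beta_poly R n \is monic.
  by rewrite -map_int_beta_poly; apply/monic_map/int_beta_poly_monic/(leq_trans _ n4).
have qm : q \is monic by rewrite -(monicMr q (monicXsubC b)) -pq pm.
have [rs qE] := closed_field_poly_normal qC.
have lq : lead_coef qC = 1 by apply/eqP; rewrite -monicE map_monic.
rewrite lq scale1r in qE.
exists rs; split; first by rewrite pqC {1}qE.
- move=> z zrs; have rq : root qC z by rewrite qE root_prod_XsubC.
  have rp : root (map_poly (real_complex R) (beta_poly R n)) z by rewrite pqC rootM rq.
  have [bz|zb] := leP b (Num.sqrt (complex.Re z ^+ 2 + complex.Im z ^+ 2)).
    have zb : z = b%:C.
      by apply: complex_root_norm_ge br _ rp _ => //; rewrite normc_def lecR.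
    by move: rq; rewrite zb fmorph_root /root (negbTE qb).
  by apply: complex_root_norm_lt br _ rp _ => //; rewrite normc_def ltcR.
- have : size qC = n.
    rewrite size_map_poly; apply: succn_inj.
    rewrite -(size_int_beta_poly (_ : 0 < n)%N) ?(leq_trans _ n4) //.
    rewrite -(size_map_inj_poly (f := intr : int -> R)) ?map_int_beta_poly //; last first.
      exact: intr_inj.
    by rewrite pq size_Mmonic ?monicXsubC ?monic_neq0 // size_XsubC addn2.
  by rewrite qE size_prod_XsubC => <-.
Qed.

(** Dividing first by the product q of the factors over the roots in the unit disc leaves a
    polynomially bounded remainder r. What is left of the quotient modulo X - b is a constant h with
    h q(b) = P(b) - r(b), so the bound on P(b) bounds h, and the remainder modulo the whole
    polynomial is h q + r. The bound 2 on the coefficients is that of a difference of two sign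
    words. *)
Lemma modp_beta_bound : exists D : R, 0 <= D /\
  forall (k : nat) (P : {poly R}) (c : R), (size P <= k)%N ->
    (forall i, `|P`_i| <= 2) -> `|P.[b]| <= c ->
  exists H r : {poly C},
    [/\ map_poly (real_complex R) P =
          H * map_poly (real_complex R) (beta_poly R n) + r,
        (size r <= n)%N
      & forall i, `|r`_i| <= (D * (c + 1) * (3 * k + 1)%:R ^+ n)%:C].
Proof.
have [rs [pE rs1 srs]] := beta_poly_split.
have bge := beta_ge n4 br.
set q : {poly C} := \prod_(z <- rs) ('X - z%:P) in pE.
have qb0 : q.[b%:C] != 0.
  rewrite -/(root q _) root_prod_XsubC; apply/negP => /rs1.
  by rewrite norm_real_complex lecR gtr0_norm; lra.
pose nm (z : C) : R := Num.sqrt (complex.Re z ^+ 2 + complex.Im z ^+ 2).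
have nmE z : `|z| = (nm z)%:C by exact: normc_def.
pose qs := \sum_(i < size q) nm q`_i.
have qsP i : `|q`_i| <= qs%:C.
  have [iq|iq] := ltnP i (size q); last first.
    by rewrite nth_default // normr0 lecR sumr_ge0 // => j _; exact: sqrtr_ge0.
  rewrite nmE lecR /qs (bigD1 (Ordinal iq)) //= lerDl sumr_ge0 // => j _.
  exact: sqrtr_ge0.
have qs0 : 0 <= qs by apply: sumr_ge0 => j _; exact: sqrtr_ge0.
have nq0 : 0 < nm q.[b%:C] by rewrite -ltcR -nmE normr_gt0.
have b0 : 0 <= b by lra.
pose D := qs * (1 + (n%:R * b ^+ n) * 2) / nm q.[b%:C] + 2.
have D0 : 0 <= D.
  by rewrite addr_ge0 // divr_ge0 ?mulr_ge0 ?addr_ge0 ?mulr_ge0 ?exprn_ge0 // ltW.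
exists D; split => // k P c sP Pb Pc.
have [H [r [PE sr rb]]] : exists H r : {poly C},
    [/\ map_poly (real_complex R) P = H * q + r, (size r <= size rs)%N
      & forall i, `|r`_i| <= 2 * (3 * k + 1)%:R ^+ size rs].
  apply: modp_prod_XsubC_bound => //; first by rewrite size_map_poly.
  move=> i; rewrite coef_map /= norm_real_complex.
  by rewrite -[2]/(2%:R) -(rmorph_nat (real_complex R)) lecR.
have [H1 [h HE]] : exists (H1 : {poly C}) h, H = H1 * ('X - b%:C%:P) + h%:P.
  have : root (H - H.[b%:C]%:P) b%:C by rewrite /root !hornerE subrr.
  case/factor_theorem => H1 H1E; exists H1, H.[b%:C].
  by rewrite -H1E subrK.
set T := (3 * k + 1)%:R ^+ n : R.
have T1 : 1 <= T by rewrite exprn_ege1 // ler1n addn1.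
have rT i : `|r`_i| <= (2 * T)%:C.
  rewrite (le_trans (rb i)) // rmorphM rmorph_nat /T rmorphXn rmorph_nat.
  by rewrite ler_wpM2l ?ler0n // ler_weXn2l ?ler1n ?addn1 // srs leq_pred.
have rbb : `|r.[b%:C]| <= (n%:R * b ^+ n * (2 * T))%:C.
  rewrite horner_coef (le_trans (ler_norm_sum _ _ _)) //.
  apply: (@le_trans _ _ (\sum_(i < size r) (b ^+ n * (2 * T))%:C)).
    apply: ler_sum => i _; rewrite normrM mulrC rmorphM ler_pM //.
    rewrite normrX norm_real_complex ger0_norm // -rmorphXn lecR.
    rewrite ler_weXn2l //; first by lra.
    by rewrite (leq_trans (ltnW (ltn_ord i))) // (leq_trans sr) // srs leq_pred.
  rewrite sumr_const card_ord -rmorphMn lecR -mulrA [leRHS]mulr_natl.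
  rewrite ler_wpMn2l // ?(leq_trans sr) ?srs ?leq_pred //.
  by rewrite mulr_ge0 ?exprn_ge0 //; lra.
have hb : nm h * nm q.[b%:C] <= c + n%:R * b ^+ n * (2 * T).
  rewrite -lecR rmorphM rmorphD /= -!nmE -normrM.
  have -> : h * q.[b%:C] = (P.[b])%:C - r.[b%:C].
    rewrite -horner_map /= PE HE !hornerE subrr mulr0 add0r; ring.
  rewrite (le_trans (ler_normB _ _)) // lerD //.
  by rewrite norm_real_complex lecR.
have c0 : 0 <= c by rewrite (le_trans _ Pc).
have hD : nm h * qs + 2 * T <= D * (c + 1) * T.
  rewrite -ler_pdivlMr // in hb.
  have : nm h * qs <= (c + n%:R * b ^+ n * (2 * T)) / nm q.[b%:C] * qs.
    by rewrite ler_wpM2r.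
  set v := (nm q.[b%:C])^-1; have v0 : 0 <= v by rewrite invr_ge0 ltW.
  set e := n%:R * b ^+ n; have e0 : 0 <= e by rewrite mulr_ge0 ?exprn_ge0.
  by rewrite /D -/v -/e => hq; exact: remainder_bound_aux.
exists H1, (h%:P * q + r); split.
- rewrite PE HE pE; ring.
- rewrite (leq_trans (size_polyD _ _)) // geq_max (leq_trans sr) ?srs ?leq_pred //.
  rewrite mul_polyC andbT (leq_trans (size_scale_leq _ _)) //.
  by rewrite size_prod_XsubC srs prednK // (leq_trans _ n4).
- move=> i; rewrite coefD coefCM (le_trans (ler_normD _ _)) // normrM.
  apply: (@le_trans _ _ (nm h * qs + 2 * T)%:C); last by rewrite lecR.
  by rewrite rmorphD lerD // rmorphM ler_pM // nmE.
Qed.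

End Factor.

(** * Separation of the expansions *)

Definition digit (A : pzRingType) (a : bool) : A := if a then 1 else - 1.

Fixpoint wsum (A : pzRingType) (lam : A) (u : seq bool) : A :=
  if u is a :: v then digit A a + lam * wsum lam v else 0.

Lemma wsum_cat (A : comPzRingType) (lam : A) (u v : seq bool) :
  wsum lam (u ++ v) = wsum lam u + lam ^+ size u * wsum lam v.
Proof.
elim: u => [|a u IHu] /=; first by rewrite expr0 mul1r add0r.
by rewrite IHu exprS; ring.
Qed.

(** The word is reversed because, after scaling by a power of b, its first digit carries the highest
    power. *)
Definition wpoly (u : seq bool) : {poly int} := Poly (rev (map (digit int) u)).

Lemma wpoly_rcons u a : wpoly (rcons u a) = wpoly u * 'X + (digit int a)%:P.
Proof. by rewrite /wpoly map_rcons rev_rcons /= cons_poly_def. Qed.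

Lemma horner_wpoly (R : realType) (b : R) (u : seq bool) : b != 0 ->
  b ^+ size u * wsum b^-1 u = b * (map_poly intr (wpoly u)).[b].
Proof.
move=> b0; elim/last_ind: u => [|u a IHu].
  by rewrite /= rmorph0 horner0 !mulr0.
rewrite wpoly_rcons size_rcons -cats1 wsum_cat /= mulr0 addr0.
rewrite rmorphD rmorphM /= map_polyX map_polyC /= !(hornerD, hornerM, hornerX, hornerC).
have -> : (digit int a)%:~R = digit R a.
  by case: a; rewrite //= rmorphN.
have -> : b ^+ (size u).+1 * (wsum b^-1 u + b^-1 ^+ size u * digit R a) =
    b * (b ^+ size u * wsum b^-1 u) + b * digit R a.
  by rewrite exprS exprVn; field; rewrite expf_neq0.
rewrite IHu; ring.
Qed.

Lemma size_wpoly u : (size (wpoly u) <= size u)%N.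
Proof. by rewrite (leq_trans (size_Poly _)) // size_rev size_map. Qed.

Lemma coef_wpoly u i : `|(wpoly u)`_i| <= 1.
Proof.
rewrite coef_Poly; have [iu|iu] := ltnP i (size u); last first.
  by rewrite nth_default // size_rev size_map.
rewrite nth_rev ?size_map // (nth_map false) //; last by lia.
by rewrite /digit; case: ifP.
Qed.

Section Separation.
Import complex.
Local Open Scope complex_scope.
Variables (R : realType) (n : nat).
Hypothesis n4 : (4 <= n)%N.
Variable b : R.
Hypothesis br : is_largest_root (beta_poly R n) b.
Let C := R[i].

(** The polynomial is monic, so by uniqueness of the remainder the complex one is the image of the
    integer one and the bound transfers. *)
Lemma rmodp_beta_bound : exists D : nat -> nat, forall (d k : nat) (P : {poly int}),
  (size P <= k)%N -> (forall i, `|P`_i| <= 2) -> `|(map_poly intr P).[b]| <= d%:R ->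
  forall i, (absz ((Pdiv.Ring.rmodp P (int_beta_poly n))`_i)%R <= D d * (3 * k + 1) ^ n)%N.
Proof.
have [D [D0 HD]] := modp_beta_bound n4 br.
exists (fun d => Num.bound (D * (d%:R + 1))) => d k P sP Pb Pd i.
have n0 : (0 < n)%N by exact: leq_trans n4.
have [H [r [PE sr rb]]] : exists H r : {poly C},
    [/\ map_poly (real_complex R) (map_poly intr P) =
          H * map_poly (real_complex R) (beta_poly R n) + r,
        (size r <= n)%N
      & forall i, `|r`_i| <= (D * (d%:R + 1) * (3 * k + 1)%:R ^+ n)%:C].
  apply: HD => // [|j]; first exact: leq_trans (size_poly _ _) sP.
  by rewrite coef_map /= -intr_norm (ler_int _ _ 2).
have pm := int_beta_poly_monic n0.
pose toC (Q : {poly int}) : {poly C} := map_poly (real_complex R) (map_poly intr Q).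
have toCE Q j : (toC Q)`_j = (Q`_j)%:~R.
  by rewrite /toC !coef_map /= rmorph_int.
have spC : size (map_poly (real_complex R) (beta_poly R n)) = n.+1.
  rewrite size_map_poly -map_int_beta_poly size_map_inj_poly ?size_int_beta_poly //.
  exact: intr_inj.
have rE : toC (Pdiv.Ring.rmodp P (int_beta_poly n)) = r.
  have := Pdiv.RingMonic.rdivp_eq pm P.
  move=> /(congr1 toC); rewrite /toC !rmorphD !rmorphM /= PE map_int_beta_poly.
  move=> /(congr1 (fun Q => Q %% map_poly (real_complex R) (beta_poly R n))).
  rewrite !modp_addl_mul_small ?spC ?ltnS //.
  rewrite size_map_poly (leq_trans (size_poly _ _)) //.
  have := Pdiv.Ring.ltn_rmodpN0 P (monic_neq0 pm).
  by rewrite size_int_beta_poly.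
have := rb i; rewrite -rE toCE -intr_norm -[(_%:~R : C)](rmorph_int (real_complex R)) lecR.
move=> le; rewrite -(ler_nat R) natr_absz.
apply: (le_trans le); rewrite natrM natrX ler_wpM2r ?exprn_ge0 //.
by rewrite ltW // archi_boundP // mulr_ge0.
Qed.

(* Two words with the same remainder modulo the polynomial have the same sum. The
   remainder is an integer polynomial whose coefficients in the factors over the
   non-dominant roots are polynomially bounded, these roots lying in the unit disc,
   while its value at b is bounded for words with close sums. *)
Lemma wsum_separation (c : R) : 0 <= c -> exists K m : nat,
  forall (k : nat) (A : {set k.-tuple bool}) (x : R),
    {in A &, injective (fun u : k.-tuple bool => wsum b^-1 u)} ->
    {in A, forall u : k.-tuple bool, `|wsum b^-1 u - x| <= c * b^-1 ^+ k} ->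
  (#|A| <= K * k.+1 ^ m)%N.
Proof.
move=> c0; have [D HD] := rmodp_beta_bound.
have bge := beta_ge n4 br; have b0 : b != 0 by lra.
(* Two sums within [c * b^-1 ^+ k] of [x] are within twice that of each other. *)
pose d := Num.bound (2 * c).
have cd : 2 * c <= d%:R by rewrite ltW // archi_boundP // mulr_ge0.
exists (((2 * D d + 1) * 3 ^ n) ^ n)%N, (n * n)%N => k A x Ainj Ax.
have [->|[u0 u0A]] := set_0Vmem A; first by rewrite cards0.
pose M := (D d * (3 * k + 1) ^ n)%N.
pose P (u : k.-tuple bool) := wpoly u - wpoly u0.
pose r u := Pdiv.Ring.rmodp (P u) (int_beta_poly n).
have hP (u : k.-tuple bool) : b ^+ k * (wsum b^-1 u - wsum b^-1 u0) = b * (map_poly intr (P u)).[b].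
  rewrite mulrBr rmorphB /= hornerD hornerN mulrBr -!horner_wpoly //.
  by rewrite !size_tuple.
have rM (u : k.-tuple bool) i : u \in A -> (absz ((r u)`_i)%R <= M)%N.
  move=> uA; apply: HD => [|j|].
  - rewrite (leq_trans (size_polyD _ _)) // geq_max size_polyN.
    by apply/andP; split; apply: (leq_trans (size_wpoly _)); rewrite size_tuple.
  - rewrite coefB (le_trans (ler_normB _ _)) //.
    by rewrite (le_trans (lerD (coef_wpoly _ _) (coef_wpoly _ _))).
  - rewrite (le_trans _ cd) //.
    have : b * `|(map_poly intr (P u)).[b]| <= 2 * c.
      have -> : b * `|(map_poly intr (P u)).[b]| =
          b ^+ k * `|wsum b^-1 u - wsum b^-1 u0|.
        have [b1 b2] : 0 <= b /\ 0 <= b ^+ k by rewrite exprn_ge0 //; lra.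
        by rewrite -{1}(ger0_norm b1) -normrM -hP normrM (ger0_norm b2).
      have bk : 0 < b ^+ k by rewrite exprn_gt0 //; lra.
      rewrite -ler_pdivlMl //; have := Ax _ uA; have := Ax _ u0A.
      rewrite exprVn -[c / _]mulrC => h1 h2.
      have := ler_distD x (wsum b^-1 u) (wsum b^-1 u0).
      rewrite [ `|x - _| ]distrC; lra.
    have : 0 <= `|(map_poly intr (P u)).[b]| by [].
    nra.
(* The coefficients of the remainder lie in [-M, M]; shifting by M turns them into ordinals. *)
pose phi (u : k.-tuple bool) : {ffun 'I_n -> 'I_(2 * M).+1} :=
  [ffun i : 'I_n => inord (absz ((r u)`_i + M%:Z))].
have phi_inj : {in A &, injective phi}.
  move=> u v uA vA /ffunP uv; apply: Ainj => //.
  have ruv : r u = r v.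
    apply/polyP => i; have [ni|ni] := ltnP i n; last first.
      have sr w : (size (r w) <= n)%N.
        have := Pdiv.Ring.ltn_rmodpN0 (P w) (monic_neq0 (int_beta_poly_monic (ltnW (ltnW (ltnW n4))))).
        by rewrite size_int_beta_poly // (leq_trans _ n4).
      by rewrite !nth_default // (leq_trans (sr _)).
    have := uv (Ordinal ni); rewrite !ffunE => /(congr1 val).
    have := rM u i uA; have := rM v i vA; rewrite /= => h1 h2.
    rewrite !inordK; lia.
  have pm : int_beta_poly n \is monic.
    by apply: int_beta_poly_monic; exact: leq_trans n4.
  have hr w : (map_poly intr (P w)).[b] = (map_poly intr (r w)).[b].
    rewrite {1}(Pdiv.RingMonic.rdivp_eq pm (P w)) rmorphD rmorphM /=.
    by rewrite map_int_beta_poly hornerD hornerM (rootP br.1) mulr0 add0r.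
  have bk : b ^+ k != 0 by rewrite expf_neq0.
  have := hP u; rewrite hr ruv -hr -hP => /(mulfI bk) /(congr1 (+%R^~ (wsum b^-1 u0))).
  by rewrite !subrK.
rewrite -(card_in_imset phi_inj) (leq_trans (max_card _)) //.
rewrite card_ffun !card_ord expnM -expnMn leq_exp2r ?(leq_trans _ n4) //.
have e1 : ((3 * k + 1) ^ n <= 3 ^ n * k.+1 ^ n)%N.
  by rewrite -expnMn leq_exp2r ?(leq_trans _ n4) //; lia.
have e2 : (1 <= (3 * k + 1) ^ n)%N by rewrite expn_gt0 addn1.
rewrite /M -mulnA; nia.
Qed.

End Separation.

(** * Coincidences between expansions *)

Lemma wsum_negb (A : pzRingType) (lam : A) u :
  wsum lam (map negb u) = - wsum lam u.
Proof.
elim: u => [|a u IHu] /=; first by rewrite oppr0.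
by rewrite IHu mulrN opprD; case: a; rewrite /= ?opprK.
Qed.

Lemma wsum_nseq (A : comPzRingType) (lam : A) a m :
  (1 - lam) * wsum lam (nseq m a) = digit A a * (1 - lam ^+ m).
Proof.
elim: m => [|m IHm] /=; first by rewrite expr0 subrr !mulr0.
by rewrite mulrDr mulrCA IHm exprS; ring.
Qed.

(* [wsum lam u] in the basis [1, lam, lam^2, lam^3], when
   [lam^4 = lam^3 + lam^2 + lam - 1] *)
Fixpoint wsum_quartic (u : seq bool) : int * int * int * int :=
  if u is a :: v then
    let: (c0, c1, c2, c3) := wsum_quartic v in
    (digit int a - c3, c0 + c3, c1 + c3, c2 + c3)
  else (0, 0, 0, 0).

Lemma wsum_quarticP (A : comPzRingType) (lam : A) (u : seq bool) :
  1 - lam - lam ^+ 2 - lam ^+ 3 + lam ^+ 4 = 0 ->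
  wsum lam u = let: (c0, c1, c2, c3) := wsum_quartic u in
    c0%:~R + c1%:~R * lam + c2%:~R * lam ^+ 2 + c3%:~R * lam ^+ 3.
Proof.
move=> lam4; elim: u => [|a u IHu] /=; first by rewrite !mul0r !addr0.
case: (wsum_quartic u) IHu => [[[c0 c1] c2] c3] ->.
have dE : (digit int a)%:~R = digit A a by case: a; rewrite //= rmorphN.
rewrite !rmorphD rmorphN /= dE -[LHS]subr0 -[in LHS](mulr0 c3%:~R) -lam4; ring.
Qed.

(* Found by computer search: for n = 4 the pair of words coming from the polynomial
   itself does not suffice, as 2 b^5 < 2^5. *)
Definition quartic_coincidences : seq (seq bool) := map (map (leq 1)) [::
   [:: 0; 1; 1; 0; 1; 1; 0; 1; 1; 1; 0; 0; 0; 0; 1];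
   [:: 0; 1; 1; 0; 1; 1; 1; 0; 0; 0; 0; 1; 1; 1; 0];
   [:: 0; 1; 1; 0; 1; 1; 1; 0; 0; 0; 1; 0; 0; 0; 1];
   [:: 0; 1; 1; 1; 0; 0; 0; 0; 1; 1; 1; 0; 1; 1; 0];
   [:: 0; 1; 1; 1; 0; 0; 0; 1; 0; 0; 0; 1; 1; 1; 0];
   [:: 0; 1; 1; 1; 0; 0; 0; 1; 0; 0; 1; 0; 0; 0; 1];
   [:: 1; 0; 0; 0; 0; 1; 1; 1; 0; 1; 1; 0; 1; 1; 0];
   [:: 1; 0; 0; 0; 1; 0; 0; 0; 1; 1; 1; 0; 1; 1; 0];
   [:: 1; 0; 0; 0; 1; 0; 0; 1; 0; 0; 0; 1; 1; 1; 0];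
   [:: 1; 0; 0; 0; 1; 0; 0; 1; 0; 0; 1; 0; 0; 0; 1]].

Section Coincidences.
Variables (R : realType) (n : nat).
Hypothesis n4 : (4 <= n)%N.
Variable b : R.
Hypothesis br : is_largest_root (beta_poly R n) b.

(** For n >= 5 the word + - ... - + of length n + 1 has sum 0, as lam is a root too, and so has its
    negation. It remains to see that (b / 2)^(n+1) > 1/2: by Bernoulli's inequality (n + 1) (2 - b)
    < 1 is enough, and this holds since b^n (2 - b) = 2 b - 1 < 3 and 3 (n + 1) < b^n. *)
Lemma wsum_coincidences : exists (L : nat) (W : seq (seq bool)) (y : R),
  [/\ (0 < L)%N, uniq W,
      {in W, forall u, size u = L /\ wsum b^-1 u = y} &
      2 ^+ L < (size W)%:R * b ^+ L].
Proof.
have bge := beta_ge n4 br; have bE := beta_eq n4 br; have b2 := beta_lt2 n4 br.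
have b0 : b != 0 by lra.
move: n4 bE; rewrite leq_eqVlt => /predU1P[<- bE|n5 bE].
  have lam4 : 1 - b^-1 - b^-1 ^+ 2 - b^-1 ^+ 3 + b^-1 ^+ 4 = 0.
    have b1 : (b - 1) * b ^+ 4 != 0 by rewrite mulf_neq0 ?expf_neq0 //; lra.
    by apply: (mulfI b1); rewrite mulr0 -[RHS]bE; field.
  exists 15%N, quartic_coincidences, (wsum b^-1 (head [::] quartic_coincidences)).
  split => //.
    move=> u uW; have /allP/(_ _ uW)/andP[/eqP su /eqP qu] : all (fun u =>
        (size u == 15) && (wsum_quartic u == wsum_quartic (head [::] quartic_coincidences)))
        quartic_coincidences by vm_compute.
    by split => //; rewrite !(wsum_quarticP _ lam4) qu.
  have : (172 / 100) ^+ 15 <= b ^+ 15 by rewrite lerXn2r ?nnegrE; lra.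
  have : 2 ^+ 15 < (size quartic_coincidences)%:R * (172 / 100) ^+ 15 :> R.
    by rewrite /=; lra.
  by rewrite /=; lra.
pose u := true :: nseq n.-1 false ++ [:: true].
have n0 : n.-1.+1 = n by rewrite prednK // (leq_trans _ n5).
have wu : wsum b^-1 u = 0.
  have b1 : (1 - b^-1) * b ^+ n.+1 != 0.
    rewrite mulf_neq0 ?expf_neq0 // subr_eq0 eq_sym invr_eq1; lra.
  apply: (mulfI b1); rewrite mulr0 -[RHS]bE /u /= wsum_cat /= size_nseq mulr0 addr0.
  have := wsum_nseq b^-1 false n.-1; set w := wsum _ _ => wE.
  rewrite /digit mulr1.
  have -> : (1 - b^-1) * b ^+ n.+1 * (1 + b^-1 * (w + b^-1 ^+ n.-1)) =
     b ^+ n.+1 * (1 - b^-1 + b^-1 * ((1 - b^-1) * w) + (1 - b^-1) * b^-1 * b^-1 ^+ n.-1) by ring.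
  rewrite wE /= -n0 /= !exprS !exprVn; field.
  by rewrite b0 expf_neq0.
exists n.+1, [:: u; map negb u], 0; split => //.
- move=> v; rewrite !inE => /orP[] /eqP ->.
    by rewrite wu /u /= size_cat size_nseq addn1 n0.
  by rewrite wsum_negb wu oppr0 /u size_map /= size_cat size_nseq addn1 n0.
have b188 := beta_ge5 n4 br n5.
have bn : 3 * n.+1%:R < b ^+ n.
  rewrite -(subnK n5); elim: (n - 5)%N => [|k IHk].
    have : (188 / 100) ^+ 5 <= b ^+ 5 by rewrite lerXn2r ?nnegrE; lra.
    by rewrite add0n; lra.
  rewrite addSn exprS -natr1.
  have : 0 < (b - 1) * (b ^+ (k + 5) - 3 * (k + 5).+1%:R) by rewrite mulr_gt0; lra.
  have : 0 <= (b - 188 / 100) * (k + 5).+1%:R by rewrite mulr_ge0 //; lra.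
  have : 1 <= (k + 5).+1%:R :> R by rewrite ler1n.
  have : 6 <= (k + 5).+1%:R :> R by rewrite (ler_nat _ 6); lia.
  nra.
have bern : forall m : nat, 1 - m%:R * (1 - b / 2) <= (b / 2) ^+ m.
  elim=> [|m IHm]; first by rewrite expr0; lra.
  rewrite exprS -natr1.
  have : 0 <= b / 2 * ((b / 2) ^+ m - (1 - m%:R * (1 - b / 2))) by rewrite mulr_ge0; lra.
  have : 0 <= m%:R * (1 - b / 2) ^+ 2 by rewrite mulr_ge0 ?sqr_ge0.
  lra.
have := bern n.+1; rewrite expr_div_n ler_pdivlMr ?exprn_gt0 // => le.
have -> : (size [:: u; map negb u])%:R = 2 :> R by [].
suff : 2 ^+ n.+1 < 2 * ((1 - n.+1%:R * (1 - b / 2)) * 2 ^+ n.+1) by lra.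
have p2 : 0 < 2 ^+ n.+1 :> R by rewrite exprn_gt0.
suff : 0 < 2 * (1 - n.+1%:R * (1 - b / 2)) - 1.
  by move=> /(mulr_gt0 p2); lra.
have bb : b ^+ n * (2 - b) = 2 * b - 1 by rewrite exprS in bE; lra.
have : 0 < (b ^+ n - 3 * n.+1%:R) * (2 - b) by rewrite mulr_gt0; lra.
lra.
Qed.

End Coincidences.

(** * Counting words by their sum *)

Lemma sum_tuple_cons (V : nmodType) (T : finType) k (f : seq T -> V) :
  \sum_(w : k.+1.-tuple T) f w = \sum_(a : T) \sum_(u : k.-tuple T) f (a :: u).
Proof.
rewrite pair_big (reindex (fun x : T * k.-tuple T => [tuple of x.1 :: x.2])) //=.
exists (fun w : k.+1.-tuple T => (thead w, [tuple of behead w])) => [[a u] _|w _].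
  by congr pair; apply: val_inj.
by rewrite -tuple_eta.
Qed.

Lemma sum_tuple_cat (V : nmodType) (T : finType) l k (f : seq T -> V) :
  \sum_(w : (l + k).-tuple T) f w =
  \sum_(p : l.-tuple T) \sum_(u : k.-tuple T) f (p ++ u).
Proof.
elim: l f => [|l IHl] f.
  by rewrite (big_pred1 [tuple]) // => p; rewrite [p]tuple0; apply/esym/eqP.
rewrite (sum_tuple_cons _ (fun p => \sum_(u : k.-tuple T) f (p ++ u))).
rewrite (sum_tuple_cons _ f); apply: eq_bigr => a _.
exact: (IHl (fun w => f (a :: w))).
Qed.

Section Words.
Variables (R : realType) (lam : R).
Hypotheses (lam_gt : 1 / 2 < lam) (lam_lt : lam < 1).
Let lamb : 1 / 2 < lam /\ lam < 1 := conj lam_gt lam_lt.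
Let C := (1 - lam)^-1.
Implicit Types (x y : R) (k l : nat).

Lemma wsum_radius_gt0 : 0 < C. Proof. by rewrite /C invr_gt0 subr_gt0. Qed.

Lemma wsum_radiusE : 1 + lam * C = C.
Proof. by rewrite /C; field; rewrite subr_eq0 gt_eqF. Qed.

Lemma normr_wsum u : `|wsum lam u| <= C.
Proof.
have [l1 l2] := lamb.
elim: u => [|a u IHu] /=; first by rewrite normr0 ltW ?wsum_radius_gt0.
rewrite -wsum_radiusE (le_trans (ler_normD _ _)) // lerD //.
  by case: a; rewrite /= ?normrN normr1.
by rewrite normrM gtr0_norm; [rewrite ler_pM2l //; lra|lra].
Qed.

(** Greedy expansion: the digit is the sign of x, and (x - digit) / lam stays in [-C, C] because lam
    > 1/2 gives 1 <= lam C. *)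
Lemma wsum_dense k x : `|x| <= C ->
  exists u : k.-tuple bool, `|wsum lam u - x| <= C * lam ^+ k.
Proof.
have [l1 l2] := lamb.
elim: k x => [|k IHk] x xC.
  by exists [tuple]; rewrite /= sub0r normrN expr0 mulr1.
pose a := 0 <= x.
have CE := wsum_radiusE; have C0 := wsum_radius_gt0.
have lC : 1 <= lam * C.
  have : 0 <= (2 * lam - 1) * C by rewrite mulr_ge0; lra.
  lra.
have [u ux] : exists u : k.-tuple bool, `|wsum lam u - (x - digit R a) / lam| <= C * lam ^+ k.
  apply: IHk; rewrite normrM normfV [ `|lam| ]gtr0_norm; last by lra.
  rewrite ler_pdivrMr; last by lra.
  move: xC; rewrite !ler_norml /a; case: (leP 0 x) => x0; rewrite /digit; lra.
exists [tuple of a :: u]; rewrite /= exprS.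
have -> : digit R a + lam * wsum lam u - x =
    lam * (wsum lam u - (x - digit R a) / lam) by field; lra.
rewrite normrM gtr0_norm; last by lra.
by rewrite mulrCA ler_pM2l //; lra.
Qed.

Definition mult k y : nat := #|[set v : k.-tuple bool | wsum lam v == y]|.

Lemma multE (V : nzSemiRingType) k y :
  (mult k y)%:R = \sum_(v : k.-tuple bool | wsum lam v == y) 1 :> V.
Proof.
rewrite /mult sumr_const; congr (_ *+ _); apply: eq_card => v.
by rewrite !inE.
Qed.

Lemma mult_gt0 k (u : k.-tuple bool) : (0 < mult k (wsum lam u))%N.
Proof. by apply/card_gt0P; exists u; rewrite inE. Qed.

Lemma mult_le k y : (mult k y <= 2 ^ k)%N.
Proof. by rewrite (leq_trans (max_card _)) // card_tuple card_bool. Qed.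

Lemma mult_cat l k y z : (mult l y * mult k z <= mult (l + k) (y + lam ^+ l * z))%N.
Proof.
have E j t : mult j t = \sum_(v : j.-tuple bool) ((wsum lam v == t) : nat).
  rewrite /mult -sum1_card big_mkcond; apply: (@eq_bigr _ 0%N addn) => v _.
  by rewrite inE; case: eqP.
rewrite !E (sum_tuple_cat l k (fun w => (wsum lam w == y + lam ^+ l * z) : nat)).
rewrite -[leqLHS]/(_ * _)%R mulr_suml; apply: leq_sum => p _.
rewrite mulr_sumr; apply: leq_sum => u _.
rewrite wsum_cat size_tuple; case: eqP => [->|_] //=.
by case: (wsum lam u =P z) => [->|] //; rewrite eqxx.
Qed.

(* With the weight 1 / [mult], a sum over words is a sum over the distinct values
   of [wsum]. *)
Lemma sum_class k (f : R -> R) (u : k.-tuple bool) :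
  \sum_(v : k.-tuple bool | wsum lam v == wsum lam u)
    (mult k (wsum lam v))%:R^-1 * f (wsum lam v) = f (wsum lam u).
Proof.
rewrite (eq_bigr (fun=> 1 * ((mult k (wsum lam u))%:R^-1 * f (wsum lam u)))); last first.
  by move=> v /eqP ->; rewrite mul1r.
rewrite -mulr_suml -multE mulrA mulfV ?mul1r //.
by rewrite pnatr_eq0 -lt0n mult_gt0.
Qed.

Lemma le_sum_class k (f : R -> R) (P : pred R) (u : k.-tuple bool) :
  (forall v : k.-tuple bool, 0 <= f (wsum lam v)) -> P (wsum lam u) ->
  f (wsum lam u) <= \sum_(v : k.-tuple bool | P (wsum lam v))
    (mult k (wsum lam v))%:R^-1 * f (wsum lam v).
Proof.
move=> f0 Pu; rewrite -[leLHS]sum_class.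
rewrite (bigID (fun v : k.-tuple bool => wsum lam v == wsum lam u) (fun v : k.-tuple bool => P (wsum lam v))) /=.
rewrite -[leLHS]addr0 lerD //; last first.
  by apply: sumr_ge0 => v _; rewrite mulr_ge0 // invr_ge0.
rewrite le_eqVlt; apply/orP; left; apply/eqP; apply: eq_bigl => v.
by case: (wsum lam v =P _) => [->|]; rewrite ?Pu // andbF.
Qed.

(** The pick depends on [u] only through its sum, so the fixed words, collected in [reps], index the
    distinct sums. *)
Definition rep k (u : k.-tuple bool) : k.-tuple bool :=
  odflt u [pick v : k.-tuple bool | wsum lam v == wsum lam u].

Lemma wsum_rep k (u : k.-tuple bool) : wsum lam (rep u) = wsum lam u.
Proof. by rewrite /rep; case: pickP => //= v /eqP. Qed.

Lemma rep_eq k (u v : k.-tuple bool) : wsum lam u = wsum lam v -> rep u = rep v.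
Proof.
move=> uv; rewrite /rep uv; case: pickP => //= /(_ v).
by rewrite eqxx.
Qed.

Definition reps k : {set k.-tuple bool} := [set u | rep u == u].

Lemma sum_reps k (P : pred R) :
  \sum_(v : k.-tuple bool | P (wsum lam v)) (mult k (wsum lam v))%:R^-1 =
  #|[set u in reps k | P (wsum lam u)]|%:R :> R.
Proof.
rewrite -sum1_card natr_sum.
rewrite (partition_big (@rep k) (fun u => u \in [set u in reps k | P (wsum lam u)])); last first.
  move=> v Pv; rewrite !inE wsum_rep Pv andbT.
  by apply/eqP/rep_eq; rewrite wsum_rep.
apply: eq_bigr => u; rewrite !inE => /andP[/eqP ru Pu].
transitivity (\sum_(v : k.-tuple bool | wsum lam v == wsum lam u)
    (mult k (wsum lam v))%:R^-1 * 1 : R).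
  rewrite [RHS](eq_bigr (fun v : k.-tuple bool => (mult k (wsum lam v))%:R^-1)); last first.
    by move=> v _; rewrite mulr1.
  apply: eq_bigl => v; apply/andP/eqP => [[Pv /eqP rv]|vu].
    by rewrite -wsum_rep rv.
  by rewrite vu Pu (rep_eq vu) ru.
by rewrite (sum_class (fun=> 1)).
Qed.

Lemma reps_inj k : {in reps k &, injective (fun u : k.-tuple bool => wsum lam u)}.
Proof. by move=> u v; rewrite !inE => /eqP <- /eqP <-; rewrite !wsum_rep => /rep_eq. Qed.

(** By [wsum_dense] the intervals of radius C lam^k around the distinct sums cover [-C, C]; compare
    lengths. *)
Lemma card_reps_ge k : lam ^- k <= #|reps k|%:R.
Proof.
have C0 := wsum_radius_gt0; have [l1 l2] := lamb.
have lk : 0 < lam ^+ k by rewrite exprn_gt0; lra.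
pose I (u : k.-tuple bool) := `[wsum lam u - C * lam ^+ k, wsum lam u + C * lam ^+ k]%classic.
have cover : (`[- C, C] `<=` \bigcup_(u in [set` enum (reps k)]) I u)%classic.
  move=> x; rewrite /= in_itv /= -ler_norml => /(wsum_dense k)[u ux].
  exists (rep u); first by rewrite /= mem_enum inE; apply/eqP/rep_eq; rewrite wsum_rep.
  by rewrite /I /= in_itv /= wsum_rep; move: ux; rewrite ler_norml; lra.
have Im u : measurable (I u : set R) by exact: measurable_itv.
have : (lebesgue_measure (`[(- C)%R, C]%classic : set R) <=
    \sum_(u \in [set` enum (reps k)]) lebesgue_measure (I u : set R))%E.
  exact: (content_sub_fsum (@lebesgue_measure R) (finite_seq (enum (reps k)))
    (fun u _ => Im u) (measurable_itv _) cover).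
rewrite lebesgue_measure_itv /= lte_fin ifT; last by lra.
rewrite -fsbig_seq ?enum_uniq // (eq_bigr (fun=> (2 * (C * lam ^+ k))%:E)); last first.
  move=> u _; rewrite /I lebesgue_measure_itv /= lte_fin ifT.
    by rewrite -EFinB; congr EFin; ring.
  have : 0 < C * lam ^+ k by rewrite mulr_gt0.
  by lra.
rewrite -EFinB sumEFin lee_fin big_const_seq count_predT iter_addr_0 -cardE.
rewrite opprK -mulr_natr => H.
rewrite -div1r ler_pdivrMr // -(@ler_pM2l _ (2 * C)); last by lra.
by rewrite mulr1; lra.
Qed.

End Words.

(** * The moments of the multiplicities *)

Lemma powR_rootK (R : realType) (x q : R) : 0 <= x -> 0 < q -> (x `^ q^-1) `^ q = x.
Proof. by move=> x0 q0; rewrite -powRrM mulVf ?gt_eqF // powRr1. Qed.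

Lemma powRK_root (R : realType) (x q : R) : 0 <= x -> 0 < q -> (x `^ q) `^ q^-1 = x.
Proof. by move=> x0 q0; rewrite -powRrM mulfV ?gt_eqF // powRr1. Qed.

Section Step.
Variables (R : realType) (lam : R).
Hypotheses (lam_gt : 1 / 2 < lam) (lam_lt : lam < 1).
Let lamb : 1 / 2 < lam /\ lam < 1 := conj lam_gt lam_lt.
Let C := (1 - lam)^-1.
Variables (c : R) (Q : nat -> R).
Hypothesis cC : 2 * C + c * lam <= c.
Hypothesis sep : forall k x,
  \sum_(v : k.-tuple bool | `|wsum lam v - x| <= c * lam ^+ k)
     (mult lam k (wsum lam v))%:R^-1 <= Q k.
Implicit Types (k l : nat) (x y q : R).
Notation N k y := ((mult lam k y)%:R : R).

(** A ball at scale lam^k sees all words with a close sum, whereas [mult] sees exact coincidences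
    only. *)
Definition near_mult k y : nat :=
  #|[set v : k.-tuple bool | `|wsum lam v - y| <= c * lam ^+ k]|.

Definition gibbs k q : R := \sum_(u : k.-tuple bool) (N k (wsum lam u))^-1 * N k (wsum lam u) `^ q.

Lemma nearE k y : (near_mult k y)%:R =
  \sum_(v : k.-tuple bool | `|wsum lam v - y| <= c * lam ^+ k) 1 :> R.
Proof.
rewrite /near_mult sumr_const; congr (_ *+ _); apply: eq_card => v.
by rewrite !inE.
Qed.

Lemma c_gt0 : 0 < c.
Proof.
have [l1 l2] := lamb; have C0 := wsum_radius_gt0 lam_lt.
have := cC; rewrite -/C in C0; nra.
Qed.

Lemma Q_ge0 k : 0 <= Q k.
Proof.
apply: le_trans (sep k 0); apply: sumr_ge0 => v _.
by rewrite invr_ge0.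
Qed.

(** The window holds at most [Q k] distinct sums, and the multiplicity of each is at most the q-th
    root of the sum of all N^q in the window. *)
Lemma near_powR_le k y q : 0 < q ->
  (near_mult k y)%:R `^ q <= Q k `^ q *
    \sum_(v : k.-tuple bool | `|wsum lam v - y| <= c * lam ^+ k)
       (N k (wsum lam v))^-1 * N k (wsum lam v) `^ q.
Proof.
move=> q0; set Z := \sum_(v : _ | _) _ * _.
have Z0 : 0 <= Z by apply: sumr_ge0 => v _; rewrite mulr_ge0 ?powR_ge0 ?invr_ge0.
have Qk := Q_ge0 k.
have : (near_mult k y)%:R <= Q k * Z `^ q^-1.
  rewrite nearE.
  apply: (@le_trans _ _ (\sum_(v : k.-tuple bool | `|wsum lam v - y| <= c * lam ^+ k)
      (N k (wsum lam v))^-1 * Z `^ q^-1)); last first.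
    by rewrite -mulr_suml ler_wpM2r ?powR_ge0.
  apply: ler_sum => v vy; have n0 : 0 < N k (wsum lam v) by rewrite ltr0n mult_gt0.
  rewrite mulrC ler_pdivlMr // mul1r -[leLHS](powRK_root (ltW n0) q0).
  apply: ge0_ler_powR; rewrite ?nnegrE ?powR_ge0 ?invr_ge0 ?(ltW q0) //.
  apply: (le_sum_class (f := fun s => N k s `^ q)
     (P := fun s => `|s - y| <= c * lam ^+ k)) => // w; exact: powR_ge0.
move=> /(@ge0_ler_powR _ q (ltW q0)).
rewrite powRM ?powR_ge0 // powR_rootK //; apply; rewrite ?nnegrE //.
by rewrite mulr_ge0 ?powR_ge0.
Qed.

(** Prefixes of close words are close: if p' u is near the target, the sums of p and p' differ by at
    most lam^l (2 C + c lam^k), which [cC] bounds by c lam^l. This is the purpose of that hypothesis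
    on c. *)
Lemma near_cat l k (p : l.-tuple bool) y : (0 < k)%N -> `|y| <= C ->
  (near_mult (l + k) (wsum lam p + lam ^+ l * y))%:R =
  \sum_(p' : l.-tuple bool | `|wsum lam p' - wsum lam p| <= c * lam ^+ l)
    (near_mult k (y + (wsum lam p - wsum lam p') / lam ^+ l))%:R :> R.
Proof.
move=> k0 yC; have [l1 l2] := lamb.
have ll : 0 < lam ^+ l by rewrite exprn_gt0; lra.
have E (p' : l.-tuple bool) (u : k.-tuple bool) :
    (`|wsum lam (p' ++ u) - (wsum lam p + lam ^+ l * y)| <= c * lam ^+ (l + k)) =
    (`|wsum lam u - (y + (wsum lam p - wsum lam p') / lam ^+ l)| <= c * lam ^+ k).
  rewrite wsum_cat size_tuple exprD.
  have -> : wsum lam p' + lam ^+ l * wsum lam u - (wsum lam p + lam ^+ l * y) =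
      lam ^+ l * (wsum lam u - (y + (wsum lam p - wsum lam p') / lam ^+ l)).
    by field; lra.
  by rewrite normrM gtr0_norm // mulrCA ler_pM2l.
rewrite nearE big_mkcond (sum_tuple_cat l k (fun w =>
  if `|wsum lam w - (wsum lam p + lam ^+ l * y)| <= c * lam ^+ (l + k) then 1 else 0)).
rewrite [RHS]big_mkcond; apply: eq_bigr => p' _; case: ifP => [pW|/negP pW].
  by rewrite nearE [RHS]big_mkcond; apply: eq_bigr => u _; rewrite E.
apply: big1 => u _; rewrite E; case: ifP => // uW; case: pW.
have uC := normr_wsum lam_gt lam_lt u; rewrite -/C in uC.
have lk : lam ^+ k <= lam.
  by rewrite -[leRHS]expr1 ler_wiXn2l //; lra.
have c0 := c_gt0.
have clk : c * lam ^+ k <= c * lam by rewrite ler_pM2l.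
have d : `|(wsum lam p - wsum lam p') / lam ^+ l| <= c.
  have cc := cC; move: uW uC yC; rewrite !ler_norml; lra.
move: d; rewrite normrM normfV [ `|lam ^+ l| ]gtr0_norm // ler_pdivrMr //.
by rewrite distrC.
Qed.

(** By [near_cat] the ratio is an average, over the prefixes near p, of counts at level k. Its q-th
    power is therefore at most the sum of their q-th powers over the distinct prefix sums, at most
    [Q l] of them. After [near_powR_le] and an exchange of sums, each v is reached from at most
    [Q k] distinct sums of u. *)
Lemma gibbs_step l k (p : l.-tuple bool) q : (0 < k)%N -> 0 < q ->
  \sum_(u : k.-tuple bool) (N k (wsum lam u))^-1 *
    ((near_mult (l + k) (wsum lam p + lam ^+ l * wsum lam u))%:R /
       (near_mult l (wsum lam p))%:R) `^ q <=
  Q l * (Q k `^ q * (Q k * gibbs k q)).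
Proof.
move=> k0 q0; have [l1 l2] := lamb; have c0 := c_gt0.
have ll : 0 < lam ^+ l by rewrite exprn_gt0; lra.
have Nl : 0 < (near_mult l (wsum lam p))%:R :> R.
  rewrite ltr0n; apply/card_gt0P; exists p; rewrite inE subrr normr0.
  by rewrite mulr_ge0 // ltW.
pose W p' := `|p' - wsum lam p| <= c * lam ^+ l.
pose y (p' t : R) := t + (wsum lam p - p') / lam ^+ l.
apply: (@le_trans _ _ (\sum_(u : k.-tuple bool) (N k (wsum lam u))^-1 *
    \sum_(p' : l.-tuple bool | W (wsum lam p')) (N l (wsum lam p'))^-1 *
      (near_mult k (y (wsum lam p') (wsum lam u)))%:R `^ q)).
  apply: ler_sum => u _; rewrite ler_wpM2l ?invr_ge0 //.
  set Z := \sum_(p' : _ | _) _.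
  have Z0 : 0 <= Z by apply: sumr_ge0 => v _; rewrite mulr_ge0 ?powR_ge0 ?invr_ge0.
  rewrite -[leRHS](powR_rootK Z0 q0); apply: ge0_ler_powR; rewrite ?nnegrE ?powR_ge0 ?(ltW q0) //.
  rewrite ler_pdivrMr // near_cat ?normr_wsum // [leRHS]mulrC [in leRHS]nearE mulr_suml.
  apply: ler_sum => p' p'W; rewrite mul1r -[leLHS](powRK_root (ler0n _ _) q0).
  apply: ge0_ler_powR; rewrite ?nnegrE ?powR_ge0 ?invr_ge0 ?(ltW q0) //.
  apply: (le_sum_class (f := fun s => (near_mult k (y s (wsum lam u)))%:R `^ q) (P := W)) => //.
apply: (@le_trans _ _ (\sum_(u : k.-tuple bool) (N k (wsum lam u))^-1 *
    \sum_(p' : l.-tuple bool | W (wsum lam p')) (N l (wsum lam p'))^-1 *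
      (Q k `^ q * \sum_(v : k.-tuple bool |
          `|wsum lam v - y (wsum lam p') (wsum lam u)| <= c * lam ^+ k)
          (N k (wsum lam v))^-1 * N k (wsum lam v) `^ q))).
  apply: ler_sum => u _; rewrite ler_wpM2l ?invr_ge0 //.
  by apply: ler_sum => p' _; rewrite ler_wpM2l ?invr_ge0 // near_powR_le.
under eq_bigr => u _ do rewrite mulr_sumr.
rewrite exchange_big /=.
apply: (@le_trans _ _ (\sum_(p' : l.-tuple bool | W (wsum lam p'))
  (N l (wsum lam p'))^-1 * (Q k `^ q * (Q k * gibbs k q)))); last first.
  rewrite -mulr_suml ler_wpM2r // ?mulr_ge0 ?powR_ge0 ?Q_ge0 ?sep //.
  by apply: sumr_ge0 => v _; rewrite mulr_ge0 ?powR_ge0 ?invr_ge0.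
apply: ler_sum => p' _.
under eq_bigr => u _ do rewrite mulrCA [X in _ * X]mulrCA.
rewrite -mulr_sumr ler_wpM2l ?invr_ge0 // -mulr_sumr ler_wpM2l ?powR_ge0 //.
under eq_bigr => u _ do rewrite mulr_sumr big_mkcond.
rewrite exchange_big /= /gibbs mulr_sumr; apply: ler_sum => v _.
rewrite -big_mkcond /= -mulr_suml ler_wpM2r ?mulr_ge0 ?powR_ge0 ?invr_ge0 //.
apply: le_trans (sep k (wsum lam v - (wsum lam p - wsum lam p') / lam ^+ l)).
rewrite le_eqVlt; apply/orP; left; apply/eqP; apply: eq_bigl => u.
by rewrite distrC /y; congr (_ <= _); congr Num.norm; ring.
Qed.

End Step.

(** As X has mean 0 and is at most K, the points with [- 1 <= X] carry at least 1 / (K + 1) of the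
    weight. If f exceeded (K + 2) A on all of them, its mean would exceed A. *)
Lemma weighted_choice (R : realFieldType) (T : finType) (w X f : T -> R) (K A : R) :
  (0 < #|T|)%N -> (forall t, 0 < w t) -> 0 <= K -> (forall t, X t <= K) ->
  \sum_t w t * X t = 0 -> (forall t, 0 <= f t) -> 0 < A ->
  \sum_t w t * f t <= A * \sum_t w t ->
  exists t, - 1 <= X t /\ f t <= (K + 2) * A.
Proof.
move=> /card_gt0P[t0 _] w0 K0 XK X0 f0 A0 fA.
have [/existsP[t /andP[t1 t2]]|/existsPn H] :=
    boolP [exists t, (- 1 <= X t) && (f t <= (K + 2) * A)].
  by exists t.
exfalso; set W := \sum_(t | - 1 <= X t) w t.
have W0 : 0 <= W by apply: sumr_ge0 => t _; exact: ltW.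
have Z0 : 0 < \sum_t w t.
  rewrite (bigD1 t0) //= ltr_wpDr //; apply: sumr_ge0 => t _; exact: ltW.
have h1 : \sum_t w t <= (K + 1) * W.
  have -> : \sum_t w t = \sum_t (w t + w t * X t) by rewrite big_split /= X0 addr0.
  rewrite /W mulr_sumr [leRHS]big_mkcond /=.
  apply: ler_sum => t _; have := w0 t; have := XK t.
  case: ifPn => [_|]; last rewrite -ltNge; move=> *; first by nra.
  by nra.
have h2 : (K + 2) * A * W <= A * \sum_t w t.
  apply: le_trans fA; rewrite /W mulr_sumr [leLHS]big_mkcond /=.
  apply: ler_sum => t _; case: ifPn => [Xt|_]; last by rewrite mulr_ge0 ?f0 // ltW.
  by rewrite mulrC ler_wpM2l // ltW // ltNge; have := H t; rewrite Xt.
have h3 : (K + 2) * W <= \sum_t w t by rewrite -(ler_pM2l A0) mulrA [A * _]mulrC.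
by have : W = 0; nra.
Qed.

Section Exponent.
Variables (R : realType) (lam : R).
Hypotheses (lam_gt : 1 / 2 < lam) (lam_lt : lam < 1).
Let lamb : 1 / 2 < lam /\ lam < 1 := conj lam_gt lam_lt.
Variable g : R.
Hypothesis g_gt : ln (2 * lam) < g.
Notation N k u := ((mult lam k (wsum lam (tval u)))%:R : R).

Definition gibbs_drift k q : R := \sum_(u : k.-tuple bool)
  ((N k u)^-1 * N k u `^ q) * (ln (N k u) - k%:R * g).

Lemma mult_gt0R k (u : k.-tuple bool) : 0 < N k u.
Proof. by rewrite ltr0n mult_gt0. Qed.

(** The tangent at q to the convex function q |-> expR (- q * k * g) * [gibbs k q] lies below it at
    1, where the Gibbs sum counts all 2^k words. *)
Lemma gibbs_convex k q :
  expR ((1 - q) * (k%:R * g)) * (gibbs lam k q + (1 - q) * gibbs_drift k q) <= 2 ^+ k.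
Proof.
have -> : 2 ^+ k = \sum_(u : k.-tuple bool) (1 : R).
  by rewrite sumr_const card_tuple card_bool natrX.
rewrite /gibbs /gibbs_drift mulr_sumr -big_split /= mulr_sumr; apply: ler_sum => u _.
have n0 := mult_gt0R u; set n := N k u in n0 *.
have nE : n = expR (ln n) by rewrite lnK.
have e : n `^ q = expR (q * ln n) by rewrite /powR gt_eqF.
have e1 : n = n `^ q * (expR ((1 - q) * (k%:R * g)) * expR ((1 - q) * (ln n - k%:R * g))).
  rewrite e -!expRD {1}nE; congr expR; ring.
have ge := expR_ge1Dx ((1 - q) * (ln n - k%:R * g)).
have -> : n^-1 * n `^ q + (1 - q) * (n^-1 * n `^ q * (ln n - k%:R * g)) =
  n^-1 * n `^ q * (1 + (1 - q) * (ln n - k%:R * g)) by ring.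
apply: (@le_trans _ _ (expR ((1 - q) * (k%:R * g)) * (n^-1 * n `^ q *
    expR ((1 - q) * (ln n - k%:R * g))))).
  by rewrite ler_wpM2l ?expR_ge0 // ler_wpM2l // mulr_ge0 ?powR_ge0 // invr_ge0 ltW.
rewrite le_eqVlt; apply/orP; left; apply/eqP.
transitivity (n^-1 * (n `^ q * (expR ((1 - q) * (k%:R * g)) *
  expR ((1 - q) * (ln n - k%:R * g))))); first by ring.
by rewrite -e1 mulVf // gt_eqF.
Qed.

Lemma gibbs_ge k q (u : k.-tuple bool) : N k u `^ q <= gibbs lam k q.
Proof.
apply: (le_sum_class (f := fun s => (mult lam k s)%:R `^ q) (P := xpredT)) => // v.
Qed.

Lemma gibbs_ge_card k q : 0 <= q -> lam ^- k <= gibbs lam k q.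
Proof.
move=> q0; rewrite (le_trans (card_reps_ge lam_gt lam_lt k)) //.
have -> : #|reps lam k|%:R = #|[set u in reps lam k | xpredT (wsum lam (tval u))]|%:R :> R.
  by congr (_%:R); apply: eq_card => u; rewrite !inE andbT.
rewrite -(sum_reps lam k xpredT); apply: ler_sum => u _.
rewrite ler_peMr ?invr_ge0 // -[leLHS](powRr0 (N k u)).
by rewrite ler_powR // ler1n mult_gt0.
Qed.

Lemma gibbs_drift_continuous k : continuous (gibbs_drift k).
Proof.
apply: continuous_big => [|u _]; first exact: add_continuous.
have pE : powR (N k u) = expR \o ( *%R^~ (ln (N k u))).
  by apply/funext => q; rewrite /powR /= gt_eqF // mult_gt0R.
rewrite pE => q; apply: cvgM; last exact: cvg_cst.
apply: cvgM; first exact: cvg_cst.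
by apply: continuous_comp; [exact: mulrr_continuous|exact: continuous_expR].
Qed.

Let gpos : 0 < ln (2 * lam) /\ 0 < g.
Proof.
have [l1 l2] := lamb; have gg := g_gt.
have h : 0 < ln (2 * lam) by rewrite ln_gt0; lra.
by split=> //; lra.
Qed.

Variables (g' K0 : R).
Hypotheses (gg' : g < g').
Hypothesis max_mult : forall k, exists u : k.-tuple bool, g' * k%:R - K0 <= ln (N k u).

(* The drift has the sign of the derivative of the convex function
   q |-> expR (- q * k * g) * [gibbs k q]. By [gibbs_convex] it is nonpositive at a
   small q0, since there are at least lam ^- k distinct sums, and nonnegative at a
   large q1, by [max_mult]. *)
Lemma gibbs_exponent : exists (q0 q1 : R) (k0 : nat), 0 < q0 /\
  forall k, (k0 <= k)%N -> exists q, [/\ q0 <= q, q <= q1 & gibbs_drift k q = 0].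
Proof.
have [l1 l2] := lamb; have [s0 g0] := gpos; have gg := g_gt; have hg := gg'.
set s := ln (2 * lam) in s0 gg.
(* Chosen so that (1 - q0) g = ln (2 lam), which turns the exponential factor of [gibbs_convex] into
   (2 lam)^k. *)
pose q0 := 1 - s / g.
have sg : 0 < s / g < 1 by rewrite divr_gt0 //= ltr_pdivrMr // mul1r.
have q00 : 0 < q0 by rewrite /q0; lra.
(* Then (q1 - 1) (g' - g) is 2 ln 2: for k >= k0 at most half of the gain is lost to K0, and the
   rest exceeds the k ln 2 of the total count. *)
pose q1 : R := 1 + 2 * ln 2 / (g' - g).
have ln20 : 0 < ln 2 :> R by rewrite ln_gt0 // ltr1n.
have q11 : 1 < q1 by rewrite ltrDl divr_gt0 ?mulr_gt0 //; lra.
pose k0 := (Num.bound (2 * `|K0| / (g' - g))).+1.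
exists q0, q1, k0; split => // k kk.
have k1 : 1 <= k%:R :> R by rewrite ler1n (leq_trans _ kk).
have kK : K0 <= (g' - g) * k%:R / 2.
  have : 2 * `|K0| / (g' - g) < k0%:R.
    rewrite (lt_le_trans (archi_boundP _)) ?ler_nat // ?divr_ge0 ?mulr_ge0 //; lra.
  rewrite ltr_pdivrMr; last by lra.
  have : k0%:R <= k%:R :> R by rewrite ler_nat.
  have := ler_norm K0; nra.
have d0 : gibbs_drift k q0 <= 0.
  rewrite leNgt; apply/negP => d0.
  have := gibbs_convex k q0; apply/negP; rewrite -ltNge.
  have -> : (1 - q0) * (k%:R * g) = k%:R * s by rewrite /q0; field; lra.
  rewrite expRM_natl /s lnK ?posrE; last by lra.
  have := gibbs_ge_card k (ltW q00).
  have p : 0 < (2 * lam) ^+ k by rewrite exprn_gt0; lra.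
  have -> : 2 ^+ k = (2 * lam) ^+ k * lam ^- k :> R.
    by rewrite exprMn mulfK // expf_neq0 //; lra.
  have : 0 < (1 - q0) * gibbs_drift k q0 by rewrite mulr_gt0 // /q0; lra.
  rewrite ltr_pM2l //; lra.
have d1 : 0 <= gibbs_drift k q1.
  rewrite leNgt; apply/negP => d1.
  have := gibbs_convex k q1; apply/negP; rewrite -ltNge.
  have [u hu] := max_mult k.
  apply: (@lt_le_trans _ _ (expR ((1 - q1) * (k%:R * g)) *
     (gibbs lam k q1 + (1 - q1) * gibbs_drift k q1))) => //.
  apply: (@le_lt_trans _ _ (expR ((1 - q1) * (k%:R * g)) * N k u `^ q1)); last first.
    rewrite ltr_pM2l ?expR_gt0 // (le_lt_trans (gibbs_ge q1 u)) // ltrDl.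
    have : 0 < (q1 - 1) * (- gibbs_drift k q1) by rewrite mulr_gt0; lra.
    lra.
  rewrite /powR gt_eqF ?mult_gt0R // -expRD.
  have -> : 2 ^+ k = expR (k%:R * ln 2) :> R by rewrite expRM_natl lnK ?posrE.
  rewrite ler_expR.
  have e : (q1 - 1) * (g' - g) = 2 * ln 2 by rewrite /q1; field; lra.
  have : 0 <= q1 * (ln (N k u) - (g' * k%:R - K0)) by rewrite mulr_ge0; lra.
  have : 0 <= q1 * ((g' - g) * k%:R / 2 - K0) by rewrite mulr_ge0; lra.
  have : 0 <= k%:R * g by rewrite mulr_ge0; lra.
  have : (q1 - 1) * (g' - g) * k%:R = 2 * ln 2 * k%:R by rewrite e.
  have : 0 <= (g' - g) * k%:R by rewrite mulr_ge0; lra.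
  lra.
have q01 : q0 <= q1 by rewrite /q0; lra.
have [||q qI qE] := @IVT R (gibbs_drift k) q0 q1 0 q01.
- exact/continuous_subspaceT/gibbs_drift_continuous.
- by rewrite ge_min d0 le_max d1 orbT.
by exists q; move: qI; rewrite in_itv /= => /andP[].
Qed.

End Exponent.

(** * Greedy choice of blocks *)

Section Greedy.
Variables (R : realType) (lam : R).
Hypotheses (lam_gt : 1 / 2 < lam) (lam_lt : lam < 1).
Let lamb : 1 / 2 < lam /\ lam < 1 := conj lam_gt lam_lt.
Let C := (1 - lam)^-1.
Variables (c : R) (Q : nat -> R).
Hypothesis cC : 2 * C + c * lam <= c.
Hypothesis sep : forall k x,
  \sum_(v : k.-tuple bool | `|wsum lam v - x| <= c * lam ^+ k)
     (mult lam k (wsum lam v))%:R^-1 <= Q k.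
Variable g : R.
Hypothesis g01 : 0 <= g <= 1.

Lemma Q_ge1 k : 1 <= Q k.
Proof.
pose u := [tuple of nseq k true].
have c0 := c_gt0 lam_gt lam_lt cC; have [l1 l2] := lamb.
apply: le_trans (sep k (wsum lam u)).
under eq_bigr => v _ do rewrite -[_^-1]mulr1.
apply: (le_sum_class (f := fun=> 1) (P := fun s => `|s - wsum lam u| <= c * lam ^+ k) (u := u)) => //.
by rewrite /= subrr normr0 mulr_ge0 ?exprn_ge0; lra.
Qed.

Lemma near_ge k (u : k.-tuple bool) : (mult lam k (wsum lam u) <= near_mult lam c k (wsum lam u))%N.
Proof.
rewrite /mult /near_mult; apply: subset_leq_card.
apply/fintype.subsetP => v.
rewrite !inE => /eqP ->.
have c0 := c_gt0 lam_gt lam_lt cC; have [l1 l2] := lamb.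
by rewrite subrr normr0 mulr_ge0 ?exprn_ge0; lra.
Qed.

Lemma near_gt0 k (u : k.-tuple bool) : 0 < (near_mult lam c k (wsum lam u))%:R :> R.
Proof. by rewrite ltr0n (leq_trans _ (near_ge u)) // mult_gt0. Qed.

Lemma ln_mult_ge0 k (u : k.-tuple bool) : 0 <= ln (mult lam k (wsum lam u))%:R :> R.
Proof. by rewrite ln_ge0 // ler1n mult_gt0. Qed.

Lemma ln_mult_le k (u : k.-tuple bool) : ln (mult lam k (wsum lam u))%:R <= k%:R :> R.
Proof.
apply: (@le_trans _ _ (ln (2 ^+ k))).
  by rewrite ler_ln ?posrE ?ltr0n ?mult_gt0 ?exprn_gt0 // -natrX ler_nat mult_le.
rewrite lnXn // -[leLHS]mulr_natl ler_piMr // (le_trans (@le_ln1Dx R 1 _)) //; lra.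
Qed.

(** The logarithm of the q-th root of the Markov bound (k + 2) Q_l Q_k^(q+1), with the lower bound
    q0 in place of q. *)
Definition step_error (q0 : R) l k : R :=
  ln (Q k) + (ln (k%:R + 2) + ln (Q l) + ln (Q k)) / q0.

(** [weighted_choice] under the weights N^q of the distinct sums: the deviation of ln N from k g has
    mean 0 as the drift vanishes, and is at most k in absolute value, while [gibbs_step] bounds the
    mean of the q-th power of the near growth divided by N. The flag [up] lets the caller correct an
    accumulated deviation. *)
Lemma extend_word l (p : l.-tuple bool) k q0 q (up : bool) :
  (0 < k)%N -> 0 < q0 -> q0 <= q -> gibbs_drift lam g k q = 0 ->
  exists u : k.-tuple bool,
    let n := ln (mult lam k (wsum lam u))%:R in
    (if up then k%:R * g - 1 <= n else n <= k%:R * g + 1) /\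
    ln (near_mult lam c (l + k) (wsum lam p + lam ^+ l * wsum lam u))%:R <=
      ln (near_mult lam c l (wsum lam p))%:R + n + step_error q0 l k.
Proof.
move=> k0 q00 q0q dr; have qp : 0 < q by exact: lt_le_trans q0q.
pose n (u : k.-tuple bool) : R := (mult lam k (wsum lam u))%:R.
have n0 u : 0 < n u by rewrite ltr0n mult_gt0.
pose rho (u : k.-tuple bool) : R := (near_mult lam c (l + k) (wsum lam p + lam ^+ l * wsum lam u))%:R /
       (near_mult lam c l (wsum lam p))%:R.
pose A := Q l * (Q k `^ q * Q k).
have Ql : 0 < Q l by rewrite (lt_le_trans _ (Q_ge1 l)).
have Qk : 0 < Q k by rewrite (lt_le_trans _ (Q_ge1 k)).
have A0 : 0 < A by rewrite !mulr_gt0 ?powR_gt0.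
pose X u : R := if up then ln (n u) - k%:R * g else - (ln (n u) - k%:R * g).
have [|u||u||u|||u [Xu fu]] := @weighted_choice R (k.-tuple bool : finType)
    (fun u => (n u)^-1 * n u `^ q) X (fun u => rho u `^ q / n u `^ q) k%:R A.
- by rewrite card_tuple card_bool expn_gt0.
- by rewrite mulr_gt0 ?invr_gt0 ?powR_gt0.
- by [].
- rewrite /X; have [g0 g1] := andP g01.
  have := ln_mult_ge0 u; have := ln_mult_le u; rewrite -/(n u).
  have : 0 <= k%:R * g by rewrite mulr_ge0.
  have : 0 <= k%:R * (1 - g) by rewrite mulr_ge0 //; lra.
  by case: up {X}; lra.
- rewrite /X; case: (up); first exact: dr.
  under eq_bigr => u _ do rewrite mulrN.
  by rewrite sumrN -[RHS]oppr0; congr (- _); exact: dr.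
- by rewrite divr_ge0 ?powR_ge0.
- by [].
- have := gibbs_step lam_gt lam_lt cC sep p k0 qp.
  rewrite /gibbs => H.
  rewrite /A -!mulrA; apply: le_trans H.
  rewrite le_eqVlt; apply/orP; left; apply/eqP; apply: eq_bigr => u _.
  rewrite -/(n u) -/(rho u); field.
  by rewrite ?(gt_eqF (n0 u)) ?(gt_eqF (powR_gt0 q (n0 u))).
exists u => /=; rewrite -/(n u); split.
  by move: Xu; rewrite /X; case: up {X} => *; lra.
have rho0 : 0 <= rho u by rewrite divr_ge0.
have nl := near_gt0 p.
have nlk : 0 < (near_mult lam c (l + k) (wsum lam p + lam ^+ l * wsum lam u))%:R :> R.
  have := near_gt0 [tuple of p ++ u].
  by rewrite wsum_cat size_tuple.
have rp : 0 < rho u by rewrite divr_gt0.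
rewrite -addrA addrC -lerBlDr -ln_div ?posrE // -/(rho u).
move: fu; rewrite ler_pdivrMr ?powR_gt0 // => fu.
have k2 : 0 < k%:R + 2 :> R by rewrite ltr_wpDl.
have : ln (rho u `^ q) <= ln ((k%:R + 2) * A * n u `^ q).
  by rewrite ler_ln ?posrE ?mulr_gt0 ?powR_gt0.
have -> : ln ((k%:R + 2) * A * n u `^ q) =
    ln (k%:R + 2) + (ln (Q l) + (q * ln (Q k) + ln (Q k))) + q * ln (n u).
  have pk : 0 < Q k `^ q by exact: powR_gt0.
  have pn : 0 < n u `^ q by exact: powR_gt0.
  rewrite lnM ?posrE ?mulr_gt0 // lnM ?posrE // /A lnM ?posrE ?mulr_gt0 //.
  by rewrite lnM ?posrE // !ln_powR.
rewrite ln_powR => H.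
rewrite /step_error addrC -lerBlDr.
rewrite -(ler_pM2l qp).
set T := ln (k%:R + 2) + ln (Q l) + ln (Q k).
have T0 : 0 <= T.
  by rewrite !addr_ge0 ?ln_ge0 ?Q_ge1 //; have : 0 <= k%:R :> R by []; lra.
have qT : T <= q * (T / q0).
  by rewrite mulrA mulrAC ler_peMl // ler_pdivlMr // mul1r.
rewrite /T in qT *; nra.
Qed.

End Greedy.

Lemma ln_le_sqrt (R : realType) (x : R) : 0 < x -> ln x <= 2 * Num.sqrt x.
Proof.
move=> x0; have s0 : 0 < Num.sqrt x by rewrite sqrtr_gt0.
rewrite -[in leLHS](sqr_sqrtr (ltW x0)) lnXn // -[leLHS]mulr_natl ler_pM2l //.
have := @le_ln1Dx R (Num.sqrt x - 1).
by rewrite [1 + _]addrC subrK => /(_ _); lra.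
Qed.

(* Blocks of lengths k0, k0 + 1, ...: long enough for the errors per letter to vanish,
   yet with consecutive ends asymptotically equal. *)
Definition block_end (k0 j : nat) : nat := \sum_(t < j) (k0 + t).

Lemma block_endS k0 j : block_end k0 j.+1 = (block_end k0 j + (k0 + j))%N.
Proof. by rewrite /block_end big_ord_recr. Qed.

Lemma block_end_ge k0 j : (0 < k0)%N -> (j * j.+1 <= 2 * block_end k0 j)%N.
Proof.
move=> k00; elim: j => [//|j IHj]; rewrite block_endS; nia.
Qed.

Lemma block_end_le k0 j : (block_end k0 j <= (k0 + 1) * (j.+1 * j.+1))%N.
Proof.
elim: j => [//|j IHj]; first by rewrite /block_end big_ord0.
rewrite block_endS; nia.
Qed.

Section Sequence.
Variables (R : realType) (lam : R).
Hypotheses (lam_gt : 1 / 2 < lam) (lam_lt : lam < 1).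
Let lamb : 1 / 2 < lam /\ lam < 1 := conj lam_gt lam_lt.
Let C := (1 - lam)^-1.
Variables (c : R) (K m : nat).
Let Q k : R := (K * k.+1 ^ m)%:R.
Hypothesis cC : 2 * C + c * lam <= c.
Hypothesis sep : forall k x,
  \sum_(v : k.-tuple bool | `|wsum lam v - x| <= c * lam ^+ k)
     (mult lam k (wsum lam v))%:R^-1 <= Q k.
Variables (g q0 : R) (k0 : nat).
Hypotheses (g01 : 0 <= g <= 1) (q00 : 0 < q0) (k00 : (0 < k0)%N).
Hypothesis drift0 : forall k, (k0 <= k)%N ->
  exists2 q, q0 <= q & gibbs_drift lam g k q = 0.

(** All terms are logarithms of polynomials in j. The square root is a crude majorant, still good
    enough: j blocks cost O(j^(3/2)), while their total length is of order j^2. *)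
Lemma step_error_le : exists2 D : R, 0 <= D &
  forall j, step_error Q q0 (block_end k0 j) (k0 + j) <= D * Num.sqrt (j.+1)%:R.
Proof.
have K1 : (0 < K)%N.
  by have := Q_ge1 lam_gt lam_lt cC sep 0; rewrite /Q exp1n muln1 ler1n.
pose a : R := 2 * Num.sqrt (k0 + 2)%:R + 4.
have ln_poly k j : (0 < k)%N -> (k <= (k0 + 2) * (j.+1 * j.+1))%N -> ln k%:R <= a * Num.sqrt (j.+1)%:R.
  move=> kp kle.
  have s1 : 1 <= Num.sqrt (j.+1)%:R :> R by rewrite -[leLHS]sqrtr1 ler_sqrt ?ler1n.
  have kl : k%:R <= ((k0 + 2) * (j.+1 * j.+1))%:R :> R by rewrite ler_nat.
  apply: (@le_trans _ _ (ln ((k0 + 2) * (j.+1 * j.+1))%:R)).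
    by rewrite ler_ln ?posrE ?ltr0n // muln_gt0 addn2.
  rewrite !natrM lnM ?posrE ?mulr_gt0 ?ltr0n ?addn2 // lnM ?posrE ?ltr0n //.
  have h1 := @ln_le_sqrt R (j.+1)%:R; have h2 := @ln_le_sqrt R (k0.+2)%:R.
  rewrite !ltr0n in h1 h2; have {}h1 := h1 isT; have {}h2 := h2 isT.
  rewrite /a addn2.
  have : 0 <= Num.sqrt k0.+2%:R * (Num.sqrt (j.+1)%:R - 1) :> R.
    by rewrite mulr_ge0 ?sqrtr_ge0 //; lra.
  lra.
have lnK0 : 0 <= ln (K%:R : R) by rewrite ln_ge0 // ler1n.
have lnQ k j : (k.+1 <= (k0 + 2) * (j.+1 * j.+1))%N ->
    ln (Q k) <= (ln K%:R + m%:R * a) * Num.sqrt (j.+1)%:R.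
  move=> kle; rewrite /Q natrM natrX lnM ?posrE ?exprn_gt0 ?ltr0n // lnXn ?ltr0n //.
  have s1 : 1 <= Num.sqrt (j.+1)%:R :> R by rewrite -[leLHS]sqrtr1 ler_sqrt ?ler1n.
  rewrite -[X in _ + X <= _]mulr_natl [leRHS]mulrDl lerD //; first by rewrite ler_peMr.
  by rewrite -mulrA ler_wpM2l // ln_poly.
have a0 : 0 <= a by rewrite /a; have : 0 <= Num.sqrt (k0 + 2)%:R :> R := sqrtr_ge0 _; lra.
set b := ln K%:R + m%:R * a in lnQ.
have b0 : 0 <= b by rewrite addr_ge0 ?mulr_ge0.
clearbody b; clearbody a.
exists (b + (a + b + b) / q0).
  by rewrite (addr_ge0 b0) ?divr_ge0 ?(ltW q00) // (addr_ge0 _ b0) ?(addr_ge0 a0 b0).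
move=> j; have hk : ((k0 + j).+2 <= (k0 + 2) * (j.+1 * j.+1))%N by nia.
have hl : ((block_end k0 j).+1 <= (k0 + 2) * (j.+1 * j.+1))%N.
  by have := block_end_le k0 j; nia.
rewrite /step_error [leRHS]mulrDl lerD ?lnQ 1?ltnW //.
rewrite [leRHS]mulrAC ler_wpM2r ?invr_ge0 ?(ltW q00) // !mulrDl.
have -> : (k0 + j)%:R + 2 = (k0 + j).+2%:R :> R by rewrite -(natrD _ _ 2) addn2.
by rewrite !lerD ?ln_poly ?lnQ //; exact: ltnW.
Qed.

Lemma word_sequence : exists (P : nat -> seq bool) (D : R), forall j,
  [/\ size (P j) = block_end k0 j, exists v, P j.+1 = P j ++ v,
      (block_end k0 j)%:R * g - D * (j%:R * Num.sqrt (j.+1)%:R) <=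
        ln (mult lam (block_end k0 j) (wsum lam (P j)))%:R &
      ln (near_mult lam c (block_end k0 j) (wsum lam (P j)))%:R <=
        (block_end k0 j)%:R * g + D * (j%:R * Num.sqrt (j.+1)%:R)].
Proof.
have [D D0 HD] := step_error_le.
(* The state is the word so far with the sum of ln N over its blocks, a lower bound for ln N of the
   word itself; the next block goes up or down according to that sum. *)
pose rel (i : nat * (seq bool * R)) (y : seq bool * R) :=
  size i.2.1 = block_end k0 i.1 ->
  exists u : (k0 + i.1).-tuple bool,
    let n := ln (mult lam (k0 + i.1) (wsum lam u))%:R in
    [/\ y = (i.2.1 ++ u, i.2.2 + n),
      (if i.2.2 < (block_end k0 i.1)%:R * g then (k0 + i.1)%:R * g - 1 <= n
       else n <= (k0 + i.1)%:R * g + 1) &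
      ln (near_mult lam c (block_end k0 i.1.+1) (wsum lam (i.2.1 ++ u)))%:R <=
      ln (near_mult lam c (block_end k0 i.1) (wsum lam i.2.1))%:R + n +
         D * Num.sqrt (i.1.+1)%:R].
have relP i : exists y, rel i y.
  case: i => j [p s]; rewrite /rel /=.
  have [sp|sp] := eqVneq (size p) (block_end k0 j); last first.
    by exists (p, s) => /eqP; rewrite (negbTE sp).
  have pt : size p == block_end k0 j by apply/eqP.
  have [q qq dr] := drift0 (leq_addr j k0).
  have k0j : (0 < k0 + j)%N by rewrite addn_gt0 k00.
  have [u [u1 u2]] := extend_word lam_gt lam_lt cC sep g01 (Tuple pt)
    (s < (block_end k0 j)%:R * g) k0j q00 qq dr.
  exists (p ++ u, s + ln (mult lam (k0 + j) (wsum lam u))%:R) => _; exists u; split => //.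
  rewrite wsum_cat sp block_endS (le_trans u2) // lerD2l; exact: HD.
have [F HF] := choice relP.
pose st := fix st j := if j is i.+1 then F (i, st i) else ([::], 0 : R).
have stS j : st j.+1 = F (j, st j) by [].
have sz j : size (st j).1 = block_end k0 j.
  elim: j => [|j IHj]; first by rewrite /block_end big_ord0.
  rewrite stS; have [u [-> _ _]] := HF (j, st j) IHj.
  by rewrite size_cat IHj size_tuple block_endS.
have sq1 j : 1 <= Num.sqrt (j.+1)%:R :> R.
  by rewrite -[leLHS]sqrtr1 ler_sqrt ?ler1n.
have kR j : (k0 + j)%:R = k0%:R + j%:R :> R by rewrite natrD.
(* Each block moves the deviation towards 0 up to an error of 1, and overshoots by at most its own
   length. *)
have mid j : `|(st j).2 - (block_end k0 j)%:R * g| <= 2 * j%:R + k0%:R.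
  elim: j => [|j IHj]; first by rewrite /block_end big_ord0 !mul0r subrr normr0 mulr0 add0r.
  rewrite stS; have [u [-> /= Hs _]] := HF (j, st j) (sz j); rewrite /= in Hs.
  have n0 := ln_mult_ge0 lam u; have nk := ln_mult_le lam u; rewrite /= in n0 nk.
  rewrite block_endS natrD -natr1; move: IHj; rewrite !ler_norml.
  have [g0 g1] := andP g01.
  have : 0 <= (k0 + j)%:R * g by rewrite mulr_ge0.
  have : 0 <= (k0 + j)%:R * (1 - g) by rewrite mulr_ge0 //; lra.
  have : 0 <= j%:R :> R by [].
  have : 0 <= k0%:R :> R by [].
  by move: Hs; case: ltP; rewrite kR in nk *; lra.
have low j : (st j).2 <= ln (mult lam (block_end k0 j) (wsum lam (st j).1))%:R.
  elim: j => [|j IHj]; first by rewrite ln_ge0 // ler1n /block_end big_ord0 (mult_gt0 lam [tuple]).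
  rewrite stS; have [u [-> _ _]] := HF (j, st j) (sz j) => /=.
  rewrite wsum_cat sz block_endS.
  have p1 : (0 < mult lam (block_end k0 j) (wsum lam (st j).1))%N.
    by have pt : size (st j).1 == block_end k0 j by [apply/eqP]; exact: (mult_gt0 lam (Tuple pt)).
  have p2 := mult_gt0 lam u.
  apply: (@le_trans _ _ (ln (mult lam (block_end k0 j) (wsum lam (st j).1) * mult lam (k0 + j) (wsum lam u))%:R)).
    by rewrite natrM lnM ?posrE ?ltr0n // lerD2r.
  rewrite ler_ln ?posrE ?ltr0n ?ler_nat ?mult_cat ?muln_gt0 ?p1 //.
  by rewrite (leq_trans _ (mult_cat _ _ _ _ _)) // muln_gt0 p1.
have up j : ln (near_mult lam c (block_end k0 j) (wsum lam (st j).1))%:R <=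
    (st j).2 + D * (j%:R * Num.sqrt (j.+1)%:R).
  elim: j => [|j IHj].
    rewrite /= mul0r mulr0 addr0 ln_le0 // (_ : 1 = 1%:R) // ler_nat /block_end big_ord0.
    by rewrite (leq_trans (max_card _)) // card_tuple.
  rewrite stS; have [u [-> _ /= H]] := HF (j, st j) (sz j).
  apply: (le_trans H) => /=.
  have : Num.sqrt (j.+1)%:R <= Num.sqrt (j.+2)%:R :> R by rewrite ler_sqrt ?ler_nat.
  set t1 := Num.sqrt _; set t2 := Num.sqrt _ => t12.
  have : 0 <= D * (t2 - t1) by rewrite mulr_ge0 // subr_ge0.
  have : 0 <= j%:R * (D * (t2 - t1)) by rewrite !mulr_ge0 // subr_ge0.
  move: IHj; rewrite -/t1 -natr1; lra.
exists (fun j => (st j).1), (D + 2 + k0%:R) => j; split.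
- exact: sz.
- by rewrite stS; have [u [-> _ _]] := HF (j, st j) (sz j); exists u.
- apply: le_trans (low j).
  have [j0|j0] := posnP j.
    by rewrite j0 /block_end big_ord0 !mul0r mulr0 subr0.
  have := mid j; rewrite ler_norml.
  have j1 : 1 <= j%:R :> R by rewrite ler1n.
  have := sq1 j; set t := Num.sqrt _ => t1.
  have : 0 <= k0%:R :> R by [].
  have : 0 <= D * (j%:R * t) by rewrite !mulr_ge0 //; lra.
  have : 0 <= (2 + k0%:R) * (j%:R * (t - 1)) :> R by rewrite !mulr_ge0 //; lra.
  have : 0 <= k0%:R * (j%:R - 1) :> R by rewrite mulr_ge0 //; lra.
  lra.
- apply: (le_trans (up j)).
  have [j0|j0] := posnP j.
    by rewrite j0 /block_end big_ord0 !mul0r !mulr0.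
  have := mid j; rewrite ler_norml.
  have j1 : 1 <= j%:R :> R by rewrite ler1n.
  have := sq1 j; set t := Num.sqrt _ => t1.
  have : 0 <= k0%:R :> R by [].
  have : 0 <= (2 + k0%:R) * (j%:R * (t - 1)) :> R by rewrite !mulr_ge0 //; lra.
  have : 0 <= k0%:R * (j%:R - 1) :> R by rewrite mulr_ge0 //; lra.
  lra.
Qed.

End Sequence.

(** * Large multiplicities and typical words for the inverse of beta *)

Lemma mult_ge_size (R : realType) (lam y : R) (L : nat) (W : seq (seq bool)) :
  uniq W -> {in W, forall u, size u = L /\ wsum lam u = y} ->
  (size W <= mult lam L y)%N.
Proof.
move=> uW WP.
have -> : size W = size (pmap insub W : seq (L.-tuple bool)).
  rewrite size_pmap_sub; apply/esym/eqP; rewrite -all_count; apply/allP => u uin.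
  by apply/eqP; case: (WP u uin).
rewrite -(card_uniqP (pmap_sub_uniq _ uW)) /mult subset_leq_card //.
apply/fintype.subsetP => u; rewrite mem_pmap_sub inE => uin.
by apply/eqP; case: (WP _ uin).
Qed.

(** Repeating a word of W k / L times multiplies the coincidences, each repetition contributing a
    factor [size W]; the incomplete last block accounts for the subtracted logarithm. *)
Lemma max_mult_ge (R : realType) (lam y : R) (L : nat) (W : seq (seq bool)) :
  (0 < L)%N -> uniq W -> (0 < size W)%N ->
  {in W, forall u, size u = L /\ wsum lam u = y} ->
  forall k, exists u : k.-tuple bool,
    ln (size W)%:R / L%:R * k%:R - ln (size W)%:R <=
      ln (mult lam k (wsum lam u))%:R :> R.
Proof.
move=> L0 uW W0 WP k.
have [w wW] : exists w, w \in W by case: W W0 {uW WP} => // w W _; exists w; rewrite mem_head.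
have [sw wy] := WP w wW.
have wt : size w == L by apply/eqP.
have pow : forall j, exists u : (j * L).-tuple bool, (size W ^ j <= mult lam (j * L) (wsum lam u))%N.
  elim=> [|j [u uj]]; first by exists [tuple]; rewrite expn0 mult_gt0.
  exists [tuple of Tuple wt ++ u]; rewrite /= wsum_cat (eqP wt).
  rewrite (leq_trans _ (mult_cat _ _ _ _ _)) // expnS leq_mul //.
  by rewrite wy mult_ge_size.
have [u uj] := pow (k %/ L)%N.
pose r := [tuple of nseq (k %% L) true].
have kt : size (u ++ r) == k.
  by rewrite size_cat !size_tuple -divn_eq.
exists (Tuple kt) => /=.
have W1 : 0 < (size W)%:R :> R by rewrite ltr0n.
have lW : 0 <= ln (size W)%:R :> R by rewrite ln_ge0 // ler1n.
apply: (@le_trans _ _ (ln (size W ^ (k %/ L))%:R)).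
  rewrite natrX lnXn // -[leRHS]mulr_natl.
  have LR : 0 < L%:R :> R by rewrite ltr0n.
  have kL : k%:R <= ((k %/ L)%:R + 1) * L%:R :> R.
    by rewrite natr1 -natrM ler_nat ltnW // ltn_ceil.
  rewrite -(ler_pM2r LR).
  have -> : (ln (size W)%:R / L%:R * k%:R - ln (size W)%:R) * L%:R =
     ln (size W)%:R * (k%:R - L%:R) :> R by field; rewrite gt_eqF.
  have : 0 <= ln (size W)%:R * (((k %/ L)%:R + 1) * L%:R - k%:R) :> R by rewrite mulr_ge0 //; lra.
  lra.
have uj2 : (size W ^ (k %/ L) <= mult lam k (wsum lam (u ++ r)))%N.
  rewrite [X in mult _ X](divn_eq k L) wsum_cat size_tuple.
  rewrite (leq_trans _ (mult_cat _ _ _ _ _)) // (leq_trans uj) // leq_pmulr //.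
  exact: (mult_gt0 lam r).
rewrite ler_ln ?posrE ?ltr0n ?expn_gt0 ?W0 ?ler_nat //.
by rewrite (leq_trans _ uj2) // expn_gt0 W0.
Qed.

(** With C = (1 - lam)^-1, the constant c = 4 C^2 satisfies 2 C + c lam <= c, needed for [near_cat],
    and c >= 4 C: a word sum within C lam^L of the limit point, a ball of radius 2 C lam^L and a
    tail C lam^L add up to 4 C lam^L. *)
Definition typical_words (R : realType) (lam g : R) : Prop :=
  exists (k0 : nat) (P : nat -> seq bool) (D : R), (0 < k0)%N /\ forall j,
  [/\ size (P j) = block_end k0 j, exists v, P j.+1 = P j ++ v,
      (block_end k0 j)%:R * g - D * (j%:R * Num.sqrt (j.+1)%:R) <=
        ln (mult lam (block_end k0 j) (wsum lam (P j)))%:R &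
      ln (near_mult lam (4 * (1 - lam)^-1 ^+ 2) (block_end k0 j) (wsum lam (P j)))%:R <=
        (block_end k0 j)%:R * g + D * (j%:R * Num.sqrt (j.+1)%:R)].

Section Salem.
Variables (R : realType) (n : nat).
Hypothesis n4 : (4 <= n)%N.
Variable b : R.
Hypothesis br : is_largest_root (beta_poly R n) b.

Lemma salem_bounds : 1 / 2 < b^-1 /\ b^-1 < 1.
Proof.
have b1 := beta_ge n4 br; have b2 := beta_lt2 n4 br.
by rewrite div1r ltf_pV2 ?posrE ?invf_lt1; try split; lra.
Qed.

Lemma salem_max_mult : exists g' K0 : R, ln (2 * b^-1) < g' /\
  forall k, exists u : k.-tuple bool,
    g' * k%:R - K0 <= ln (mult b^-1 k (wsum b^-1 u))%:R.
Proof.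
have [L [W [y [L0 uW WP bW]]]] := wsum_coincidences n4 br.
have b1 := beta_ge n4 br.
have bL : 0 < b ^+ L by rewrite exprn_gt0; lra.
have W0 : (0 < size W)%N.
  rewrite -(ltr0n R) -(pmulr_lgt0 _ bL) (lt_trans _ bW) // exprn_gt0 //; lra.
exists (ln (size W)%:R / L%:R), (ln (size W)%:R); split; last exact: max_mult_ge WP.
have b0 : 0 < 2 * b^-1 by rewrite mulr_gt0 ?invr_gt0; lra.
rewrite ltr_pdivlMr ?ltr0n // mulr_natr -lnXn // ltr_ln ?posrE ?exprn_gt0 ?ltr0n //.
by rewrite exprMn exprVn ltr_pdivrMr.
Qed.

Lemma salem_typical_words : exists ga gb : R,
  [/\ ga < gb, gb < ln 2 & forall g, ga <= g <= gb -> typical_words b^-1 g].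
Proof.
have [l1 l2] := salem_bounds; set lam := b^-1 in l1 l2 *.
have [g' [K0 [gg' gK]]] := salem_max_mult.
pose C := (1 - lam)^-1.
have C1 : 0 < C by rewrite invr_gt0; lra.
have CE : C * (1 - lam) = 1 by rewrite mulVf //; lra.
have c0 : 0 <= 4 * C ^+ 2 by rewrite mulr_ge0 ?sqr_ge0.
have [K [m sepA]] := wsum_separation n4 br c0.
have cC : 2 * C + 4 * C ^+ 2 * lam <= 4 * C ^+ 2.
  have : 4 * C ^+ 2 * (1 - lam) = 4 * C by rewrite expr2 -mulrA -mulrA CE mulr1.
  lra.
have sep k x : \sum_(v : k.-tuple bool | `|wsum lam v - x| <= 4 * C ^+ 2 * lam ^+ k)
     (mult lam k (wsum lam v))%:R^-1 <= (K * k.+1 ^ m)%:R :> R.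
  rewrite (sum_reps lam k (fun s => `|s - x| <= 4 * C ^+ 2 * lam ^+ k)) ler_nat.
  apply: (sepA k _ x).
    by move=> u v; rewrite !inE => /andP[ur _] /andP[vr _]; apply: reps_inj; rewrite inE.
  by move=> u; rewrite !inE => /andP[].
have ln21 : ln 2 <= 1 :> R by rewrite (le_trans (@le_ln1Dx R 1 _)) //; lra.
have s1 : ln (2 * lam) < ln 2 by rewrite ltr_ln ?posrE //; lra.
have s0 : 0 < ln (2 * lam) by rewrite ln_gt0; lra.
(* The minimum with ln 2 keeps the dimension (ln 2 - g) / (- ln lam) positive; the thirds below put
   a closed interval inside (s, t). *)
pose s := ln (2 * lam); pose t := Num.min g' (ln 2).
have st : s < t by rewrite lt_min gg' s1.
have [tg1 tg2] : t <= g' /\ t <= ln 2 by rewrite !ge_min !lexx orbT.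
exists ((2 * s + t) / 3), ((s + 2 * t) / 3); split; [lra|lra|].
move=> g /andP[gl gr].
have sg : s < g by lra.
have gg : g < g' by lra.
have [q0 [q1 [k1 [q00 H]]]] := gibbs_exponent l1 l2 sg gg gK.
have g01 : 0 <= g <= 1 by rewrite /s in sg *; lra.
have dr k : (k1.+1 <= k)%N -> exists2 q, q0 <= q & gibbs_drift lam g k q = 0.
  by move=> /ltnW /H [q [? _ ?]]; exists q.
have [P [D HP]] := word_sequence l1 l2 cC sep g01 q00 (ltn0Sn k1) dr.
by exists k1.+1, P, D.
Qed.

End Salem.

(** * Mass of balls *)

Definition close_words (R : realType) (lam : R) k (x r : R) : {set k.-tuple bool} :=
  [set u : k.-tuple bool | `|wsum lam u - x| <= r].

Section Law.
Variables (R : realType) (lam : R).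
Hypotheses (lam_gt : 1 / 2 < lam) (lam_lt : lam < 1).
Let lamb : 1 / 2 < lam /\ lam < 1 := conj lam_gt lam_lt.
Let C := (1 - lam)^-1.

Section Cylinders.
Variables (d : measure_display) (T : measurableType d) (P : probability T R).
Variables (eps : nat -> {RV P >-> R}) (S : {RV P >-> R}).
Hypotheses (eps_indep : mutually_independent eps).
Hypothesis eps_sign : forall n w, eps n w = 1 \/ eps n w = - 1.
Hypothesis eps_half : forall n, P [set w | eps n w = 1]%classic = (2^-1)%:E /\
                  P [set w | eps n w = - 1]%classic = (2^-1)%:E.
Hypothesis eps_sum : forall w,
  (series (fun n => eps n w * lam ^+ n) n @[n --> \oo] --> S w)%classic.

(** Written as an intersection over a finite set of indices, the form in which
    [mutually_independent] gives the product rule. *)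
Definition cylinder k (u : k.-tuple bool) : set T :=
  (\bigcap_(i in [set` [fset j in iota 0 k]%fset]) eps i @^-1` [set digit R (nth false u i)])%classic.

Lemma measurable_cylinder k (u : k.-tuple bool) : measurable (cylinder u).
Proof.
apply: bigcap_measurableType => i _; rewrite -[X in measurable X]setTI.
exact: measurable_funP.
Qed.

Lemma probability_cylinder k (u : k.-tuple bool) : P (cylinder u) = ((2 ^+ k)^-1)%:E.
Proof.
rewrite /cylinder (eps_indep _ (A := fun i => [set digit R (nth false u i)]%classic)); last first.
  by move=> j; exact: measurable_set1.
rewrite (eq_bigr (fun=> (2^-1)%:E)); last first.
  by move=> i _; rewrite /digit; have [h1 h2] := eps_half i; case: ifP => _.
rewrite -[RHS]/((2 ^+ k)^-1%:E) -exprVn.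
have -> : (2^-1 ^+ k)%:E = (\prod_(i <- [fset j in iota 0 k]%fset) (2^-1 : R))%:E.
  by rewrite big_const_seq count_predT card_fseq undup_id ?iota_uniq // size_iota -iter_mulr_1.
by rewrite prodEFin.
Qed.

Definition digits k (w : T) : k.-tuple bool := [tuple of mkseq (fun i => eps i w == 1) k].

Lemma digit_eps i w : digit R (eps i w == 1) = eps i w.
Proof. by rewrite /digit; case: eqP => // e; have [] := eps_sign i w. Qed.

Lemma mem_cylinder k (u : k.-tuple bool) w : cylinder u w -> u = digits k w.
Proof.
move=> uw; apply: val_inj; apply: (@eq_from_nth _ false).
  by rewrite size_mkseq size_tuple.
move=> i; rewrite size_tuple => ik; rewrite nth_mkseq //.
have := uw i; rewrite /= => -> //; last first.
  by rewrite /= inE mem_iota /= add0n.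
rewrite /digit; case: (nth false u i); first by rewrite eqxx.
by rewrite lt_eqF //; lra.
Qed.

Lemma cylinder_digits k w : cylinder (digits k w) w.
Proof.
move=> i /=; rewrite inE mem_iota /= add0n => ik.
by rewrite nth_mkseq // digit_eps.
Qed.

Lemma digits_cat k j w :
  digits (k + j) w = digits k w ++ mkseq (fun i => eps (k + i) w == 1) j :> seq bool.
Proof.
have iE : iota k j = map (addn k) (iota 0 j) by rewrite -iotaDl addn0.
by rewrite /= /mkseq iotaD map_cat add0n iE -map_comp.
Qed.

Lemma series_digits k w :
  series (fun n => eps n w * lam ^+ n) k = wsum lam (digits k w).
Proof.
elim: k => [|k IHk]; first by rewrite /series /= big_geq.
rewrite -[in RHS](addn1 k) digits_cat wsum_cat size_tuple -IHk /=.
rewrite addn0 digit_eps mulr0 addr0 [in RHS]mulrC.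
by rewrite /series /= big_nat_recr.
Qed.

Lemma tail_le k w : `|S w - wsum lam (digits k w)| <= C * lam ^+ k.
Proof.
have [l1 l2] := lamb.
have cv : (`|series (fun n => eps n w * lam ^+ n) n - wsum lam (digits k w)| @[n --> \oo]
    --> `|S w - wsum lam (digits k w)|)%classic.
  by apply: cvg_norm; apply: cvgB; [exact: eps_sum|exact: cvg_cst].
apply: (ler_cvg_to cv (cvg_cst (C * lam ^+ k))).
exists k => // j /= kj; rewrite series_digits -(subnKC kj) digits_cat.
rewrite wsum_cat size_tuple addrAC subrr add0r normrM.
have lk : 0 <= lam ^+ k by rewrite exprn_ge0; lra.
by rewrite (ger0_norm lk) mulrC ler_wpM2r // normr_wsum.
Qed.

Let I x r : set R := `[x - r, x + r]%classic.

Let measurable_preimage x r : measurable (S @^-1` I x r)%classic.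
Proof.
rewrite -[X in measurable X]setTI; apply: measurable_funP => //; exact: measurable_itv.
Qed.

Lemma sum_cylinder k (B : {set k.-tuple bool}) :
  (\sum_(u \in [set` enum B]) P (cylinder u) = (#|B|%:R / 2 ^+ k)%:E)%E.
Proof.
rewrite -fsbig_seq ?enum_uniq //; under eq_bigr => u _ do rewrite probability_cylinder.
by rewrite sumEFin big_const_seq count_predT iter_addr_0 -cardE mulr_natl.
Qed.

(** The first k digits determine S up to C lam^k, so the cylinders of the words whose sum is close
    to x cover the event. *)
Lemma probability_close_le k x r :
  (P (S @^-1` I x r)%classic <=
   (#|close_words lam k x (r + C * lam ^+ k)|%:R / 2 ^+ k)%:E)%E.
Proof.
rewrite -sum_cylinder; apply: content_sub_fsum; first exact: finite_seq.
- by move=> u _; exact: measurable_cylinder.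
- exact: measurable_preimage.
move=> w; rewrite /I /= in_itv /= => Sw; exists (digits k w); last exact: cylinder_digits.
rewrite /= mem_enum inE; have := tail_le k w; move: Sw.
by rewrite !ler_norml; lra.
Qed.

Lemma probability_close_ge k x r :
  ((#|close_words lam k x (r - C * lam ^+ k)|%:R / 2 ^+ k)%:E <=
    P (S @^-1` I x r)%classic)%E.
Proof.
have cyl_triv (D : set (k.-tuple bool)) : trivIset D (@cylinder k).
  by move=> u v _ _ [w [/mem_cylinder -> /mem_cylinder ->]].
have cyl_meas (u : k.-tuple bool) := measurable_cylinder u.
rewrite -sum_cylinder -measure_fin_bigcup //.
apply: le_measure; rewrite ?inE.
- apply: fin_bigcup_measurable; first exact: finite_seq.
  by move=> u _; exact: measurable_cylinder.
- exact: measurable_preimage.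
move=> w [u /=]; rewrite mem_enum inE => ux /mem_cylinder uw.
rewrite /I /= in_itv /=; have := tail_le k w; move: ux; rewrite uw.
by rewrite !ler_norml; lra.
Qed.

End Cylinders.

Variable nu : probability R R.
Hypothesis nuP : is_bernoulli_convolution lam nu.

Lemma closed_ball_itvE (x r : R) : 0 < r ->
  closed_ball x r = `[x - r, x + r]%classic.
Proof.
move=> r0; rewrite closed_ballE //; apply/seteqP; split => y /=;
by rewrite /closed_ball_ /= in_itv /= distrC ler_distl.
Qed.

Lemma bernoulli_ball_le k x r : 0 < r ->
  (nu (closed_ball x r) <=
   (#|close_words lam k x (r + C * lam ^+ k)|%:R / 2 ^+ k)%:E)%E.
Proof.
move=> r0; have [d [T [P [eps [S [i1 i2 i3 i4 i5]]]]]] := nuP.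
rewrite closed_ball_itvE // i5; last exact: measurable_itv.
by apply: (@probability_close_le _ _ P eps).
Qed.

Lemma bernoulli_ball_ge k x r : 0 < r ->
  ((#|close_words lam k x (r - C * lam ^+ k)|%:R / 2 ^+ k)%:E <=
    nu (closed_ball x r))%E.
Proof.
move=> r0; have [d [T [P [eps [S [i1 i2 i3 i4 i5]]]]]] := nuP.
rewrite closed_ball_itvE // i5; last exact: measurable_itv.
by apply: (@probability_close_ge _ _ P eps).
Qed.

End Law.

Lemma near_at_right0 (R : realType) (A : R -> Prop) (r0 : R) : 0 < r0 ->
  (forall r, 0 < r -> r < r0 -> A r) -> (\forall r \near 0^'+, A r)%classic.
Proof.
move=> r00 H; near=> r; apply: H; first by near: r; exact: nbhs_right_gt.
by near: r; exact: nbhs_right_lt.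
Unshelve. all: by end_near.
Qed.

Lemma expr_small (R : realType) (lam e : R) : 0 < lam -> lam < 1 -> 0 < e ->
  exists k : nat, forall j, (k <= j)%N -> lam ^+ j < e.
Proof.
move=> l0 l1 e0; have nl : `|lam| < 1 by rewrite gtr0_norm.
have /cvgr0Pnorm_lt/(_ e e0) [k _ H] := cvg_expr nl.
exists k => j kj; have := H j kj.
by rewrite /= ger0_norm // exprn_ge0 // ltW.
Qed.

Section Ball.
Variables (R : realType) (lam : R).
Hypotheses (lam_gt : 1 / 2 < lam) (lam_lt : lam < 1).
Let lamb : 1 / 2 < lam /\ lam < 1 := conj lam_gt lam_lt.
Let C := (1 - lam)^-1.
Variable nu : probability R R.
Hypothesis nuP : is_bernoulli_convolution lam nu.

Definition ball_mass x r : R := fine (nu (closed_ball x r)).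

Lemma measurable_cball (x r : R) : measurable (closed_ball x r : set R).
Proof. exact: measurable_closed_ball. Qed.

Lemma ball_massE x r : nu (closed_ball x r) = (ball_mass x r)%:E.
Proof. by rewrite /ball_mass fineK // fin_num_measure //; exact: measurable_cball. Qed.

Lemma ball_mass_ge0 x r : 0 <= ball_mass x r.
Proof. by rewrite /ball_mass fine_ge0. Qed.

Lemma ball_mass_le1 x r : ball_mass x r <= 1.
Proof. by rewrite -lee_fin -ball_massE probability_le1 //; exact: measurable_cball. Qed.

Lemma ball_mass_mono x r s : 0 < r -> r <= s -> ball_mass x r <= ball_mass x s.
Proof.
move=> r0 rs; rewrite -lee_fin -!ball_massE le_measure ?inE //; try exact: measurable_cball.
rewrite !closed_ball_itvE //; last exact: lt_le_trans rs.
by move=> y /=; rewrite !in_itv /=; lra.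
Qed.

Lemma ball_mass_ge k x r y : 0 < r -> `|y - x| + C * lam ^+ k <= r ->
  (mult lam k y)%:R / 2 ^+ k <= ball_mass x r.
Proof.
move=> r0 yx; rewrite -lee_fin -ball_massE.
apply: le_trans (bernoulli_ball_ge lam_gt lam_lt nuP k x r0).
rewrite lee_fin ler_pM2r ?invr_gt0 ?exprn_gt0 // ler_nat /mult /close_words.
apply: subset_leq_card; apply/fintype.subsetP => u; rewrite !inE => /eqP ->.
by rewrite /C in yx; lra.
Qed.

Lemma ball_mass_le_near c k x r y : 0 < r ->
  `|y - x| + r + C * lam ^+ k <= c * lam ^+ k ->
  ball_mass x r <= (near_mult lam c k y)%:R / 2 ^+ k.
Proof.
move=> r0 yx; rewrite -lee_fin -ball_massE.
apply: le_trans (bernoulli_ball_le lam_gt lam_lt nuP k x r0) _.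
rewrite lee_fin ler_pM2r ?invr_gt0 ?exprn_gt0 // ler_nat /near_mult /close_words.
apply: subset_leq_card; apply/fintype.subsetP => u; rewrite !inE => ux.
rewrite /C in yx; apply: (le_trans (ler_distD x _ _)); rewrite [ `|x - y| ]distrC.
lra.
Qed.

Section Dimension.
Variable g : R.
Hypothesis g_lt : g < ln 2.
Hypothesis typ : typical_words lam g.

(** Each word extends the previous one, so the intervals of radius C lam^L around their sums are
    nested; x is a common point. At radius 2 C lam^L the ball contains the whole cylinder of the
    word, which gives the lower bound by [mult]; the upper one is by [near_mult]. *)
Lemma typical_point : exists (x : R) (k0 : nat) (D : R), [/\ (0 < k0)%N, 0 <= D &
  forall j, let L := block_end k0 j in
  let h := ln (ball_mass x (2 * C * lam ^+ L)) in
  0 < ball_mass x (2 * C * lam ^+ L) /\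
  `|h + L%:R * (ln 2 - g)| <= D * (j%:R * Num.sqrt (j.+1)%:R)].
Proof.
have [l1 l2] := lamb; have l0 : 0 < lam by lra.
have C0 : 0 < C := wsum_radius_gt0 lam_lt.
have C1 : 1 <= C.
  by rewrite /C -[leLHS]invr1 lef_pV2 ?posrE //; lra.
have [k0 [P [D [k00 HP]]]] := typ.
pose L := block_end k0.
have lL j : 0 < lam ^+ L j by rewrite exprn_gt0.
pose a j := wsum lam (P j) - C * lam ^+ L j.
pose b j := wsum lam (P j) + C * lam ^+ L j.
have step j : a j <= a j.+1 /\ b j.+1 <= b j.
  have [sj [v vE] _ _] := HP j; have [sj1 _ _ _] := HP j.+1.
  rewrite /a /b vE wsum_cat sj.
  have -> : L j.+1 = (L j + size v)%N by rewrite -[L j]sj -size_cat -vE sj1.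
  rewrite exprD.
  have wv : `|wsum lam v| <= C - C * lam ^+ size v.
    elim: v {vE} => [|t v IHv]; first by rewrite /= expr0 mulr1 subrr normr0.
    rewrite /= exprS (le_trans (ler_normD _ _)) // normrM gtr0_norm // -/C.
    have -> : `|digit R t| = 1 by case: t; rewrite /= ?normrN normr1.
    have CE : 1 + lam * C = C := wsum_radiusE lam_lt.
    have : 0 <= lam * (C - C * lam ^+ size v - `|wsum lam v|) by rewrite mulr_ge0 //; lra.
    lra.
  have : 0 <= lam ^+ L j * (C - C * lam ^+ size v - `|wsum lam v|).
    by rewrite mulr_ge0 //; [exact: ltW|lra].
  have w1 := ler_norm (wsum lam v); have w2 := ler_norm (- wsum lam v).
  rewrite normrN in w2.
  have : 0 <= lam ^+ L j * (`|wsum lam v| - wsum lam v) by rewrite mulr_ge0 //; [exact: ltW|lra].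
  have : 0 <= lam ^+ L j * (`|wsum lam v| + wsum lam v) by rewrite mulr_ge0 //; [exact: ltW|lra].
  by move=> *; split; lra.
have am i j : (i <= j)%N -> a i <= a j.
  move=> /subnK <-; elim: (j - i)%N => [|m IHm]; first by rewrite add0n.
  by rewrite addSn (le_trans IHm) //; have [] := step (m + i)%N.
have bm i j : (i <= j)%N -> b j <= b i.
  move=> /subnK <-; elim: (j - i)%N => [|m IHm]; first by rewrite add0n.
  by rewrite addSn (le_trans _ IHm) //; have [] := step (m + i)%N.
have ab j : a j <= b j by rewrite /a /b; have := mulr_gt0 C0 (lL j); lra.
have ub i j : a i <= b j.
  have [ij|ji] := leP i j; first by rewrite (le_trans (am _ _ ij)).
  by rewrite (le_trans (ab _)) // bm // ltnW.
pose x := sup (range a)%classic.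
have ax j : a j <= x.
  apply: sup_upper_bound; last by exists j.
  by split; [exists (a 0%N), 0%N|exists (b 0%N) => _ [i _ <-]].
have xb j : x <= b j.
  by apply: ge_sup; [exists (a 0%N), 0%N|move=> _ [i _ <-]].
have xP j : `|wsum lam (P j) - x| <= C * lam ^+ L j.
  by have := ax j; have := xb j; rewrite /a /b ler_norml; lra.
exists x, k0, `|D|; split => // j L0 h; rewrite {}/h {}/L0 -/(L j); set h := ln (ball_mass _ _).
have [sj _ lo hi] := HP j; rewrite -/(L j) in sj lo hi.
have r0 : 0 < 2 * C * lam ^+ L j by rewrite !mulr_gt0.
have pt : size (P j) == L j by apply/eqP.
have m0 : 0 < (mult lam (L j) (wsum lam (P j)))%:R :> R.
  by rewrite ltr0n (mult_gt0 lam (Tuple pt)).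
have p2 : 0 < 2 ^+ L j :> R by rewrite exprn_gt0.
have ge : (mult lam (L j) (wsum lam (P j)))%:R / 2 ^+ L j <= ball_mass x (2 * C * lam ^+ L j).
  by apply: ball_mass_ge => //; have := xP j; lra.
have bp : 0 < ball_mass x (2 * C * lam ^+ L j) by rewrite (lt_le_trans _ ge) // divr_gt0.
have le : ball_mass x (2 * C * lam ^+ L j) <=
    (near_mult lam (4 * C ^+ 2) (L j) (wsum lam (P j)))%:R / 2 ^+ L j.
  apply: ball_mass_le_near => //; have := xP j.
  have lj := lL j; have : 0 <= lam ^+ L j * (4 * (C * (C - 1))) by rewrite !mulr_ge0 //; lra.
  rewrite expr2; lra.
have n0 : 0 < (near_mult lam (4 * C ^+ 2) (L j) (wsum lam (P j)))%:R :> R.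
  by have := lt_le_trans bp le; rewrite pmulr_lgt0 // invr_gt0.
have l2k : ln (2 ^+ L j) = (L j)%:R * ln 2 :> R by rewrite lnXn // mulr_natl.
have ge' : ln (mult lam (L j) (wsum lam (P j)))%:R - (L j)%:R * ln 2 <= h.
  by rewrite -l2k -ln_div ?posrE // ler_ln ?posrE // divr_gt0.
have le' : h <= ln (near_mult lam (4 * C ^+ 2) (L j) (wsum lam (P j)))%:R - (L j)%:R * ln 2.
  by rewrite -l2k -ln_div ?posrE // ler_ln ?posrE // divr_gt0.
split => //.
have t0 : 0 <= j%:R * Num.sqrt (j.+1)%:R :> R by rewrite mulr_ge0 ?sqrtr_ge0.
have : 0 <= (`|D| - D) * (j%:R * Num.sqrt (j.+1)%:R).
  by rewrite mulr_ge0 // subr_ge0 ler_norm.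
rewrite -/C in hi; rewrite ler_norml; lra.
Qed.

End Dimension.
End Ball.

(** * Local dimensions *)

(** With s = sqrt (j + 2), accumulated errors are of order s^3, while [block_end] is at least s^4 /
    8. *)
Lemma block_growth (R : realType) (k0 : nat) (M e c : R) :
  (0 < k0)%N -> 0 <= M -> 0 < e -> 0 <= c ->
  exists J : nat, forall j, (J <= j)%N ->
    M * Num.sqrt (j + 2)%:R ^+ 3 + c <= e * (block_end k0 j)%:R.
Proof.
move=> k00 M0 e0 c0.
pose s0 : R := 2 + 16 * (M + c) / e.
have s02 : 2 <= s0 by rewrite lerDl divr_ge0 ?mulr_ge0 ?addr_ge0 // ltW.
exists (Num.bound (s0 ^+ 2)) => j Jj.
set s := Num.sqrt _.
have s2 : s ^+ 2 = j%:R + 2 by rewrite sqr_sqrtr // natrD.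
have sge0 : 0 <= s by exact: sqrtr_ge0.
have ss0 : s0 <= s.
  rewrite -(@ler_pXn2r _ 2) ?nnegrE //; last by lra.
  rewrite s2; have := archi_boundP (sqr_ge0 s0).
  have : (Num.bound (s0 ^+ 2))%:R <= j%:R :> R by rewrite ler_nat.
  lra.
have ge : j%:R * (j%:R + 1) <= 2 * (block_end k0 j)%:R :> R.
  by have := block_end_ge j k00; rewrite -(ler_nat R) !natrM natr1.
have jE : j%:R = s ^+ 2 - 2 :> R by rewrite s2; lra.
have s4 : 4 <= s ^+ 2 by rewrite expr2; nra.
have ge8 : s ^+ 4 <= 8 * (block_end k0 j)%:R.
  rewrite jE in ge; have -> : s ^+ 4 = s ^+ 2 * s ^+ 2 by ring.
  nra.
have es : 16 * (M + c) <= e * s.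
  have : 16 * (M + c) / e <= s by move: ss0; rewrite /s0; lra.
  by rewrite ler_pdivrMr // [leRHS]mulrC.
have s3 : 1 <= s ^+ 3 by rewrite exprn_ege1 //; lra.
have h1 : 16 * (M + c) * s ^+ 3 <= e * s ^+ 4.
  have -> : e * s ^+ 4 = e * s * s ^+ 3 by ring.
  by rewrite ler_wpM2r //; lra.
have h2 : e * s ^+ 4 <= e * (8 * (block_end k0 j)%:R) by rewrite ler_pM2l.
have : 0 <= c * (s ^+ 3 - 1) by rewrite mulr_ge0 //; lra.
have : 0 <= M * s ^+ 3 by rewrite mulr_ge0 //; lra.
have : 0 <= e * (block_end k0 j)%:R by rewrite mulr_ge0 // ltW.
lra.
Qed.

(** Here T is - ln r, H is minus the logarithm of the mass of the ball, and L and L + K are the ends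
    of the block in which the scale r falls. *)
Lemma quotient_estimate (R : realFieldType) (a la al c e L K E1 E2 T H : R) :
  al * la = a -> 0 < al -> 0 < e -> 0 <= a * K -> 0 <= E1 -> 0 <= E2 ->
  L * la - c <= T -> T <= (L + K) * la - c ->
  L * a - E1 <= H -> H <= (L + K) * a + E2 ->
  a * K + E1 + E2 + al * `|c| <= e * (L * la - `|c|) ->
  `|al * T - H| <= e * T.
Proof.
move=> alla al0 e0 aK E10 E20 t1 t2 h1 h2 err.
have c1 := ler_norm c; have c2 := ler_norm (- c); rewrite normrN in c2.
have eT : e * (L * la - c) <= e * T by rewrite ler_pM2l.
have eC : 0 <= e * (`|c| - c) by rewrite mulr_ge0 ?(ltW e0) //; lra.
have aT1 : al * (L * la - c) <= al * T by rewrite ler_pM2l.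
have aT2 : al * T <= al * ((L + K) * la - c) by rewrite ler_pM2l.
have ac1 : 0 <= al * (`|c| - c) by rewrite mulr_ge0 ?(ltW al0) //; lra.
have ac2 : 0 <= al * (`|c| + c) by rewrite mulr_ge0 ?(ltW al0) //; lra.
have alL x : al * (x * la - c) = x * a - al * c by rewrite -alla; ring.
rewrite !alL in aT1 aT2; rewrite ler_norml; apply/andP; split; lra.
Qed.

Section Dimension.
Variables (R : realType) (lam : R).
Hypotheses (lam_gt : 1 / 2 < lam) (lam_lt : lam < 1).
Let lamb : 1 / 2 < lam /\ lam < 1 := conj lam_gt lam_lt.
Let C := (1 - lam)^-1.
Variable nu : probability R R.
Hypothesis nuP : is_bernoulli_convolution lam nu.
Variable g : R.
Hypothesis g_lt : g < ln 2.
Hypothesis typ : typical_words lam g.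

(** The mass is controlled only at block ends. Between two of them monotonicity in r suffices,
    because the block length k0 + j is negligible against [block_end k0 j]. *)
Lemma local_dim_typical : (local_dim_set nu ((ln 2 - g) / - ln lam) !=set0)%classic.
Proof.
have [l1 l2] := lamb; have l0 : 0 < lam by lra.
have C0 : 0 < C := wsum_radius_gt0 lam_lt.
have [x [k0 [D [k00 D0 HD]]]] := typical_point lam_gt lam_lt nuP typ.
pose L := block_end k0; pose rad j := 2 * C * lam ^+ L j.
have rad0 j : 0 < rad j by rewrite !mulr_gt0 // exprn_gt0.
pose v := ball_mass nu x.
have {}HD j : 0 < v (rad j) /\
    `|ln (v (rad j)) + (L j)%:R * (ln 2 - g)| <= D * (j%:R * Num.sqrt (j.+1)%:R).
  by exact: HD.
pose la := - ln lam; have la0 : 0 < la by rewrite /la oppr_gt0 ln_lt0 // l0.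
pose a := ln 2 - g; have a0 : 0 < a by rewrite subr_gt0.
pose al := a / la; have al0 : 0 < al by rewrite divr_gt0.
have alla : al * la = a by rewrite /al mulfVK // gt_eqF.
pose c2 := ln (2 * C).
have lnrad j : ln (rad j) = c2 - (L j)%:R * la.
  rewrite /rad lnM ?posrE ?mulr_gt0 ?exprn_gt0 // lnXn // -[ln lam *+ _]mulr_natl /la -/c2; ring.
have LS j : (L j.+1)%:R = (L j)%:R + (k0%:R + j%:R) :> R by rewrite /L block_endS !natrD.
have rad_mono i j : (i <= j)%N -> rad j <= rad i.
  move=> ij; rewrite /rad ler_pM2l ?mulr_gt0 // ler_wiXn2l ?(ltW l0) ?(ltW l2) //.
  move: ij => /subnK <-; elim: (j - i)%N => [|m IHm]; first by rewrite add0n.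
  by rewrite addSn /L block_endS (leq_trans IHm) // leq_addr.
have rad_small e : 0 < e -> exists j, rad j <= e.
  move=> e0; have [k Hk] := expr_small l0 l2 (divr_gt0 e0 (mulr_gt0 (ltr0n R 2) C0)).
  exists k; rewrite /rad mulrC -ler_pdivlMr ?mulr_gt0 // ltW // Hk //.
  have := block_end_ge k k00; rewrite -/(L k); nia.
exists x; rewrite /local_dim_set /=; rewrite -/la -/a -/al.
have near_fin : (\forall r \near 0^'+, (ln (v r) / ln r)%:E =
    lne (nu (closed_ball x r)) / (ln r)%:E)%classic%E.
  apply: (@near_at_right0 _ _ 1) => // r r0 r1.
  have [j rj] := rad_small r r0.
  have vr : 0 < v r by rewrite (lt_le_trans (HD j).1) // ball_mass_mono.
  by rewrite ball_massE lne_EFin // inver lt_eqF ?ln_lt0 ?r0.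
apply: cvg_trans; first exact: (near_eq_cvg near_fin).
apply: cvg_EFin; first by near=> r.
rewrite /comp /=; apply/cvgrPdist_le => e e0.
pose M := a * (k0%:R + 1) + 2 * D + al * `|c2|.
have M0 : 0 <= M.
  have h1 : 0 <= a * (k0%:R + 1) := mulr_ge0 (ltW a0) (addr_ge0 (ler0n _ _) ler01).
  have h2 : 0 <= al * `|c2| := mulr_ge0 (ltW al0) (normr_ge0 _).
  by rewrite /M; lra.
have [J HJ] := block_growth k00 M0 (mulr_gt0 e0 la0) (mulr_ge0 (ltW (addr_gt0 e0 ltr01)) (addr_ge0 ler01 (normr_ge0 c2))).
apply: (@near_at_right0 _ _ (Num.min 1 (rad J))) => [|r r0].
  by rewrite lt_min ltr01 rad0.
rewrite lt_min => /andP[r1 rJ].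
(* The first radius not exceeding r; r < [rad J] forces its predecessor to have index at least J. *)
have [j [Jj rj1 rj]] : exists j, [/\ (J <= j)%N, rad j.+1 <= r & r < rad j].
  have [i0 ri0] := rad_small r r0.
  have ex : exists i, rad i <= r by exists i0.
  case: (ex_minnP ex) => [[|j]] rj jmin; first by have := rad_mono 0%N J isT; lra.
  exists j; split => //; last by rewrite ltNge; apply/negP => /jmin; rewrite ltnn.
  rewrite leqNgt; apply/negP => jJ.
  by have := rad_mono j.+1 J jJ; lra.
set T := - ln r; set H := - ln (v r).
have vr : 0 < v r by rewrite (lt_le_trans (HD j.+1).1) // ball_mass_mono.
have [vj /ler_normlP[h1 h2]] := HD j; have [vj1 /ler_normlP[h3 h4]] := HD j.+1.
have t1 : (L j)%:R * la - c2 <= T.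
  by rewrite /T; have : ln r <= ln (rad j) by [rewrite ler_ln ?posrE // ltW]; rewrite lnrad; lra.
have t2 : T <= (L j.+1)%:R * la - c2.
  by rewrite /T; have : ln (rad j.+1) <= ln r by [rewrite ler_ln ?posrE]; rewrite lnrad; lra.
have H1 : H <= - ln (v (rad j.+1)) by rewrite /H lerN2 ler_ln ?posrE // ball_mass_mono.
have H2 : - ln (v (rad j)) <= H by rewrite /H lerN2 ler_ln ?posrE // ball_mass_mono // ltW.
rewrite -/a in h1 h2 h3 h4.
pose s : R := Num.sqrt (j + 2)%:R.
have {}HJ := HJ j Jj; rewrite -/s -/(L j) in HJ.
have s2 : s ^+ 2 = j%:R + 2 by rewrite sqr_sqrtr // natrD.
have s0 : 0 <= s by exact: sqrtr_ge0.
have s1 : 1 <= s.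
  by rewrite /s -[leLHS]sqrtr1 ler_sqrt ?ler1n // addn2.
have e2 : Num.sqrt (j.+2)%:R = s by rewrite /s addn2.
have e1 : Num.sqrt (j.+1)%:R <= s :> R by rewrite /s ler_sqrt // ler_nat addn2.
rewrite e2 in h3 h4.
have s3 : s ^+ 3 = s * (j%:R + 2) by rewrite -s2; ring.
have j0 : 0 <= j%:R :> R by [].
have s31 : j%:R + 2 <= s ^+ 3.
  have : 0 <= (s - 1) * (j%:R + 2) by rewrite mulr_ge0 //; lra.
  by rewrite s3; lra.
have s32 : 1 <= s ^+ 3 by apply: le_trans s31; lra.
have Tpos : 0 < T by rewrite /T oppr_gt0 ln_lt0 // r0.
have main : `|al * T - H| <= e * T.
  apply: (quotient_estimate (a := a) (la := la) (c := c2) (L := (L j)%:R) (K := k0%:R + j%:R)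
    (E1 := D * s ^+ 3) (E2 := D * s ^+ 3)) => //.
  - exact: (mulr_ge0 (ltW a0) (addr_ge0 (ler0n _ _) j0)).
  - by rewrite mulr_ge0 // ltW // (lt_le_trans ltr01).
  - by rewrite mulr_ge0 // ltW // (lt_le_trans ltr01).
  - by rewrite -LS.
  - have b1 : D * (j%:R * Num.sqrt (j.+1)%:R) <= D * s ^+ 3.
      by rewrite ler_wpM2l // s3 mulrC ler_pM ?sqrtr_ge0 // lerDl.
    by apply: (le_trans _ H2); move: h1 h2 b1; lra.
  - have b2 : D * ((j.+1)%:R * s) <= D * s ^+ 3.
      by rewrite ler_wpM2l // s3 mulrC ler_wpM2l // -natr1 lerD2l ler1n.
    by apply: (le_trans H1); move: h3 b2; rewrite LS; lra.
  - have b3 : a * (k0%:R + j%:R) <= a * (k0%:R + 1) * s ^+ 3.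
      rewrite -mulrA ler_wpM2l // ?(ltW a0) //.
      have : 0 <= k0%:R * (s ^+ 3 - 1) by rewrite mulr_ge0 // subr_ge0.
      by move: s31; lra.
    have b4 : al * `|c2| <= al * `|c2| * s ^+ 3.
      by rewrite ler_peMr // mulr_ge0 // ltW.
    by have := normr_ge0 c2; move: HJ b3 b4; rewrite /M; lra.
have -> : al - ln (v r) / ln r = (al * T - H) / T.
  by rewrite /T /H; field; rewrite lt_eqF // ln_lt0 // r0.
by rewrite normrM normfV (gtr0_norm Tpos) ler_pdivrMr.
Unshelve. all: by end_near.
Qed.

End Dimension.

(** * Packings *)

(** Weighted arithmetic-geometric inequality for x / X and 1 / n, from the tangent to ln at their
    mean. Summed over a family it gives Hoelder's inequality against the constant 1. *)
Lemma powR_tangent (R : realType) (t x X n : R) : 0 <= t <= 1 ->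
  0 < x -> 0 < X -> 0 < n ->
  x `^ t <= X `^ t * n `^ (1 - t) * (t * (x / X) + (1 - t) / n).
Proof.
move=> /andP[t0 t1] x0 X0 n0.
have xX0 : 0 < x / X by rewrite divr_gt0.
have nV0 : 0 < n^-1 by rewrite invr_gt0.
have m0 : 0 < t * (x / X) + (1 - t) / n.
  have [->|tn] := eqVneq t 0; first by rewrite mul0r add0r subr0 mul1r.
  have tp : 0 < t by rewrite lt_neqAle eq_sym tn.
  apply: ltr_pwDl; first exact: mulr_gt0.
  by rewrite mulr_ge0 ?subr_ge0 ?(ltW nV0).
set m := t * (x / X) + (1 - t) / n in m0 *.
have lnle z : 0 < z -> ln z <= ln m + (z / m - 1).
  move=> z0; have zm : 0 < z / m by rewrite divr_gt0.
  have := @le_ln1Dx R (z / m - 1); rewrite [1 + _]addrC subrK.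
  by rewrite ln_div ?posrE // => /(_ _); lra.
have Xt : 0 < X `^ t by exact: powR_gt0.
have nt : 0 < n `^ (1 - t) by exact: powR_gt0.
rewrite -ler_ln ?posrE ?mulr_gt0 ?powR_gt0 // lnM ?posrE ?mulr_gt0 //.
rewrite lnM ?posrE // !ln_powR.
have hx := lnle _ xX0; have hn := lnle _ nV0.
rewrite ln_div ?posrE // in hx; rewrite lnV ?posrE // in hn.
have : t * (ln x - ln X) <= t * (ln m + (x / X / m - 1)) by rewrite ler_wpM2l.
have : (1 - t) * (- ln n) <= (1 - t) * (ln m + (n^-1 / m - 1)).
  by rewrite ler_wpM2l ?subr_ge0.
have : t * (x / X / m) + (1 - t) * (n^-1 / m) = 1.
  have aux (a1 a2 v : R) : t * (a1 * v) + (1 - t) * (a2 * v) = (t * a1 + (1 - t) * a2) * v by ring.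
  by rewrite aux divff // gt_eqF.
lra.
Qed.

Lemma sum_powR_interpolate (R : realType) (I : eqType) (s : seq I) (a : I -> R) (q t : R) :
  (forall i, i \in s -> 0 < a i) -> 0 <= t <= 1 -> s != [::] ->
  \sum_(i <- s) a i `^ (t * q) <=
    (\sum_(i <- s) a i `^ q) `^ t * (size s)%:R `^ (1 - t).
Proof.
move=> a0 t01 s0; set X := \sum_(i <- s) a i `^ q.
have n0 : 0 < (size s)%:R :> R by rewrite ltr0n; case: (s) s0.
have X0 : 0 < X.
  rewrite /X; case: s s0 a0 {X n0} => // i s _ a0.
  rewrite big_cons ltr_pwDl ?powR_gt0 ?a0 ?mem_head // sumr_ge0 // => j _; exact: powR_ge0.
set P := X `^ t * _.
apply: (@le_trans _ _ (\sum_(i <- s) P * (t * (a i `^ q / X) + (1 - t) / (size s)%:R))).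
  rewrite big_seq [leRHS]big_seq; apply: ler_sum => i iin.
  by rewrite mulrC powRrM powR_tangent // powR_gt0 // a0.
rewrite -mulr_sumr big_split /= -mulr_sumr -mulr_suml -/X divff ?gt_eqF // mulr1.
rewrite big_const_seq count_predT iter_addr_0 -[_ / _ *+ _]mulr_natr divfK ?gt_eqF //.
by rewrite addrC subrK mulr1.
Qed.

(** The l^p norms decrease in p: each factor a_i^(q' - q) is at most the total to the power (q' - q)
    / q. *)
Lemma sum_powR_lp_mono (R : realType) (I : eqType) (s : seq I) (a : I -> R) (q q' : R) :
  (forall i, i \in s -> 0 <= a i) -> 0 < q -> q <= q' ->
  \sum_(i <- s) a i `^ q' <= (\sum_(i <- s) a i `^ q) `^ (q' / q).
Proof.
move=> a0 q0 qq'; set X := \sum_(i <- s) a i `^ q.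
have X0 : 0 <= X by apply: sumr_ge0 => i _; exact: powR_ge0.
have q'0 : 0 < q' by exact: lt_le_trans qq'.
have [XE|Xn] := eqVneq X 0.
  rewrite XE powR0 ?gt_eqF ?divr_gt0 // big_seq big1 // => i iin.
  have : a i `^ q <= 0.
    rewrite -XE /X (big_rem i) //= lerDl sumr_ge0 // => j _; exact: powR_ge0.
  rewrite le_eqVlt ltNge powR_ge0 orbF => /eqP/powR_eq0_eq0 ->.
  by rewrite powR0 // gt_eqF.
have Xp : 0 < X by rewrite lt_neqAle eq_sym Xn.
have -> : q' / q = 1 + (q' - q) / q by field; rewrite gt_eqF.
rewrite powRD ?Xn ?implybT // powRr1 // /X mulr_suml -/X.
rewrite big_seq [leRHS]big_seq; apply: ler_sum => i iin.
have [aE|an] := eqVneq (a i) 0.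
  by rewrite aE powR0 ?gt_eqF // mulr_ge0 ?powR_ge0.
have -> : q' = q + (q' - q) by ring.
rewrite powRD ?an ?implybT // ler_wpM2l ?powR_ge0 // addrAC subrr add0r.
have ai := a0 i iin.
have -> : a i `^ (q' - q) = (a i `^ q) `^ ((q' - q) / q).
  by rewrite -powRrM; congr (_ `^ _); field; rewrite gt_eqF.
apply: ge0_ler_powR; rewrite ?nnegrE ?powR_ge0 ?divr_ge0 ?subr_ge0 ?(ltW q0) //.
rewrite /X (big_rem i) //= lerDl sumr_ge0 // => j _; exact: powR_ge0.
Qed.

Section Packing.
Variables (R : realType) (lam : R).
Hypotheses (lam_gt : 1 / 2 < lam) (lam_lt : lam < 1).
Let lamb : 1 / 2 < lam /\ lam < 1 := conj lam_gt lam_lt.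
Let C := (1 - lam)^-1.
Variable nu : probability R R.
Hypothesis nuP : is_bernoulli_convolution lam nu.
Implicit Types (q r x : R) (A : seq R).

(** Finite families, as sequences: an [\esum] is a supremum over finite subsets, so they determine
    [Lq_Theta]. *)
Definition packing r A : Prop :=
  [/\ uniq A, forall x, x \in A -> msupport nu x
   & trivIset [set` A]%classic (fun x => closed_ball x r)].

Definition packing_sum q r A : R := \sum_(x <- A) ball_mass nu x r `^ q.

Lemma packing_le_Theta q r A : packing r A -> ((packing_sum q r A)%:E <= Lq_Theta nu q r)%E.
Proof.
move=> [uA sA tA]; apply: ereal_sup_ge; exists (\esum_(x in [set` A]%classic) poweR (nu (closed_ball x r)) q)%E.
  by exists [set` A]%classic => //; split.
rewrite esum_fset; [|exact: finite_seq|by move=> x _; exact: poweR_ge0].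
rewrite -fsbig_seq // -sumEFin le_eqVlt; apply/orP; left; apply/eqP.
by apply: eq_bigr => x _; rewrite ball_massE poweR_EFin.
Qed.

Lemma Theta_le q r (M : R) : (forall A, packing r A -> packing_sum q r A <= M) ->
  (Lq_Theta nu q r <= M%:E)%E.
Proof.
move=> H; apply: ge_ereal_sup => _ [D [sD tD] <-].
apply: ge_ereal_sup => _ [B [fB BD] <-].
rewrite fsbig_finite //= (eq_bigr (fun x => (ball_mass nu x r `^ q)%:E)); last first.
  by move=> x _; rewrite ball_massE poweR_EFin.
rewrite sumEFin lee_fin; apply: H; split.
- exact: fset_uniq.
- by move=> x; rewrite in_fset_set // inE => /BD /sD.
- move=> x y /=; rewrite !in_fset_set // !inE => /BD Dx /BD Dy; exact: tD.
Qed.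

End Packing.

Lemma scale_exists (R : realType) (lam B r : R) : 0 < lam -> lam < 1 -> 0 < r -> r <= B ->
  exists k : nat, B * lam ^+ k <= r /\ k%:R <= (ln B - ln r) / - ln lam + 1.
Proof.
move=> l0 l1 r0 rB; have B0 : 0 < B by exact: lt_le_trans rB.
have la0 : 0 < - ln lam by rewrite oppr_gt0 ln_lt0 // l0.
set y := (ln B - ln r) / - ln lam.
have y0 : 0 <= y by rewrite divr_ge0 ?subr_ge0 ?ler_ln ?posrE // ltW.
have [k [yk ky]] : exists k : nat, y < k%:R /\ k%:R <= y + 1.
  by exists (Num.truncn y).+1; rewrite truncnS_gt // -natr1 lerD2r truncn_le.
exists k; split => //.
have lk : 0 < lam ^+ k by rewrite exprn_gt0.
rewrite -ler_ln ?posrE ?mulr_gt0 // lnM ?posrE // lnXn // -[ln lam *+ _]mulr_natr.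
move: yk; rewrite /y ltr_pdivrMr //; lra.
Qed.

Section Packing.
Variables (R : realType) (lam : R).
Hypotheses (lam_gt : 1 / 2 < lam) (lam_lt : lam < 1).
Let lamb : 1 / 2 < lam /\ lam < 1 := conj lam_gt lam_lt.
Let C := (1 - lam)^-1.
Let C1 : 1 < C.
Proof.
have [l1 l2] := lamb.
by rewrite /C -[ltLHS]invr1 ltf_pV2 ?posrE //; lra.
Qed.
Variable nu : probability R R.
Hypothesis nuP : is_bernoulli_convolution lam nu.
Implicit Types (q r x : R) (A : seq R).

Lemma ball_mass_ge_expr x r k : `|x| <= C -> 2 * C * lam ^+ k <= r ->
  2 ^- k <= ball_mass nu x r.
Proof.
move=> xC kr; have [l1 l2] := lamb; have c1 := C1.
have lk : 0 < lam ^+ k by rewrite exprn_gt0; lra.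
have Clk : 0 < C * lam ^+ k by rewrite mulr_gt0 //; lra.
have r0 : 0 < r by lra.
have [u ux] := wsum_dense lam_gt lam_lt k xC.
apply: (@le_trans _ _ ((mult lam k (wsum lam u))%:R / 2 ^+ k)).
  by rewrite ler_peMl ?invr_ge0 ?exprn_ge0 // ler1n mult_gt0.
by apply: ball_mass_ge => //; rewrite -/C in ux *; lra.
Qed.

Lemma ball_mass_gt0 x r : `|x| <= C -> 0 < r -> 0 < ball_mass nu x r.
Proof.
move=> xC r0; have [l1 l2] := lamb; have c1 := C1.
have l0 : 0 < lam by lra.
have [|k [kr _]] := @scale_exists R lam (Num.max (2 * C) r) r l0 l2 r0.
  by rewrite le_max lexx orbT.
apply: (@lt_le_trans _ _ (2 ^- k)); first by rewrite invr_gt0 exprn_gt0.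
apply: ball_mass_ge_expr => //; apply: le_trans kr.
by rewrite ler_wpM2r ?exprn_ge0 ?le_max ?lexx //; lra.
Qed.

Lemma msupport_ge x : `|x| <= C -> msupport nu x.
Proof.
move=> xC U oU Ux; have [e /= e0 eU] : exists2 e : R, 0 < e & (ball x e `<=` U)%classic.
  by have /nbhs_ballP[e /= e0 eU] := open_nbhs_nbhs (conj oU Ux); exists e.
apply: (@lt_le_trans _ _ (nu (closed_ball x (e / 2)))).
  by rewrite ball_massE lte_fin ball_mass_gt0 // divr_gt0.
rewrite le_measure ?inE //; [exact: measurable_cball|exact: open_measurable|].
move=> y; rewrite closed_ball_itvE ?divr_gt0 //= in_itv /= => xy.
by apply: eU; rewrite /ball /= ltr_distlC; lra.
Qed.

Lemma msupport_le x : msupport nu x -> `|x| <= C.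
Proof.
move=> xs; rewrite leNgt; apply/negP => Cx.
pose r := (`|x| - C) / 2.
have r0 : 0 < r by rewrite divr_gt0 ?subr_gt0.
have := xs (ball x r) (ball_open x r) (ballxx _ r0); apply/negP; rewrite -leNgt.
apply: (@le_trans _ _ (nu (closed_ball x r))).
  rewrite le_measure ?inE //; [by apply: open_measurable; exact: ball_open|exact: measurable_cball|].
  exact: subset_closed_ball.
have := bernoulli_ball_le lam_gt lam_lt nuP 0 x r0.
rewrite -/C expr0 divr1 mulr1.
suff -> : #|close_words lam 0 x (r + C)| = 0%N by [].
apply: eq_card0 => u; rewrite !inE tuple0 /= sub0r normrN; apply/negP.
by rewrite /r; lra.
Qed.

Lemma packing_mem A r x : packing nu r A -> x \in A -> 0 < r -> 0 < ball_mass nu x r <= 1.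
Proof.
move=> [_ sA _] xA r0; rewrite ball_mass_le1 andbT ball_mass_gt0 //.
exact/msupport_le/sA.
Qed.

Lemma packing_size A r : packing nu r A -> 0 < r -> (size A)%:R * r <= C + r.
Proof.
move=> [uA sA tA] r0; have c1 := C1.
have bE x : lebesgue_measure (closed_ball x r : set R) = (2 * r)%:E.
  rewrite closed_ball_itvE // lebesgue_measure_itv /= lte_fin ifT; last by lra.
  by rewrite -EFinB; congr EFin; ring.
have iE : lebesgue_measure (`[(- C - r)%R, (C + r)%R]%classic : set R) = (2 * (C + r))%:E.
  rewrite lebesgue_measure_itv /= lte_fin ifT; last by lra.
  by rewrite -EFinB; congr EFin; ring.
have : (\sum_(x \in [set` A]%classic) lebesgue_measure (closed_ball x r : set R) <=
   lebesgue_measure (`[(- C - r)%R, (C + r)%R]%classic : set R))%E.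
  have mb x : [set` A]%classic x -> measurable (closed_ball x r : set R).
    by move=> _; exact: measurable_cball.
  have e : (lebesgue_measure (\bigcup_(x in [set` A]) closed_ball x r)%classic =
      \sum_(x \in [set` A]%classic) lebesgue_measure (closed_ball x r : set R))%E.
    exact: (measure_fin_bigcup (@lebesgue_measure R) (finite_seq A) tA mb).
  rewrite -e le_measure ?inE //.
    by apply: fin_bigcup_measurable => //; exact: finite_seq.
  move=> y [x /= xA]; rewrite closed_ball_itvE //= !in_itv /=.
  by have := msupport_le (sA x xA); rewrite ler_norml; lra.
rewrite -fsbig_seq // (eq_bigr (fun=> (2 * r)%:E)); last by move=> x _; exact: bE.
rewrite iE sumEFin lee_fin big_const_seq count_predT iter_addr_0.
rewrite -[(2 * r) *+ _]mulr_natr; lra.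
Qed.

Lemma packing_sum1_le A r : packing nu r A -> packing_sum nu 1 r A <= 1.
Proof.
move=> [uA sA tA]; rewrite -lee_fin.
have -> : (packing_sum nu 1 r A)%:E = (\sum_(x \in [set` A]%classic) nu (closed_ball x r))%E.
  rewrite -fsbig_seq // /packing_sum -sumEFin; apply: eq_bigr => x _.
  by rewrite ball_massE powRr1 // ball_mass_ge0.
have mb x : [set` A]%classic x -> measurable (closed_ball x r : set R).
  by move=> _; exact: measurable_cball.
have e : (nu (\bigcup_(x in [set` A]) closed_ball x r)%classic =
    \sum_(x \in [set` A]%classic) nu (closed_ball x r : set R))%E.
  exact: (measure_fin_bigcup nu (finite_seq A) tA mb).
rewrite -e; apply: probability_le1; apply: fin_bigcup_measurable; first exact: finite_seq.
by move=> x _; exact: measurable_cball.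
Qed.

Lemma packing_exists r : 0 < r -> exists A, packing nu r A /\ 2 * C / (3 * r) <= (size A)%:R.
Proof.
move=> r0; have c1 := C1; set y := 2 * C / (3 * r).
have y0 : 0 <= y by rewrite divr_ge0 ?mulr_ge0 //; lra.
(* Spacing 3 r, since closed balls with centers at distance 2 r meet. *)
pose pt i := - C + 3 * r * i%:R.
exists [seq pt i | i <- iota 0 (Num.truncn y).+1]; split; last first.
  by rewrite size_map size_iota ltW // truncnS_gt.
have ptD i j : (i < j)%N -> pt i + 3 * r <= pt j.
  move=> ij; have : i%:R + 1 <= j%:R :> R by rewrite natr1 ler_nat.
  rewrite /pt => h; have : 3 * r * (i%:R + 1) <= 3 * r * j%:R by rewrite ler_pM2l ?mulr_gt0.
  lra.
split.
- rewrite map_inj_uniq ?iota_uniq // => i j ij.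
  by have [/ptD h|/ptD h|//] := ltngtP i j; exfalso; move: h; rewrite ij; lra.
- move=> x /mapP[i]; rewrite mem_iota add0n /= => iy ->; apply: msupport_ge.
  have : i%:R <= y.
    apply: (@le_trans _ _ (Num.truncn y)%:R); last by rewrite truncn_le y0.
    by rewrite ler_nat -ltnS.
  rewrite /y ler_pdivlMr ?mulr_gt0 // /pt ler_norml => h.
  by have : 0 <= 3 * r * i%:R by [rewrite !mulr_ge0 // ltW]; lra.
- move=> x1 x2 x1A x2A [z []].
  have /mapP[i _ ->] : x1 \in [seq pt i | i <- iota 0 (Num.truncn y).+1] := x1A.
  have /mapP[j _ ->] : x2 \in [seq pt i | i <- iota 0 (Num.truncn y).+1] := x2A.
  rewrite !closed_ball_itvE //= !in_itv /= => h1 h2.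
  by have [/ptD h|/ptD h|-> //] := ltngtP i j; exfalso; lra.
Qed.

Definition lnTheta q r : R := ln (fine (Lq_Theta nu q r)).

Lemma packing_sum_le_size A q r : packing nu r A -> 0 < r -> 0 <= q ->
  packing_sum nu q r A <= (size A)%:R.
Proof.
move=> pA r0 q0; apply: (@le_trans _ _ (\sum_(x <- A) (1 : R))).
  rewrite /packing_sum big_seq [leRHS]big_seq; apply: ler_sum => x xA.
  have /andP[b0 b1] := packing_mem pA xA r0.
  have -> : 1 = 1 `^ q :> R by rewrite powR1.
  by apply: ge0_ler_powR; rewrite ?nnegrE ?(ltW b0).
by rewrite big_const_seq count_predT iter_addr_0.
Qed.

Lemma Theta_le_inv q r : 0 < r -> r < 1 -> 0 <= q ->
  (Lq_Theta nu q r <= ((C + 1) / r)%:E)%E.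
Proof.
move=> r0 r1 q0; apply: Theta_le => A pA; rewrite (le_trans (packing_sum_le_size pA r0 q0)) //.
rewrite ler_pdivlMr //; have := packing_size pA r0; lra.
Qed.

Lemma Theta_ge q r : 0 < r -> r < 1 -> 0 <= q ->
  ((2 * C / (3 * r) * expR (- q * (ln 2 * ((ln (2 * C) - ln r) / - ln lam + 1))))%:E
    <= Lq_Theta nu q r)%E.
Proof.
move=> r0 r1 q0; have [l1 l2] := lamb; have c1 := C1.
have [A [pA sA]] := packing_exists r0.
apply: le_trans (packing_le_Theta q pA); rewrite lee_fin.
have l0 : 0 < lam by lra.
have [|k [kr kle]] := @scale_exists R lam (2 * C) r l0 l2 r0; first by lra.
set E := expR _.
apply: (@le_trans _ _ (\sum_(x <- A) E)).
  rewrite big_const_seq count_predT iter_addr_0 -[E *+ _]mulr_natl ler_wpM2r //.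
  exact: expR_ge0.
rewrite /packing_sum big_seq [leRHS]big_seq; apply: ler_sum => x xA.
have /andP[b0 b1] := packing_mem pA xA r0.
have bk : 2 ^- k <= ball_mass nu x r.
  by apply: ball_mass_ge_expr => //; have [_ sP _] := pA; exact/msupport_le/sP.
rewrite /powR gt_eqF // ler_expR mulNr -mulrN ler_wpM2l //.
have : ln (2 ^- k) <= ln (ball_mass nu x r).
  by rewrite ler_ln ?posrE ?invr_gt0 ?exprn_gt0.
rewrite lnV ?posrE ?exprn_gt0 // lnXn // -[ln 2 *+ _]mulr_natr.
have ln20 : 0 <= ln 2 :> R by rewrite ln_ge0 // ler1n.
have : ln 2 * k%:R <= ln 2 * ((ln (2 * C) - ln r) / - ln lam + 1) by rewrite ler_wpM2l.
lra.
Qed.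

Lemma Theta_pos q r : 0 < r -> r < 1 -> 0 <= q ->
  0 < fine (Lq_Theta nu q r) /\ Lq_Theta nu q r = (fine (Lq_Theta nu q r))%:E.
Proof.
move=> r0 r1 q0; have c1 := C1.
have ge := Theta_ge r0 r1 q0; have le := Theta_le_inv r0 r1 q0.
have fin : Lq_Theta nu q r \is a fin_num.
  rewrite fin_numElt (lt_le_trans _ ge) ?ltNyr //=; exact: le_lt_trans le (ltry _).
split; last by rewrite fineK.
rewrite -lte_fin fineK // (lt_le_trans _ ge) // lte_fin mulr_gt0 ?expR_gt0 //.
by rewrite divr_gt0 ?mulr_gt0 //; lra.
Qed.

Lemma lnTheta_le q r : 0 < r -> r < 1 -> 0 <= q ->
  lnTheta q r <= ln (C + 1) - ln r.
Proof.
move=> r0 r1 q0; have [T0 TE] := Theta_pos r0 r1 q0; have c1 := C1.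
have Cp : 0 < C + 1 by lra.
have := Theta_le_inv r0 r1 q0; rewrite TE lee_fin => le.
by rewrite -ln_div ?posrE // /lnTheta ler_ln ?posrE // divr_gt0.
Qed.

Lemma lnTheta1_le0 r : 0 < r -> r < 1 -> lnTheta 1 r <= 0.
Proof.
move=> r0 r1; rewrite /lnTheta ln_le0 // -lee_fin; have [_ <-] := Theta_pos r0 r1 (@ler01 R).
by apply: Theta_le => A; exact: packing_sum1_le.
Qed.

Lemma lnTheta_ge q r : 0 < r -> r < 1 -> 0 <= q ->
  ln (2 * C / 3) - ln r - q * (ln 2 * ((ln (2 * C) - ln r) / - ln lam + 1)) <= lnTheta q r.
Proof.
move=> r0 r1 q0; have [T0 TE] := Theta_pos r0 r1 q0; have c1 := C1.
have Cp : 0 < 2 * C / 3 by lra.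
have := Theta_ge r0 r1 q0; rewrite TE lee_fin => ge.
rewrite -ln_div ?posrE // -mulNr -[X in _ + X]expRK -lnM ?posrE ?divr_gt0 ?expR_gt0 //.
have e : 2 * C / 3 / r = 2 * C / (3 * r) by field; rewrite gt_eqF.
have p : 0 < 2 * C / (3 * r) by rewrite -e divr_gt0.
by rewrite e /lnTheta ler_ln ?posrE ?(mulr_gt0 p) ?expR_gt0.
by have [l1 l2] := lamb; lra.
Qed.

Lemma lnTheta_lp_mono q q' r : 0 < r -> r < 1 -> 0 < q -> q <= q' ->
  lnTheta q' r <= q' / q * lnTheta q r.
Proof.
move=> r0 r1 q0 qq'; have q'0 : 0 < q' by exact: lt_le_trans qq'.
have [T0 TE] := Theta_pos r0 r1 (ltW q0); have [T0' TE'] := Theta_pos r0 r1 (ltW q'0).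
rewrite /lnTheta -ln_powR ler_ln ?posrE ?powR_gt0 // -lee_fin -TE'.
apply: Theta_le => A pA.
have b0 x : x \in A -> 0 <= ball_mass nu x r by move=> _; exact: ball_mass_ge0.
apply: (le_trans (sum_powR_lp_mono b0 q0 qq')).
apply: ge0_ler_powR; rewrite ?nnegrE ?divr_ge0 ?(ltW q0) ?(ltW q'0) ?(ltW T0) //.
  by apply: sumr_ge0 => x _; exact: powR_ge0.
by rewrite -lee_fin -TE; exact: (packing_le_Theta q pA).
Qed.

Lemma lnTheta_interpolate q t r : 0 < r -> r < 1 -> 0 <= q -> 0 <= t <= 1 ->
  lnTheta (t * q) r <= t * lnTheta q r + (1 - t) * lnTheta 0 r.
Proof.
move=> r0 r1 q0 /[dup] t01 /andP[t0 t1].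
have [T0 TE] := Theta_pos r0 r1 q0; have [Tz TzE] := Theta_pos r0 r1 (lexx (0 : R)).
have [Tt TtE] := Theta_pos r0 r1 (mulr_ge0 t0 q0).
rewrite /lnTheta -!ln_powR -lnM ?posrE ?powR_gt0 // ler_ln ?posrE ?mulr_gt0 ?powR_gt0 //.
rewrite -lee_fin -TtE; apply: Theta_le => A pA.
have [->|An] := eqVneq A [::].
  by rewrite /packing_sum big_nil mulr_ge0 ?powR_ge0.
have b0 x : x \in A -> 0 < ball_mass nu x r.
  by move=> xA; have /andP[] := packing_mem pA xA r0.
apply: (le_trans (sum_powR_interpolate q b0 t01 An)).
have sA : (size A)%:R <= fine (Lq_Theta nu 0 r).
  rewrite -lee_fin -TzE; apply: le_trans (packing_le_Theta 0 pA).
  rewrite /packing_sum; under eq_bigr => x _ do rewrite powRr0.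
  by rewrite big_const_seq count_predT iter_addr_0.
rewrite ler_pM ?powR_ge0 // ge0_ler_powR ?nnegrE ?subr_ge0 ?(ltW T0) ?(ltW Tz) //.
  by apply: sumr_ge0 => x _; exact: powR_ge0.
by rewrite -lee_fin -TE; exact: (packing_le_Theta q pA).
Qed.

(** A single ball, centered at a sum of large multiplicity, is already a packing. *)
Lemma lnTheta_ge_max (g' K0 : R) : g' <= ln 2 ->
  (forall k, exists u : k.-tuple bool, g' * k%:R - K0 <= ln (mult lam k (wsum lam u))%:R) ->
  forall q r, 0 < r -> r < 1 -> 0 <= q ->
  - q * ((ln 2 - g') * ((ln C - ln r) / - ln lam + 1) + K0) <= lnTheta q r.
Proof.
move=> g2 H q r r0 r1 q0; have [l1 l2] := lamb; have c1 := C1.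
have [T0 TE] := Theta_pos r0 r1 q0.
have l0 : 0 < lam by lra.
have [|k [kr kle]] := @scale_exists R lam C r l0 l2 r0; first by lra.
have [u hu] := H k.
have xC := normr_wsum lam_gt lam_lt u; rewrite -/C in xC.
have bm : (mult lam k (wsum lam u))%:R / 2 ^+ k <= ball_mass nu (wsum lam u) r.
  by apply: ball_mass_ge => //; rewrite subrr normr0 add0r.
have m0 : 0 < (mult lam k (wsum lam u))%:R :> R by rewrite ltr0n mult_gt0.
have b0 : 0 < ball_mass nu (wsum lam u) r by rewrite (lt_le_trans _ bm) // divr_gt0 ?exprn_gt0.
have pA : packing nu r [:: wsum lam u].
  split => //; first by move=> x; rewrite inE => /eqP ->; exact: msupport_ge.
  by move=> x y /=; rewrite !inE => /eqP -> /eqP ->.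
have := packing_le_Theta q pA; rewrite TE lee_fin /packing_sum big_seq1 => le.
have : ln (ball_mass nu (wsum lam u) r `^ q) <= lnTheta q r.
  by rewrite /lnTheta ler_ln ?posrE ?powR_gt0.
apply: le_trans; rewrite ln_powR mulNr -mulrN ler_wpM2l //.
have : ln ((mult lam k (wsum lam u))%:R / 2 ^+ k) <= ln (ball_mass nu (wsum lam u) r).
  by rewrite ler_ln ?posrE // divr_gt0 ?exprn_gt0.
rewrite ln_div ?posrE ?exprn_gt0 // lnXn // -[ln 2 *+ _]mulr_natr.
have : (ln 2 - g') * k%:R <= (ln 2 - g') * ((ln C - ln r) / - ln lam + 1).
  by rewrite ler_wpM2l // subr_ge0.
lra.
Qed.

End Packing.

(** * The spectrum *)

Section Liminf.
Variables (R : realType) (f : R -> \bar R).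

Lemma limf_einf_ge (c : R) :
  (forall e, 0 < e -> \forall r \near 0^'+, ((c - e)%:E <= f r)%E)%classic ->
  (c%:E <= limf_einf f 0^'+)%E.
Proof.
move=> H; rewrite limf_einfE; apply/lee_subgt0Pr => e e0.
apply: ereal_sup_ge; exists (ereal_inf [set f x | x in [set r | (c - e)%:E <= f r]%E])%classic.
  by exists [set r | (c - e)%:E <= f r]%E%classic => //; exact: H.
by apply: le_ereal_inf_tmp => _ [r /= cr <-]; rewrite -EFinB.
Qed.

Lemma limf_einf_le (c : R) :
  (forall e, 0 < e -> \forall r \near 0^'+, (f r <= (c + e)%:E)%E)%classic ->
  (limf_einf f 0^'+ <= c%:E)%E.
Proof.
move=> H; apply/lee_addgt0Pr => e e0; rewrite limf_einfE.
apply: ge_ereal_sup => _ [V FV <-].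
have : (\forall r \near (0 : R)^'+, V r /\ (f r <= (c + e)%:E)%E)%classic.
  by apply: filterI => //; exact: H.
move=> /filter_ex [r [Vr fr]]; rewrite -EFinD; apply: le_trans fr.
by apply: ereal_inf_lbound; exists r.
Qed.

Lemma limf_einf_near (t e : R) : limf_einf f 0^'+ = t%:E -> 0 < e ->
  (\forall r \near 0^'+, ((t - e)%:E <= f r)%E)%classic.
Proof.
move=> ft e0; have : ((t - e)%:E < limf_einf f 0^'+)%E by rewrite ft lte_fin ltrBlDr ltrDl.
rewrite limf_einfE => /ereal_sup_gt[_ [V FV <-] tV].
near=> r; apply: (le_trans (ltW tV)); apply: ereal_inf_lbound; exists r => //.
by near: r; exact: FV.
Unshelve. all: by end_near.
Qed.

End Liminf.

Lemma near0_ln_le (R : realType) (B : R) (A : R -> Prop) :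
  (forall r, 0 < r -> r < 1 -> B <= - ln r -> A r) ->
  (\forall r \near 0^'+, A r)%classic.
Proof.
move=> H; apply: (@near_at_right0 _ _ (Num.min 1 (expR (- B)))).
  by rewrite lt_min ltr01 expR_gt0.
move=> r r0; rewrite lt_min => /andP[r1 rB]; apply: H => //.
by rewrite lerNr -[- B]expRK ler_ln ?posrE ?expR_gt0 // ltW.
Qed.

Section Spectrum.
Variables (R : realType) (lam : R).
Hypotheses (lam_gt : 1 / 2 < lam) (lam_lt : lam < 1).
Let lamb : 1 / 2 < lam /\ lam < 1 := conj lam_gt lam_lt.
Let C := (1 - lam)^-1.
Variable nu : probability R R.
Hypothesis nuP : is_bernoulli_convolution lam nu.
Implicit Types (q r : R).

Let f q r : \bar R := (lne (Lq_Theta nu q r) / (ln r)%:E)%E.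

Let fE q r : 0 < r -> r < 1 -> 0 <= q -> f q r = (- (lnTheta nu q r / - ln r))%:E.
Proof.
move=> r0 r1 q0; have [T0 TE] := Theta_pos lam_gt lam_lt nuP r0 r1 q0.
have lr : ln r < 0 by rewrite ln_lt0 // r0.
rewrite /f TE lne_EFin // inver lt_eqF // -/(lnTheta nu q r) -EFinM.
by congr EFin; field; rewrite lt_eqF.
Qed.

Let lnr r : 0 < r -> r < 1 -> 0 < - ln r.
Proof. by move=> r0 r1; rewrite oppr_gt0 ln_lt0 // r0. Qed.

Lemma spectrum_ge q (c d : R) : 0 <= q ->
  (forall r, 0 < r -> r < 1 -> lnTheta nu q r <= - c * - ln r + d) ->
  (c%:E <= Lq_spectrum nu q)%E.
Proof.
move=> q0 H; apply: limf_einf_ge => e e0.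
apply: (@near0_ln_le _ (`|d| / e)) => r r0 r1 Br.
rewrite -/(f q r) fE // lee_fin lerNr ler_pdivrMr ?lnr //.
have := H r r0 r1; rewrite ler_pdivrMr // in Br; have := ler_norm d; lra.
Qed.

Lemma spectrum_le q (c d : R) : 0 <= q ->
  (forall r, 0 < r -> r < 1 -> - c * - ln r - d <= lnTheta nu q r) ->
  (Lq_spectrum nu q <= c%:E)%E.
Proof.
move=> q0 H; apply: limf_einf_le => e e0.
apply: (@near0_ln_le _ (`|d| / e)) => r r0 r1 Br.
rewrite -/(f q r) fE // lee_fin lerNl ler_pdivlMr ?lnr //.
have := H r r0 r1; rewrite ler_pdivrMr // in Br; have := ler_norm d; lra.
Qed.

(** Dividing by ln r < 0 reverses the inequality between the Theta functions; as k >= 0, a lower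
    bound near 0 for the quotient at q becomes one at q', and d disappears in the limit. *)
Lemma spectrum_compare q q' (t k c d : R) : 0 <= q -> 0 <= q' -> 0 <= k ->
  Lq_spectrum nu q = t%:E ->
  (forall r, 0 < r -> r < 1 ->
     lnTheta nu q' r <= k * lnTheta nu q r - c * - ln r + d) ->
  ((k * t + c)%:E <= Lq_spectrum nu q')%E.
Proof.
move=> q0 q'0 k0 tE H; apply: limf_einf_ge => e e0.
have e20 : 0 < e / 2 / (k + 1) by rewrite !divr_gt0 //; lra.
have h1 := limf_einf_near tE e20.
have h2 : (\forall r \near 0^'+, [/\ 0 < r, r < 1 & `|d| / (e / 2) <= - ln r])%classic.
  by apply: (@near0_ln_le _ (`|d| / (e / 2))) => r r0 r1 Br.
near=> r.
have [r0 r1 Br] : [/\ 0 < r, r < 1 & `|d| / (e / 2) <= - ln r] by near: r.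
have : ((t - e / 2 / (k + 1))%:E <= f q r)%E by near: r.
have u0 := lnr r0 r1.
rewrite -/(f q' r) !fE // !lee_fin lerNr ler_pdivrMr // => h.
rewrite lerNr ler_pdivrMr //.
have h3 : k * lnTheta nu q r <= k * (- (t - e / 2 / (k + 1)) * - ln r) by rewrite ler_wpM2l.
have := H r r0 r1; rewrite ler_pdivrMr ?divr_gt0 // in Br; have dn := ler_norm d.
have ke : k * (e / 2 / (k + 1)) <= e / 2.
  by rewrite mulrA ler_pdivrMr ?ltr_wpDl // mulrC ler_wpM2l; lra.
have : 0 <= (e / 2 - k * (e / 2 / (k + 1))) * - ln r by rewrite mulr_ge0 ?subr_ge0 // ltW.
lra.
Unshelve. all: by end_near.
Qed.

Definition spectrum q : R := fine (Lq_spectrum nu q).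

Lemma spectrum_fin : exists2 A : R, 0 <= A & forall q, 0 <= q ->
  Lq_spectrum nu q = (spectrum q)%:E /\ - 1 <= spectrum q <= - 1 + q * A.
Proof.
have [l1 l2] := lamb.
have la0 : 0 < - ln lam by rewrite oppr_gt0 ln_lt0 //; lra.
have ln20 : 0 <= ln 2 :> R by rewrite ln_ge0 // ler1n.
exists (ln 2 / - ln lam); first by rewrite divr_ge0 // ltW.
move=> q q0.
have ge : ((- 1)%:E <= Lq_spectrum nu q)%E.
  apply: (@spectrum_ge _ _ (ln (C + 1))) => // r r0 r1.
  by have := lnTheta_le lam_gt lam_lt nuP r0 r1 q0; rewrite -/C; lra.
have le : (Lq_spectrum nu q <= (- 1 + q * (ln 2 / - ln lam))%:E)%E.
  apply: (@spectrum_le _ _ (q * (ln 2 * (ln (2 * C) / - ln lam + 1)) - ln (2 * C / 3))) => // r r0 r1.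
  have := lnTheta_ge lam_gt lam_lt nuP r0 r1 q0; rewrite -/C.
  set v := (- ln lam)^-1; lra.
have fin : Lq_spectrum nu q \is a fin_num.
  by rewrite fin_numElt (lt_le_trans _ ge) ?ltNyr //= (le_lt_trans le) ?ltry.
by rewrite /spectrum fineK // -!lee_fin fineK // ge le.
Qed.

Lemma spectrum0 : spectrum 0 = - 1.
Proof.
have [A A0 H] := spectrum_fin; have [_ /andP[]] := H 0 (lexx 0).
by rewrite mul0r addr0 => h1 h2; apply/le_anti/andP.
Qed.

Lemma spectrum1_ge0 : 0 <= spectrum 1.
Proof.
have [A A0 H] := spectrum_fin; have [E _] := H 1 ler01.
rewrite -lee_fin -E; apply: (@spectrum_ge _ _ 0) => // r r0 r1.
by rewrite oppr0 mul0r add0r; exact: (lnTheta1_le0 lam_gt lam_lt nuP).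
Qed.

Lemma spectrum_div_mono q q' : 0 < q -> q <= q' -> spectrum q / q <= spectrum q' / q'.
Proof.
move=> q0 qq'; have q'0 : 0 < q' by exact: lt_le_trans qq'.
have [A A0 H] := spectrum_fin; have [E _] := H q (ltW q0); have [E' _] := H q' (ltW q'0).
rewrite ler_pdivlMr // mulrAC -mulrA mulrC -[X in X <= _]addr0 -lee_fin -E'.
apply: (spectrum_compare (d := 0) (ltW q0) (ltW q'0) _ E) => [|r r0 r1].
  by rewrite divr_ge0 // ltW.
by rewrite mul0r subr0 addr0; exact: (lnTheta_lp_mono lam_gt lam_lt nuP).
Qed.

(** Concavity on segments starting at 0, where tau(0) = - 1; it makes (tau(q) + 1) / q
    nonincreasing. *)
Lemma spectrum_concave0 q t : 0 <= q -> 0 <= t <= 1 ->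
  t * spectrum q - (1 - t) <= spectrum (t * q).
Proof.
move=> q0 /[dup] t01 /andP[t0 t1].
have [A A0 H] := spectrum_fin; have [E _] := H q q0; have [E' _] := H (t * q) (mulr_ge0 t0 q0).
rewrite -lee_fin -E'.
apply: (spectrum_compare (d := (1 - t) * ln (C + 1)) q0 (mulr_ge0 t0 q0) t0 E) => r r0 r1.
have := lnTheta_interpolate lam_gt lam_lt nuP r0 r1 q0 t01.
have h := lnTheta_le lam_gt lam_lt nuP r0 r1 (lexx 0); rewrite -/C in h.
have : (1 - t) * lnTheta nu 0 r <= (1 - t) * (ln (C + 1) - ln r) by rewrite ler_wpM2l ?subr_ge0.
lra.
Qed.

(** The quotient (tau(q) + 1) / q is monotone and bounded, so its limit at 0+ is its supremum, which
    is at least its value tau(1) + 1 at q = 1. *)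
Lemma slope_right0 : exists2 b : R, 1 <= b & is_Lq_right_derivative0 nu b.
Proof.
have [A A0 H] := spectrum_fin.
pose s q := (spectrum q + 1) / q.
have smono q q' : 0 < q -> q <= q' -> s q' <= s q.
  move=> q0 qq'; have q'0 : 0 < q' by exact: lt_le_trans qq'.
  have := @spectrum_concave0 q' (q / q') (ltW q'0).
  rewrite divfK ?gt_eqF // divr_ge0 ?(ltW q0) ?(ltW q'0) //= ler_pdivrMr // mul1r => /(_ qq') h.
  rewrite /s ler_pdivlMr // -lerBlDr; apply: le_trans h.
  by rewrite le_eqVlt; apply/orP; left; apply/eqP; ring.
have sA q : 0 < q -> s q <= A.
  move=> q0; have [_ /andP[_ h]] := H q (ltW q0).
  by rewrite /s ler_pdivrMr // mulrC; lra.
pose b := sup [set s q | q in [set q | 0 < q]]%classic.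
have hs : has_sup [set s q | q in [set q | 0 < q]]%classic.
  by split; [exists (s 1), 1 => //=; exact: ltr01|exists A => _ [q q0 <-]; exact: sA].
have sb q : 0 < q -> s q <= b.
  by move=> q0; apply: sup_upper_bound => //; exists q.
exists b.
  by apply: le_trans (sb 1 ltr01); rewrite /s divr1 lerDr spectrum1_ge0.
rewrite /is_Lq_right_derivative0.
have near_fin : (\forall q \near 0^'+, (s q)%:E =
    (Lq_spectrum nu q - Lq_spectrum nu 0) / q%:E)%classic%E.
  apply: (@near_at_right0 _ _ 1) => // q q0 q1.
  have [-> _] := H q (ltW q0); have [-> _] := H 0 (lexx 0).
  by rewrite spectrum0 inver gt_eqF // -EFinB opprK -EFinM.
apply: cvg_trans; first exact: (near_eq_cvg near_fin).
apply: cvg_EFin; first by near=> r.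
rewrite /comp /=; apply/cvgrPdist_le => e e0.
have [_ [q1 q10 <-] bq1] := sup_adherent e0 hs.
apply: (@near_at_right0 _ _ q1) => // q q0 qq1.
have sqb : s q <= b := sb q q0.
have sqq : s q1 <= s q := smono q q1 q0 (ltW qq1).
by rewrite ger0_norm ?subr_ge0 // lerBlDr -lerBlDl ltW // (lt_le_trans bq1 sqq).
Unshelve. all: by end_near.
Qed.

(** By monotonicity of l^p norms tau(q) / q is nondecreasing, so the limit is its supremum; one ball
    around a sum of large multiplicity keeps it below D < 1. *)
Lemma slope_pinfty (g' K0 : R) : ln (2 * lam) < g' ->
  (forall k, exists u : k.-tuple bool, g' * k%:R - K0 <= ln (mult lam k (wsum lam u))%:R) ->
  exists2 a : R, a < 1 & is_Lq_slope_pinfty nu a.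
Proof.
move=> gg' gK; have [l1 l2] := lamb.
have la0 : 0 < - ln lam by rewrite oppr_gt0 ln_lt0 //; lra.
have [A A0 H] := spectrum_fin.
pose g := Num.min g' (ln 2).
have [gle g2] : g <= g' /\ g <= ln 2 by rewrite !ge_min !lexx orbT.
have gl : ln (2 * lam) < g by rewrite lt_min gg' ltr_ln ?posrE //; lra.
have {}gK k : exists u : k.-tuple bool, g * k%:R - K0 <= ln (mult lam k (wsum lam u))%:R.
  have [u hu] := gK k; exists u; apply: le_trans hu.
  by rewrite lerD2r ler_wpM2r.
pose D := (ln 2 - g) / - ln lam.
have D1 : D < 1.
  rewrite /D ltr_pdivrMr // mul1r; move: gl; rewrite lnM ?posrE //; lra.
pose s q := spectrum q / q.
have sD q : 0 < q -> s q <= D.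
  move=> q0; have [E _] := H q (ltW q0).
  rewrite /s ler_pdivrMr // -lee_fin -E.
  apply: (@spectrum_le _ _ (q * ((ln 2 - g) * (ln C / - ln lam + 1) + K0))) => [|r r0 r1].
    exact: ltW.
  have := lnTheta_ge_max lam_gt lam_lt nuP g2 gK r0 r1 (ltW q0); rewrite -/C /D.
  set v := (- ln lam)^-1; lra.
pose a := sup [set s q | q in [set q | 0 < q]]%classic.
have hs : has_sup [set s q | q in [set q | 0 < q]]%classic.
  by split; [exists (s 1), 1 => //=; exact: ltr01|exists D => _ [q q0 <-]; exact: sD].
have sa q : 0 < q -> s q <= a.
  by move=> q0; apply: sup_upper_bound => //; exists q.
exists a.
  apply: le_lt_trans D1; apply: ge_sup; first by exists (s 1), 1 => //=; exact: ltr01.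
  by move=> _ [q q0 <-]; exact: sD.
rewrite /is_Lq_slope_pinfty.
have near_fin : (\forall q \near +oo%R, (s q)%:E = Lq_spectrum nu q / q%:E)%classic%E.
  near=> q; have q0 : 0 < q by near: q; exact: nbhs_pinfty_gt.
  by have [-> _] := H q (ltW q0); rewrite inver gt_eqF // -EFinM.
apply: cvg_trans; first exact: (near_eq_cvg near_fin).
apply: cvg_EFin; first by near=> r.
rewrite /comp /=; apply/cvgrPdist_le => e e0.
have [_ [q1 q10 <-] bq1] := sup_adherent e0 hs.
near=> q; have qq1 : q1 <= q by near: q; apply: nbhs_pinfty_ge; exact: num_real.
have sqa : s q <= a := sa q (lt_le_trans q10 qq1).
have sqq : s q1 <= s q := spectrum_div_mono q10 qq1.
by rewrite ger0_norm ?subr_ge0 // lerBlDr -lerBlDl ltW // (lt_le_trans bq1 sqq).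
Unshelve. all: by end_near.
Qed.

End Spectrum.

Local Open Scope classical_set_scope.
Local Open Scope ring_scope.

Theorem theorem1p2 (R : realType) (n : nat) (beta : R) (nu : probability R R) :
  (4 <= n)%N ->
  is_largest_root (beta_poly R n) beta ->
  is_bernoulli_convolution beta^-1 nu ->
  (exists a b : R,
     [/\ is_Lq_slope_pinfty nu a, is_Lq_right_derivative0 nu b,
         a < 1 & 1 <= b]) /\
  (exists a b : R,
     a < b /\ `[a, b] `<=` [set alpha | local_dim_set nu alpha !=set0]).
Proof.
move=> n4 br nuP; have [l1 l2] := salem_bounds n4 br.
split.
  have [g' [K0 [gg' gK]]] := salem_max_mult n4 br.
  have [a a1 sa] := slope_pinfty l1 l2 nuP gg' gK.
  have [b b1 sb] := slope_right0 l1 l2 nuP.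
  by exists a, b.
have [ga [gb [gab gb2 typ]]] := salem_typical_words n4 br.
pose La := - ln beta^-1.
have La0 : 0 < La by rewrite /La oppr_gt0 ln_lt0 // l2 andbT; lra.
(* The dimension decreases in g, so the endpoints change places. *)
exists ((ln 2 - gb) / La), ((ln 2 - ga) / La); split.
  by rewrite ltr_pM2r ?invr_gt0 //; lra.
move=> al /=; rewrite in_itv /= ler_pdivrMr // ler_pdivlMr // => /andP[h1 h2].
have gE : al = (ln 2 - (ln 2 - al * La)) / La by field; rewrite gt_eqF.
rewrite gE; apply: (local_dim_typical l1 l2 nuP); first by lra.
by apply: typ; lra.
Qed.
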